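(* Let $\lambda,c,L>0$, let $\Gamma=\{(x,y)\in\mathbb{R}^2:\ 0\le y\le L\}$, let $(X(t),Y(t))$ be the planar random motion with orthogonal directions $d_0,d_1,d_2,d_3$, velocity $c$ and switching rate $\lambda$, and let $\tau=\inf\{t>0:\ (X(t),Y(t))\notin\Gamma\}$. For $j=0,1,2,3$ let $u_j(x,y;z)$ be the (generalized) density in $z\in\mathbb{R}$ given by $$u_j(x,y;z)\,\mathrm{d}z=\mathbb{P}\big(X(\tau)\in\mathrm{d}z,\ Y(\tau)=0\,\big|\,X(0)=x,\ Y(0)=y,\ D(0)=d_j\big).$$ Then for $x\in\mathbb{R}$ and $0<y<L$ these densities are given by $$u_1(x,y;z)=\frac{2\lambda}{c\pi}\int_0^1\frac{\cos\left(\frac{(z-x)\lambda w}{c\sqrt{1-w^2}}\right)\sinh\left(\frac{\lambda(L-y)}{c}w\right)}{(1+w)^2e^{\frac{\lambda L}{c}w}-(1-w)^2e^{-\frac{\lambda L}{c}w}}\,\frac{\mathrm{d}w}{\sqrt{1-w^2}},$$ $$\begin{aligned}u_3(x,y;z)=\;&e^{-\frac{\lambda y}{c}}\delta(z-x)+\frac{\lambda}{c\pi}\int_0^1\cos\left(\frac{(z-x)\lambda w}{c\sqrt{1-w^2}}\right)\\&\cdot\left[\frac{(1+w)^2e^{\frac{\lambda(L-y)}{c}w}-(1-w)^2e^{-\frac{\lambda(L-y)}{c}w}}{(1+w)^2e^{\frac{\lambda L}{c}w}-(1-w)^2e^{-\frac{\lambda L}{c}w}}-e^{-\frac{\lambda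 y}{c}}\right]\frac{\mathrm{d}w}{(1-w^2)^{3/2}},\end{aligned}$$ $$\begin{aligned}u_0(x,y;z)=\frac{\lambda}{c\pi}\int_0^1&\frac{\sqrt{1-w^2}\cos\left(\frac{(z-x)\lambda w}{c\sqrt{1-w^2}}\right)+w\sin\left(\frac{(z-x)\lambda w}{c\sqrt{1-w^2}}\right)}{1-w^2}\\&\cdot\frac{(1+w)e^{\frac{\lambda(L-y)}{c}w}-(1-w)e^{-\frac{\lambda(L-y)}{c}w}}{(1+w)^2e^{\frac{\lambda L}{c}w}-(1-w)^2e^{-\frac{\lambda L}{c}w}}\,\mathrm{d}w,\end{aligned}$$ $$\begin{aligned}u_2(x,y;z)=\frac{\lambda}{c\pi}\int_0^1&\frac{\sqrt{1-w^2}\cos\left(\frac{(z-x)\lambda w}{c\sqrt{1-w^2}}\right)-w\sin\left(\frac{(z-x)\lambda w}{c\sqrt{1-w^2}}\right)}{1-w^2}\\&\cdot\frac{(1+w)e^{\frac{\lambda(L-y)}{c}w}-(1-w)e^{-\frac{\lambda(L-y)}{c}w}}{(1+w)^2e^{\frac{\lambda L}{c}w}-(1-w)^2e^{-\frac{\lambda L}{c}w}}\,\mathrm{d}w.\end{aligned}$$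
   Context: Planar motion with orthogonal directions: the admissible directions are $d_j=(\cos(\pi j/2),\sin(\pi j/2))$, $j=0,1,2,3$ (indices modulo 4). At time $0$ the particle is at $(x,y)$ and picks one of the four directions with probability $\frac14$ each. It moves with constant speed $c>0$; at each event of a homogeneous Poisson process with intensity $\lambda>0$, independent of the initial direction, it turns from the current direction $d_j$ to $d_{j-1}$ or to $d_{j+1}$, each with probability $\frac12$, independently of everything else. $D(t)$ is the direction at time $t$. $\delta$ is the Dirac delta: the formula for $u_3$ means that the exit law on the lower boundary is the sum of an atom of mass $e^{-\lambda y/c}$ at $z=x$ and an absolutely continuous measure with the indicated density. Integrals over $(0,1)$ are improper Riemann integrals (limits as the upper endpoint tends to $1^-$), and, as usual for densities, the formulas identify the densities up to Lebesgue-null sets of $z$. *)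

(* Defs.v *)
From mathcomp Require Import all_boot all_order all_algebra finmap.
From mathcomp Require Import all_classical all_reals all_analysis.

Set Implicit Arguments.
Unset Strict Implicit.
Unset Printing Implicit Defensive.

Import Order.TTheory GRing.Theory Num.Theory.
Import numFieldNormedType.Exports.

Local Open Scope classical_set_scope.
Local Open Scope ring_scope.

Definition mutually_independent d (Omega : measurableType d) (R : realType)
    (P : probability Omega R) (I : choiceType) (F : I -> set (set Omega)) :=
  forall (J : {fset I}) (E : I -> set Omega),
    (forall i, i \in J -> F i (E i)) ->
    P (\bigcap_(i in [set` J]) E i) = (\prod_(i <- J) P (E i))%E.

(* Directions are indexed by 'Z_4, so that j + 1 and j - 1 are modulo 4. *)
Definition dir_x (R : realType) (j : 'Z_4) : R := cos (pi * (j : nat)%:R / 2).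
Definition dir_y (R : realType) (j : 'Z_4) : R := sin (pi * (j : nat)%:R / 2).

(* The motion is driven by the initial direction J0, the waiting times T 0,
   T 1, ... between consecutive events of the Poisson process, and the outcomes
   turn 0, turn 1, ... (true: d_j becomes d_{j+1}; false: d_j becomes d_{j-1}).
   Index None stands for J0, inl n for T n, inr n for turn n. *)
Definition driver_events d (Omega : measurableType d) (R : realType)
    (P : probability Omega R) (J0 : Omega -> 'Z_4)
    (T : nat -> {RV P >-> R}) (turn : nat -> {RV P >-> bool})
    (i : option (nat + nat)) : set (set Omega) :=
  match i with
  | None => preimage_set_system setT J0 setT
  | Some (inl n) => preimage_set_system setT (T n) measurable
  | Some (inr n) => preimage_set_system setT (turn n) measurable
  end.

Record motion_driver d (Omega : measurableType d) (R : realType)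
    (P : probability Omega R) (lambda : R) (J0 : Omega -> 'Z_4)
    (T : nat -> {RV P >-> R}) (turn : nat -> {RV P >-> bool}) : Prop := {
  initial_measurable : forall j, measurable (J0 @^-1` [set j]);
  initial_uniform : forall j, P (J0 @^-1` [set j]) = (4^-1)%:E;
  waiting_exponential : forall n (A : set R), measurable A ->
    distribution P (T n) A = exponential_prob lambda A;
  turn_fair : forall n b, P (turn n @^-1` [set b]) = (2^-1)%:E;
  driver_independent : mutually_independent P (driver_events J0 T turn) }.

(* Time of the (n+1)-st event. *)
Definition event_time (Omega : Type) (R : realType) (T : nat -> Omega -> R)
    (n : nat) (w : Omega) : R := \sum_(k < n.+1) T k w.

(* Number of events up to time t; it is 0 on the null event that there are
   infinitely many of them, as fset_set of an infinite set is empty. *)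
Definition poisson_count (Omega : Type) (R : realType) (T : nat -> Omega -> R)
    (t : R) (w : Omega) : nat :=
  #|` fset_set [set n | event_time T n w <= t] |.

Definition direction (Omega : Type) (R : realType) (J0 : Omega -> 'Z_4)
    (T : nat -> Omega -> R) (turn : nat -> Omega -> bool)
    (t : R) (w : Omega) : 'Z_4 :=
  J0 w + \sum_(k < poisson_count T t w) (if turn k w then 1 else -1).

Definition position_x (R : realType) (Omega : Type) (c x : R)
    (D : R -> Omega -> 'Z_4) (t : R) (w : Omega) : R :=
  x + c * \int[lebesgue_measure]_(s in `[0, t]) dir_x R (D s w).

Definition position_y (R : realType) (Omega : Type) (c y : R)
    (D : R -> Omega -> 'Z_4) (t : R) (w : Omega) : R :=
  y + c * \int[lebesgue_measure]_(s in `[0, t]) dir_y R (D s w).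

Definition strip (R : realType) (L : R) : set (R * R) :=
  [set p | 0 <= p.2 <= L].

Definition exit_time (R : realType) (Omega : Type) (G : set (R * R))
    (X Y : R -> Omega -> R) (w : Omega) : \bar R :=
  ereal_inf [set t%:E | t in [set t | 0 < t /\ ~ G (X t w, Y t w)]].

Definition lower_exit (R : realType) (Omega : Type) (G : set (R * R))
    (X Y : R -> Omega -> R) (A : set R) : set Omega :=
  [set w | let tau := exit_time G X Y w in
     [/\ (tau < +oo)%E, A (X (fine tau) w) & Y (fine tau) w = 0]].

Definition cond_prob d (Omega : measurableType d) (R : realType)
    (P : probability Omega R) (A B : set Omega) : \bar R :=
  (fine (P (A `&` B)) / fine (P B))%:E.

(* P(X(tau) in A, Y(tau) = 0 | X(0) = x, Y(0) = y, D(0) = d_j); the starting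
   point is a parameter of the motion. *)
Definition lower_exit_law d (Omega : measurableType d) (R : realType)
    (P : probability Omega R) (c L x y : R) (D : R -> Omega -> 'Z_4)
    (j : 'Z_4) (A : set R) : \bar R :=
  cond_prob P
    (lower_exit (strip L) (position_x c x D) (position_y c y D) A)
    [set w | D 0 w = j].

(* I is the limit of the integral of f over (0, b] as b tends to 1 from below.
   The endpoint 0 is left out because the integrands below have a removable
   0 / 0 there; being continuous and bounded on each (0, b], b < 1, their
   Lebesgue and Riemann integrals agree. *)
Definition improper_integral01 (R : realType) (f : R -> R) (I : R) : Prop :=
  (forall b, 0 < b < 1 ->
     (@lebesgue_measure R).-integrable `]0, b] (EFin \o f)) /\
  (fun b => \int[lebesgue_measure]_(w in `]0, b]) f w) @ 1^'- --> I.

(* nu is the sum of the measure sing and of an absolutely continuous measure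
   whose density at almost every z is K times the improper integral of f z. *)
Definition density_formula (R : realType) (nu sing : set R -> \bar R) (K : R)
    (f : R -> R -> R) : Prop :=
  exists u : R -> R,
    [/\ measurable_fun setT u,
        forall z, 0 <= u z,
        forall A, measurable A ->
          nu A = (sing A + \int[lebesgue_measure]_(z in A) (u z)%:E)%E
      & {ae lebesgue_measure, forall z : R,
          exists2 I, improper_integral01 (f z) I & u z = K * I}].

Definition sinh (R : realType) (x : R) : R := (expR x - expR (- x)) / 2.

(* Main.v *)
Require Import Defs.
From mathcomp Require Import all_boot all_order all_algebra finmap.
From mathcomp Require Import all_classical all_reals all_analysis.
From mathcomp Require Import measurable_realfun ring lra.

Set Implicit Arguments.
Unset Strict Implicit.
Unset Printing Implicit Defensive.

Import Order.TTheory GRing.Theory Num.Theory.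
Import numFieldNormedType.Exports.

Local Open Scope classical_set_scope.
Local Open Scope ring_scope.

(** The particle moves along legs of independent exponential length of rate
    a = lambda / c, and the turns make horizontal and vertical legs alternate,
    each new leg having a fair sign independent of everything else. Hence, given
    the initial direction, the walk made of the horizontal legs is independent of
    the index of the leg on which the particle crosses the lower side, and the
    exit law is a mixture over k of the laws of the horizontal walk after k legs,
    the weights being the exit probabilities of the vertical coordinate.

    Both ingredients are explicit. In the frequency variable w, with
    t = w / sqrt (1 - w^2), the characteristic function of a leg of fair sign is
    1 / (1 + t^2) = 1 - w^2, and the Fourier transform of the Cauchy density
    gives the Laplace density of one leg; so the density after k + 1 legs is the
    integral of the cosine against (1 - w^2)^k dw / sqrt (1 - w^2), up to the
    constant a / pi (walk_dens_freq). Summing over k replaces (1 - w^2)^k by the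
    generating function of the exit weights at 1 - w^2. This generating function
    solves a linear equation for the leg operator killed outside [0, L], whose
    solution is a combination of exponentials of rate a w (exit_gf_step,
    exit_series_cvg); the means of the solution over an upward and a downward leg
    (shift_exit_gf_up, shift_exit_gf_down) give the fractions in u_1 and u_3, and
    the solution itself is the fraction in u_0 and u_2. Dominated convergence
    justifies the sum (walk_mixture_improper, first_mixture_improper). In u_0 and
    u_2 the first leg has a known sign, its one-sided exponential density is given
    only by a conditionally convergent integral, and an integration by parts
    evaluates it (improper_osc, improper_first_dens0).

    The probabilistic part shows that the exit law is this mixture. Path by path,
    the particle leaves through the lower side exactly when some downward leg,
    reached without leaving the strip, is longer than the height of its starting point
    (lower_exitP), outside a null set where the event times accumulate or a leg
    is degenerate (good_ae). The probability of this event for the n-th leg is an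
    iterate of a transition operator (prob_exit_leg), by independence of the
    n-th leg and turn from the past (independent_boxes, Rintegral_freeze), and
    the iterates separate into a vertical and a horizontal factor (iter_leg_op).
    *)

(** * Domination, exhaustion and integrals on a half-line *)

Section dominated_tools.
Context d (T : measurableType d) (R : realType).
Variable mu : {measure set T -> \bar R}.

Lemma le_integrableR (D : set T) (f g : T -> R) : measurable D ->
  measurable_fun D f -> (forall x, D x -> `|f x| <= g x) ->
  mu.-integrable D (EFin \o g) -> mu.-integrable D (EFin \o f).
Proof.
move=> mD mf fg ig; apply: le_integrable ig => //; first exact/measurable_EFinP.
move=> x Dx /=; rewrite lee_fin; apply: le_trans (fg x Dx) _; exact: ler_norm.
Qed.

Lemma Rdominated_cvg (D : set T) (f_ : nat -> T -> R) (f g : T -> R) :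
  measurable D -> (forall n, measurable_fun D (f_ n)) ->
  (forall x, D x -> f_ ^~ x @ \oo --> f x) ->
  mu.-integrable D (EFin \o g) ->
  (forall n x, D x -> `|f_ n x| <= g x) ->
  mu.-integrable D (EFin \o f) /\
  (fun n => \int[mu]_(x in D) f_ n x) @ \oo --> \int[mu]_(x in D) f x.
Proof.
move=> mD mf cf ig fg.
have mf' n : measurable_fun D (EFin \o f_ n) by exact/measurable_EFinP.
have cf' x : D x -> (fun n => (f_ n x)%:E) @ \oo --> (f x)%:E.
  by move=> Dx; apply/cvg_EFin; [exact: nearW|exact: cf].
have fg' n x : D x -> (`|(f_ n x)%:E| <= (g x)%:E)%E.
  by move=> Dx; rewrite lee_fin; exact: fg.
have [If _ Icvg] := @dominated_convergence _ _ _ mu D mD (fun n => EFin \o f_ n)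
  (EFin \o f) (EFin \o g) mf' (emeasurable_fun_cvg _ _ mf' cf')
  (aeW _ cf') ig (aeW _ (fun x n => @fg' n x)).
split => //.
apply: fine_cvg; rewrite fineK//; exact: integrable_fin_num.
Qed.

End dominated_tools.

Section exhaustion.
Context (R : realType).
Local Notation mu := (@lebesgue_measure R).

(** Dominated convergence for the restrictions of f to the sets E n, with |f|
    as the bound. *)
Lemma Rintegral_exhaustion (D : set R) (E : nat -> set R) (f : R -> R) :
  measurable D -> (forall n, measurable (E n)) -> (forall n, E n `<=` D) ->
  (forall x, D x -> \forall n \near \oo, E n x) ->
  mu.-integrable D (EFin \o f) ->
  (fun n => \int[mu]_(x in E n) f x) @ \oo --> \int[mu]_(x in D) f x.
Proof.
move=> mD mE ED DE intf.
have mf : measurable_fun D f by apply/measurable_EFinP; exact: measurable_int intf.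
rewrite (_ : (fun n => _) = fun n => \int[mu]_(x in D) (f \_ (E n)) x); last first.
  by apply/funext => n; rewrite -Rintegral_mkcondr (setIidr (ED n)).
have [] := @Rdominated_cvg _ _ _ mu D (fun n => f \_ (E n)) f (fun x => `|f x|) => //.
- move=> n; apply/(measurable_restrict f (mE n) mD).
  by apply: measurable_funS mf => //; exact: subIsetl.
- move=> x Dx; apply: cvg_near_cst.
  by near=> n; rewrite patchE mem_set//; near: n; exact: DE.
- exact: integrable_norm.
- by move=> n x Dx; rewrite patchE; case: ifP => // _; rewrite normr0.
Unshelve. all: by end_near. Qed.

(** The fundamental theorem on [0, n+1], followed by exhaustion. *)
Lemma integralFTC_halfline (f F : R -> R) (l : R) :
  continuous f ->
  (forall x : R, is_derive x 1 F (f x)) ->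
  mu.-integrable `[0, +oo[ (EFin \o f) ->
  F x @[x --> +oo] --> l ->
  \int[mu]_(x in `[0, +oo[) f x = l - F 0.
Proof.
move=> cf dF intf Fl.
have dF' x : derivable F x 1 by have [] := dF x.
have cF : continuous F.
  by move=> x; apply/differentiable_continuous/derivable1_diffP.
have H : (fun n => \int[mu]_(x in `[0, n.+1%:R]) f x) @ \oo -->
    \int[mu]_(x in `[0, +oo[) f x.
  apply: (@Rintegral_exhaustion `[0, +oo[%classic (fun n => `[0, n.+1%:R]%classic) f) => //.
  - by move=> n x /=; rewrite !in_itv/= => /andP[->].
  - move=> x /=; rewrite in_itv/= andbT => x0.
    near=> n; rewrite in_itv/= x0/=.
    near: n; exists (Num.truncn x) => // n /= tn.
    apply: le_trans (ltW (Num.Theory.truncnS_gt x)) _.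
    by rewrite ler_nat ltnS.
apply/esym; move: H; apply: cvg_unique; first exact: Rhausdorff.
rewrite (_ : (fun n => _) = fun n => F n.+1%:R - F 0); last first.
  apply/funext => n; rewrite /Rintegral (@continuous_FTC2 _ f F)//.
  - exact: continuous_subspaceT.
  - split; [by move=> x _; exact: dF'| |].
      by apply: cvg_at_right_filter; exact: cF.
    by apply: cvg_at_left_filter; exact: cF.
  - move=> x _; by rewrite derive1E; apply: derive_val.
apply: cvgB; last exact: cvg_cst.
apply: cvg_comp Fl.
rewrite (cvg_shiftS (fun n => n%:R : R)).
exact: cvgr_idn.
Unshelve. all: by end_near. Qed.

End exhaustion.

(** * Fubini for dominated kernels and affine changes of variable *)

Section fubini_dom.
Context d1 d2 (T1 : measurableType d1) (T2 : measurableType d2) (R : realType).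
Variables (m1 : {finite_measure set T1 -> \bar R})
  (m2 : {sigma_finite_measure set T2 -> \bar R}).
Variables (f : T1 * T2 -> R) (G : T2 -> R).
Hypotheses (mf : measurable_fun setT f) (iG : m2.-integrable setT (EFin \o G))
  (fG : forall x y, `|f (x, y)| <= G y).

Let mG : measurable_fun setT G.
Proof. by apply/measurable_EFinP; exact: measurable_int iG. Qed.

Let prod_int : (m1 \x m2)%E.-integrable setT (EFin \o f).
Proof.
apply: (@le_integrable _ _ _ _ _ _ _ (fun z => (G z.2)%:E)) => //.
- exact/measurable_EFinP.
- by move=> [x y] _ /=; rewrite lee_fin; exact: le_trans (fG x y) (ler_norm _).
apply/integrable21ltyP => /=.
  by apply/measurable_EFinP; exact: measurableT_comp mG measurable_snd.
under eq_integral do rewrite integral_cst//.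
rewrite ge0_integralZr//; last by apply/measurable_EFinP/measurableT_comp.
rewrite lte_mul_pinfty//.
- exact: integral_ge0.
- by rewrite ge0_fin_numE ?integral_ge0//; have /integrableP[_] := iG.
by rewrite -ge0_fin_numE// fin_num_measure.
Qed.

Let sec1 x : m2.-integrable setT (fun y => (f (x, y))%:E).
Proof.
apply: (@le_integrableR _ _ _ _ _ (fun y => f (x, y)) G) => //.
exact: measurableT_comp mf (pair1_measurable _).
Qed.

Let sec2 y : m1.-integrable setT (fun x => (f (x, y))%:E).
Proof.
apply: (@le_integrableR _ _ _ _ _ (fun x => f (x, y)) (cst (G y))) => //.
  exact: measurableT_comp mf (pair2_measurable _).
exact: finite_measure_integrable_cst.
Qed.

(** Since m1 is finite, a bound by an m2-integrable function of the second
    variable makes f integrable for the product measure. *)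
Lemma measurable_Rintegral2 : measurable_fun setT (fun x => \int[m2]_y f (x, y)).
Proof.
apply/measurable_EFinP.
have := measurable_fubini_F prod_int.
by apply: eq_measurable_fun => x _ /=; rewrite /fubini_F /Rintegral fineK//; exact: integrable_fin_num (sec1 x).
Qed.

Lemma Rintegral_Fubini :
  \int[m1]_x \int[m2]_y f (x, y) = \int[m2]_y \int[m1]_x f (x, y).
Proof.
have := Fubini prod_int; rewrite /Rintegral => H.
under eq_integral do rewrite fineK ?(integrable_fin_num _ (sec1 _))//.
under [in RHS]eq_integral do rewrite fineK ?(integrable_fin_num _ (sec2 _))//.
by rewrite H.
Qed.

End fubini_dom.

Section affine.
Context (R : realType).
Local Notation mu := (@lebesgue_measure R).

(** After rescaling, both sides are measures in A that agree on the intervals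
    ]p, q]. *)
Lemma lebesgue_measure_affine (x b : R) (A : set R) : b != 0 -> measurable A ->
  mu ((fun t : R => x + b * t) @^-1` A) = ((`|b|^-1)%:E * mu A)%E.
Proof.
move=> b0 mA.
have mphi : measurable_fun setT (fun t : measurableTypeR R => x + b * t : measurableTypeR R).
  by apply: measurable_funD => //; exact: measurable_funM.
have nb : 0 <= `|b| by [].
pose m := mscale (NngNum nb) (pushforward mu (fun t : measurableTypeR R => x + b * t : measurableTypeR R)).
have mE B : m mphi B = (`|b|%:E * mu ((fun t : R => (x + b * t)%R) @^-1` B))%E by [].
suff -> : mu A = m mphi A.
  by rewrite mE muleA -EFinM mulVf ?normr_eq0// mul1e.
apply: lebesgue_measure_unique => // _ [[p q]] _ <-.
apply: (@etrans _ _ (`|b|%:E * mu ((fun t : R => (x + b * t)%R) @^-1` `]p, q]))%E) => //.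
rewrite lebesgue_measure_itv/= lte_fin.
have [b_gt0|b_lt0|b00] := ltrgt0P b; last by rewrite b00 eqxx in b0.
- rewrite (_ : _ @^-1` _ = `](p - x) / b, (q - x) / b]%classic); last first.
    apply/seteqP; split => t /=; rewrite !in_itv/= => /andP[h1 h2]; apply/andP.
      by rewrite ltr_pdivrMr// ler_pdivlMr//; split; lra.
    move: h1 h2; rewrite ltr_pdivrMr// ler_pdivlMr// => h1 h2; split; lra.
  rewrite lebesgue_measure_itv/= lte_fin ltr_pM2r ?invr_gt0// ltrD2r.
  case: ifPn => pq; last by rewrite mule0.
  by rewrite -EFinD -EFinD -EFinM; congr EFin; field; lra.
- rewrite (_ : _ @^-1` _ = `[(q - x) / b, (p - x) / b[%classic); last first.
    apply/seteqP; split => t /=; rewrite !in_itv/= => /andP[h1 h2]; apply/andP.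
      by rewrite ler_ndivrMr// ltr_ndivlMr//; split; lra.
    move: h1 h2; rewrite ler_ndivrMr// ltr_ndivlMr// => h1 h2; split; lra.
  rewrite lebesgue_measure_itv/= lte_fin ltr_nM2r ?invr_lt0// ltrD2r.
  case: ifPn => pq; last by rewrite mule0.
  by rewrite -EFinD -EFinD -EFinM; congr EFin; field; lra.
Qed.

Lemma ge0_integral_affine (x b : R) (F : R -> \bar R) : b != 0 ->
  measurable_fun setT F -> (forall t, 0 <= F t)%E ->
  (\int[mu]_t F (x + b * t)%R = (`|b|^-1)%:E * \int[mu]_t F t)%E.
Proof.
move=> b0 mF F0.
have mphi : measurable_fun setT (fun t : measurableTypeR R => x + b * t : measurableTypeR R).
  by apply: measurable_funD => //; exact: measurable_funM.
have nb : 0 <= `|b|^-1 by rewrite invr_ge0.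
have := @ge0_integral_pushforward _ _ _ _ R _ mphi mu setT F measurableT mF (fun y _ => F0 y).
rewrite preimage_setT => <-.
rewrite (eq_measure_integral (mscale (NngNum nb) mu)); last first.
  move=> A mA _; exact: lebesgue_measure_affine.
by rewrite ge0_integral_mscale.
Qed.

Lemma ge0_integral_affine_set (x b : R) (A : set R) (F : R -> \bar R) : b != 0 ->
  measurable A -> measurable_fun A F -> (forall t, A t -> 0 <= F t)%E ->
  (\int[mu]_(t in (fun t => x + b * t)%R @^-1` A) F (x + b * t)%R =
   (`|b|^-1)%:E * \int[mu]_(t in A) F t)%E.
Proof.
move=> b0 mA mF F0.
rewrite [in RHS]integral_mkcond -(ge0_integral_affine x b0).
- rewrite integral_mkcond; apply: eq_integral => t _.
  by rewrite !patchE /mem /= /in_mem/=.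
- exact/(measurable_restrictT F mA).
- by move=> t; rewrite patchE; case: ifPn => // /set_mem; exact: F0.
Qed.

End affine.

(** * The exponential law *)

Section density.
Context (R : realType).
Local Notation mu := (@lebesgue_measure R).

(** Change of variables for the Radon-Nikodym derivative of nu, which is
    almost everywhere equal to p. *)
Lemma integral_density (nu : {finite_measure set (measurableTypeR R) -> \bar R}) (p : R -> R) (F : R -> \bar R) :
  mu.-integrable setT (EFin \o p) ->
  (forall A, measurable A -> nu A = \int[mu]_(x in A) (p x)%:E)%E ->
  nu.-integrable setT F ->
  (\int[nu]_x F x = \int[mu]_x (F x * (p x)%:E))%E.
Proof.
move=> ip nuE iF.
have dom : nu `<< mu.
  move=> A nA B mB BA.
  rewrite nuE//; apply: null_set_integral => //; last exact: nA.
  by apply: measurable_funS (measurable_int mu ip).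
rewrite -(Radon_Nikodym_change_of_variables dom)//.
apply: ae_eq_integral => //.
- by apply: emeasurable_funM => //; exact: measurable_int iF.
- apply: emeasurable_funM => //; [exact: measurable_int iF|exact: measurable_int ip].
- apply: ae_eqe_mul2l => /=.
  rewrite Radon_NikodymE//=.
  case: cid => /= h [h1 h2 h3].
  apply: integral_ae_eq => //=.
  + exact: measurable_int ip.
  + by move=> E E01 mE; rewrite -h3//= -nuE//.
Qed.

Section expo.
Variables (a : R) (a0 : 0 < a).

(** The exponential measure is a probability only for a positive rate, so the
    proof of positivity is an argument; the length of one leg has rate lambda
    / c. *)
Definition expo : probability (measurableTypeR R) R :=
  exponential_distribution_exponential_prob__canonical__probability_measure_Probability a0.

Lemma expoE A : expo A = exponential_prob a A.
Proof. by []. Qed.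

Lemma integrable_bounded_expo (F : R -> R) (M : R) :
  measurable_fun setT F -> (forall r, `|F r| <= M) ->
  expo.-integrable setT (EFin \o F).
Proof.
move=> mF FM; apply: (@le_integrableR _ _ _ expo setT F (cst M)) => //.
exact: finite_measure_integrable_cst.
Qed.

Lemma Rintegral_expo (F : R -> R) (M : R) :
  measurable_fun setT F -> (forall r, `|F r| <= M) ->
  \int[expo]_r F r = \int[mu]_(r in `[0, +oo[) (a * expR (- a * r) * F r).
Proof.
move=> mF FM.
have iF := integrable_bounded_expo mF FM.
rewrite {1}/Rintegral (integral_density (integrable_exponential_pdf a0) _ iF)//.
rewrite [in RHS]Rintegral_mkcond /Rintegral; congr fine.
apply: eq_integral => r _; rewrite -EFinM; congr EFin.
rewrite /exponential_pdf !patchE; case: ifPn => _; last by rewrite mulr0.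
by rewrite mulrC.
Qed.

Lemma integrable_expo_lebesgue (F : R -> R) (M : R) :
  measurable_fun setT F -> (forall r, `|F r| <= M) ->
  mu.-integrable `[0, +oo[ (EFin \o (fun r => a * expR (- a * r) * F r)).
Proof.
move=> mF FM.
have M0 : 0 <= M by exact: le_trans (FM 0).
apply: (@le_integrableR _ _ R mu `[0, +oo[%classic (fun r => a * expR (- a * r) * F r) (fun r => M * exponential_pdf a r)) => //.
- apply: measurable_funTS; apply: measurable_funM => //.
  by apply: measurable_funM => //; apply: measurableT_comp => //; exact: measurable_funM.
- move=> r /=; rewrite in_itv/= andbT => r0; rewrite exponential_pdfE//.
  rewrite normrM mulrC ler_pM//.
  by rewrite ger0_norm// mulr_ge0 ?expR_ge0// ltW.
- apply: (@integrableS _ _ _ _ setT) => //.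
  rewrite (_ : _ \o _ = (fun r => M%:E * (exponential_pdf a r)%:E)%E)//.
  by apply: integrableZl => //; exact: integrable_exponential_pdf.
Qed.

Lemma expo_lt0 : expo `]-oo, 0[%classic = 0%E.
Proof.
rewrite expoE /exponential_prob (eq_integral (cst 0%E)) ?integral0//.
move=> r; rewrite inE/= in_itv/= => r0.
by rewrite lt0_exponential_pdf.
Qed.

Lemma expo_tail r : 0 <= r -> expo `]r, +oo[%classic = (expR (- a * r))%:E.
Proof.
move=> r0.
have /= := @probability_setC _ _ _ expo `]-oo, r]%classic (measurable_itv _).
rewrite setCitvl => ->.
suff -> : expo `]-oo, r]%classic = (1 - (expR (- a * r))%:E)%E.
  by rewrite -!EFinB; congr EFin; lra.
have -> : `]-oo, r]%classic = `]-oo, 0[%classic `|` `[0, r]%classic.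
  apply/seteqP; split => t /=; rewrite !in_itv/=.
    by move=> tr; case: ltP => t0; [left|right; rewrite tr].
  by move=> [t0|/andP[]//]; lra.
rewrite measureU//=; last first.
  apply/seteqP; split => t//= []; rewrite !in_itv/= => t0 /andP[t0' _]; lra.
rewrite expo_lt0 add0e; transitivity (exponential_prob a `[0, r]%classic) => //.
move: r0; rewrite le_eqVlt => /predU1P[<-|r0].
  by rewrite set_itv1 /exponential_prob integral_set1 mulr0 expR0 subee.
exact: exponential_prob_itv0c.
Qed.

End expo.
End density.

(** * Cosine and sine transforms of the exponential law *)

Section derive_tools.
Context (R : realType).

Lemma is_derive_compR (f g : R -> R) (x df dg : R) :
  is_derive (g x) 1 f df -> is_derive x 1 g dg ->
  is_derive x 1 (fun r => f (g r)) (dg * df).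
Proof. by move=> Hf Hg; apply: (is_derive_eq (is_derive1_comp Hf Hg)); rewrite mulrC. Qed.

Lemma is_deriveMR (f g : R -> R) (x df dg : R) :
  is_derive x 1 f df -> is_derive x 1 g dg ->
  is_derive x 1 (fun r => f r * g r) (f x * dg + g x * df).
Proof. by move=> Hf Hg; exact: (is_deriveM Hf Hg). Qed.

Lemma is_deriveDR (f g : R -> R) (x df dg : R) :
  is_derive x 1 f df -> is_derive x 1 g dg ->
  is_derive x 1 (fun r => f r + g r) (df + dg).
Proof. by move=> Hf Hg; exact: (is_deriveD Hf Hg). Qed.

Lemma is_derive_cstR (c x : R) : is_derive x 1 (fun=> c : R) 0.
Proof. exact: is_derive_cst. Qed.

Lemma is_derive_mulcR (c : R) (f : R -> R) (x df : R) :
  is_derive x 1 f df -> is_derive x 1 (fun r => c * f r) (c * df).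
Proof.
move=> Hf; apply: (is_derive_eq (is_deriveMR (is_derive_cstR c x) Hf)).
by rewrite mulr0 addr0.
Qed.

Lemma is_derive_scale (b x : R) : is_derive x 1 (fun r : R => b * r) b.
Proof. by apply: (is_derive_eq (is_derive_mulcR b (is_derive_id x 1))); rewrite mulr1. Qed.

Lemma is_derive_continuous (f : R -> R) (x df : R) : is_derive x 1 f df -> {for x, continuous f}.
Proof. by move=> [dfx _]; apply/differentiable_continuous/derivable1_diffP. Qed.

Lemma is_derive_expRs (b x : R) : is_derive x 1 (fun r : R => expR (b * r)) (b * expR (b * x)).
Proof. exact: (is_derive_compR (is_derive_expR _) (is_derive_scale b x)). Qed.

Lemma is_derive_coss (b x : R) : is_derive x 1 (fun r : R => cos (b * r)) (- b * sin (b * x)).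
Proof. by apply: (is_derive_eq (is_derive_compR (is_derive_cos _) (is_derive_scale b x))); ring. Qed.

Lemma is_derive_sins (b x : R) : is_derive x 1 (fun r : R => sin (b * r)) (b * cos (b * x)).
Proof. exact: (is_derive_compR (is_derive_sin _) (is_derive_scale b x)). Qed.

Lemma continuous_expRs (b : R) : continuous (fun r : R => expR (b * r)).
Proof. by move=> x; apply: is_derive_continuous (is_derive_expRs b x). Qed.
Lemma continuous_coss (b : R) : continuous (fun r : R => cos (b * r)).
Proof. by move=> x; apply: is_derive_continuous (is_derive_coss b x). Qed.
Lemma continuous_sins (b : R) : continuous (fun r : R => sin (b * r)).
Proof. by move=> x; apply: is_derive_continuous (is_derive_sins b x). Qed.

Lemma normr_cos_le1 (x : R) : `|cos x| <= 1.
Proof. by rewrite ler_norml cos_geN1 cos_le1. Qed.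
Lemma normr_sin_le1 (x : R) : `|sin x| <= 1.
Proof. by rewrite ler_norml sin_geN1 sin_le1. Qed.

Lemma cvg_expRN (a : R) : 0 < a -> expR (- a * x) @[x --> +oo] --> (0 : R).
Proof.
move=> a0; rewrite (_ : (fun x => _) = (fun z => expR (- z)) \o (fun z => a * z)); last first.
  by apply/funext => x /=; rewrite mulNr.
apply: (@cvg_comp _ _ _ _ _ _ (pinfty_nbhs R)); last exact: cvgr_expR.
exact: gt0_cvgMry.
Qed.

Lemma cvg_expRN_bounded (a M : R) (g : R -> R) : 0 < a -> (forall x, `|g x| <= M) ->
  expR (- a * x) * g x @[x --> +oo] --> (0 : R).
Proof.
move=> a0 gM; apply/norm_cvg0P.
apply: (@squeeze_cvgr _ _ _ _ (cst 0) (fun x => M * expR (- a * x))).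
- apply: nearW => x; rewrite normr_ge0/= normrM (ger0_norm (expR_ge0 _)) mulrC.
  by rewrite ler_wpM2r ?expR_ge0.
- exact: cvg_cst.
- by rewrite -[X in _ --> X](mulr0 M); apply: cvgMr; exact: cvg_expRN.
Qed.

End derive_tools.

Section expo_transform.
Context (R : realType).
Variables (a : R) (a0 : 0 < a).
Local Notation mu := (@lebesgue_measure R).

Lemma Rintegral_expo_FTC (f F : R -> R) (M : R) : continuous f -> (forall x, `|f x| <= M) ->
  (forall x : R, is_derive x 1 F (a * expR (- a * x) * f x)) ->
  F x @[x --> +oo] --> (0 : R) -> \int[expo a0]_r f r = - F 0.
Proof.
move=> cf fM dF F0.
have mf : measurable_fun setT f by exact: continuous_measurable_fun.
rewrite (Rintegral_expo a0 mf fM) (integralFTC_halfline _ dF _ F0) ?sub0r//.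
  move=> x; apply: cvgM; last exact: cf.
  by apply: cvgMr; exact: continuous_expRs.
exact: integrable_expo_lebesgue mf fM.
Qed.

Lemma Rintegral_expo_cos (b : R) : \int[expo a0]_r cos (b * r) = a ^+ 2 / (a ^+ 2 + b ^+ 2).
Proof.
have D : a ^+ 2 + b ^+ 2 != 0 by rewrite gt_eqF// ltr_pwDl ?sqr_ge0// exprn_gt0.
pose k := a / (a ^+ 2 + b ^+ 2).
pose F r := expR (- a * r) * (k * (b * sin (b * r) + (- a) * cos (b * r))).
have dF (x : R) : is_derive x 1 F (a * expR (- a * x) * cos (b * x)).
  apply: (is_derive_eq (is_deriveMR (is_derive_expRs _ x) (is_derive_mulcR k
    (is_deriveDR (is_derive_mulcR _ (is_derive_sins b x))
                 (is_derive_mulcR _ (is_derive_coss b x)))))).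
  by rewrite /k; field.
rewrite (Rintegral_expo_FTC (@continuous_coss R b) (fun x => normr_cos_le1 (b * x)) dF).
  by rewrite /F !mulr0 expR0 sin0 cos0 /k; field.
apply: (@cvg_expRN_bounded _ _ (`|k| * (`|b| + `|- a|))) => // x.
rewrite normrM ler_wpM2l//; apply: le_trans (ler_normD _ _) _.
by rewrite !normrM; apply: lerD; rewrite ler_piMr ?normr_sin_le1 ?normr_cos_le1.
Qed.

Lemma Rintegral_expo_sin (b : R) : \int[expo a0]_r sin (b * r) = a * b / (a ^+ 2 + b ^+ 2).
Proof.
have D : a ^+ 2 + b ^+ 2 != 0 by rewrite gt_eqF// ltr_pwDl ?sqr_ge0// exprn_gt0.
pose k := a / (a ^+ 2 + b ^+ 2).
pose F r := expR (- a * r) * (k * ((- a) * sin (b * r) + (- b) * cos (b * r))).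
have dF (x : R) : is_derive x 1 F (a * expR (- a * x) * sin (b * x)).
  apply: (is_derive_eq (is_deriveMR (is_derive_expRs _ x) (is_derive_mulcR k
    (is_deriveDR (is_derive_mulcR _ (is_derive_sins b x))
                 (is_derive_mulcR _ (is_derive_coss b x)))))).
  by rewrite /k; field.
rewrite (Rintegral_expo_FTC (@continuous_sins R b) (fun x => normr_sin_le1 (b * x)) dF).
  by rewrite /F !mulr0 expR0 sin0 cos0 /k; field.
apply: (@cvg_expRN_bounded _ _ (`|k| * (`|- a| + `|- b|))) => // x.
rewrite normrM ler_wpM2l//; apply: le_trans (ler_normD _ _) _.
by rewrite !normrM; apply: lerD; rewrite ler_piMr ?normr_sin_le1 ?normr_cos_le1.
Qed.

End expo_transform.

(** * The Fourier transform of the Cauchy density *)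

Section more_tools.
Context (R : realType).
Local Notation mu := (@lebesgue_measure R).

Lemma sqr1_norm (s : R) : s ^+ 2 = 1 -> `|s| = 1.
Proof. by move=> s1; apply/eqP; rewrite -sqrp_eq1// real_normK ?num_real// s1. Qed.

Lemma sqr1_neq0 (s : R) : s ^+ 2 = 1 -> s != 0.
Proof. by move=> s1; rewrite -normr_eq0 sqr1_norm// oner_eq0. Qed.

Lemma Rintegral_affine (x b : R) (F : R -> R) : b != 0 ->
  measurable_fun setT F -> (forall t, 0 <= F t) ->
  \int[mu]_t F t = `|b| * \int[mu]_t F (x + b * t).
Proof.
move=> b0 mF F0; rewrite /Rintegral (ge0_integral_affine x b0 (F := EFin \o F))//; last first.
- exact/measurable_EFinP.
have : (0 <= \int[mu]_t (F t)%:E)%E by apply: integral_ge0 => t _; rewrite lee_fin.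
case: (\int[mu]_t (F t)%:E)%E => //= [r _|_].
- by rewrite mulrA mulfV ?normr_eq0// mul1r.
- by rewrite gt0_muley ?lte_fin ?invr_gt0 ?normr_gt0//= mulr0.
Qed.

Lemma Rintegral_expo_pdf (a : R) (a0 : 0 < a) (F : R -> R) (M : R) :
  measurable_fun setT F -> (forall r, `|F r| <= M) ->
  \int[expo a0]_r F r = \int[mu]_r (exponential_pdf a r * F r).
Proof.
move=> mF FM.
have iF := integrable_bounded_expo a0 mF FM.
rewrite {1}/Rintegral (integral_density (integrable_exponential_pdf a0) _ iF)//.
by congr fine; apply: eq_integral => r _; rewrite -EFinM mulrC.
Qed.

Lemma integrable_oneDsqrV : mu.-integrable setT (fun s : R => ((oneDsqr s)^-1)%:E).
Proof.
apply/integrableP; split.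
  by apply/measurable_EFinP; exact: continuous_measurable_fun (@continuous_oneDsqrV R).
under eq_integral do rewrite /= ger0_norm ?invr_ge0 ?(le_trans _ (oneDsqr_ge1 _))//.
rewrite ge0_symfun_integralT.
- rewrite (_ : [set x | 0 <= x] = `[0, +oo[%classic); last first.
    by apply/seteqP; split=> x /=; rewrite in_itv/= andbT.
  by rewrite integral0y_oneDsqr ltry.
- by move=> x; rewrite invr_ge0 (le_trans _ (oneDsqr_ge1 _)).
- exact: continuous_oneDsqrV.
- by move=> x; rewrite /= /oneDsqr sqrrN.
Qed.

Lemma Rintegral_oneDsqrV : \int[mu]_s (oneDsqr s)^-1 = pi :> R.
Proof.
rewrite /Rintegral ge0_symfun_integralT.
- rewrite (_ : [set x | 0 <= x] = `[0, +oo[%classic); last first.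
    by apply/seteqP; split=> x /=; rewrite in_itv/= andbT.
  by rewrite integral0y_oneDsqr -EFinM/= mulrC divfK.
- by move=> x; rewrite invr_ge0 (le_trans _ (oneDsqr_ge1 _)).
- exact: continuous_oneDsqrV.
- by move=> x; rewrite /= /oneDsqr sqrrN.
Qed.

End more_tools.

Section fourier_base.
Context (R : realType).
Local Notation mu := (@lebesgue_measure R).

Let pdf1 (u : R) : R := exponential_pdf 1 u.

Let pdf1_le1 u : `|pdf1 u| <= 1.
Proof.
rewrite ger0_norm ?exponential_pdf_ge0// /pdf1.
case: (leP 0 u) => u0; last by rewrite lt0_exponential_pdf.
by rewrite exponential_pdfE// mul1r -[leRHS]expR0 ler_expR mulN1r oppr_le0.
Qed.

Let pdf1_cont u : u != 0 -> {for u, continuous pdf1}.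
Proof.
rewrite neq_lt => /orP[u0|u0]; last first.
  by apply: in_continuous_exponential_pdf; rewrite in_itv/= u0.
apply: cvg_near_cst; near=> v.
by rewrite /pdf1 !lt0_exponential_pdf//; near: v; exact: lt_nbhsl.
Unshelve. all: by end_near. Qed.

Let pdf1_meas : measurable_fun setT pdf1.
Proof. exact: measurable_exponential_pdf. Qed.

Let P (e z s : R) := \int[mu]_r (pdf1 (s * (e * r - z)) * (oneDsqr r)^-1).

Let q_cont (e z s : R) : 0 < e ->
  continuous (fun t => e ^+ 2 / (e ^+ 2 + (z + s * t) ^+ 2)).
Proof.
move=> e0 t; apply: cvgM; first exact: cvg_cst.
apply: cvgV; first by rewrite gt_eqF// ltr_pwDl ?sqr_ge0// exprn_gt0.
apply: cvgD; first exact: cvg_cst.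
have l : (z + s * r) @[r --> t] --> z + s * t.
  by apply: cvgD; [exact: cvg_cst|apply: cvgM => //; exact: cvg_cst].
by rewrite expr2; under eq_fun do rewrite expr2; apply: cvgM.
Qed.

Let halfcos (e z s : R) (e0 : 0 < e) : s ^+ 2 = 1 ->
  \int[expo (ltr01 : 0 < 1 :> R)]_t (e ^+ 2 / (e ^+ 2 + (z + s * t) ^+ 2)) = e * P e z s.
Proof.
move=> s1.
have s0 := sqr1_neq0 s1.
have ns1 := sqr1_norm s1.
have D t : 0 < e ^+ 2 + t ^+ 2 by rewrite ltr_pwDl ?sqr_ge0// exprn_gt0.
have mq : measurable_fun setT (fun t => e ^+ 2 / (e ^+ 2 + (z + s * t) ^+ 2)).
  by apply: continuous_measurable_fun; exact: q_cont.
have q0 t : 0 <= e ^+ 2 / (e ^+ 2 + (z + s * t) ^+ 2).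
  by rewrite divr_ge0 ?sqr_ge0// ltW.
rewrite (@Rintegral_expo_pdf _ _ _ _ 1)//; last first.
  move=> t; rewrite ger0_norm// ler_pdivrMr// mul1r lerDl sqr_ge0//.
rewrite (@Rintegral_affine _ (- s * z) (s * e)); first last.
- by move=> t; rewrite mulr_ge0 ?exponential_pdf_ge0.
- exact: measurable_funM.
- by rewrite mulf_neq0// gt_eqF.
rewrite normrM ns1 mul1r gtr0_norm//; congr (_ * _).
apply: eq_Rintegral => t _; congr (_ * _).
  by congr exponential_pdf; ring.
have -> : z + s * (- s * z + s * e * t) = e * t.
  rewrite (_ : _ + _ = z - s ^+ 2 * z + s ^+ 2 * e * t); last by ring.
  by rewrite s1; ring.
have e1 : e != 0 by rewrite gt_eqF.
have := D (e * t); have : 0 < 1 + t ^+ 2 by rewrite ltr_pwDl ?sqr_ge0.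
by rewrite /oneDsqr => h1 h2; field; rewrite ?e1 ?gt_eqF.
Qed.

(** As 1 / (1 + t^2) is the mean of cos (t r) for r exponential of rate 1,
    Fubini turns the damped integral into an exponential mean of the Poisson
    kernels e / (e^2 + (z + r)^2) and e / (e^2 + (z - r)^2); the substitution
    made in halfcos moves the factor e from the kernel to the exponential
    density, so that e can tend to 0 under the integral. *)
Lemma damped_cos (e z : R) : 0 < e ->
  \int[mu]_(t in `[0, +oo[) (expR (- e * t) * (cos (z * t) / oneDsqr t)) =
  2^-1 * (P e z 1 + P e z (-1)).
Proof.
move=> e0.
pose E1 := expo (ltr01 : 0 < 1 :> R).
have cosE (t : R) : cos (z * t) / oneDsqr t = \int[E1]_r (cos (z * t) * cos (t * r)).
  rewrite RintegralZl//; last first.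
    apply: (integrable_bounded_expo _ (M := 1)); last by move=> r; exact: normr_cos_le1.
    exact: continuous_measurable_fun (@continuous_coss R t).
  by rewrite Rintegral_expo_cos expr1n mul1r.
have mc : measurable_fun setT (fun t => cos (z * t) / oneDsqr t : R).
  apply: continuous_measurable_fun => t; apply: cvgM; first exact: continuous_coss.
  exact: continuous_oneDsqrV.
have bc t : `|cos (z * t) / oneDsqr t| <= 1 :> R.
  rewrite normrM -[leRHS]mulr1 ler_pM ?normr_cos_le1//.
  by rewrite ger0_norm ?invr_ge0 ?(le_trans _ (oneDsqr_ge1 _))// oneDsqrV_le1.
have e1 : e != 0 by rewrite gt_eqF.
have ie (t : R -> R) : measurable_fun setT t -> (forall r, `|t r| <= 1) -> (expo e0).-integrable setT (EFin \o t).
  by move=> mt; exact: integrable_bounded_expo.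
apply: (mulfI e1).
rewrite -RintegralZl//; last first.
  have := @integrableZl _ _ _ mu _ (measurable_itv _) e^-1 _ (integrable_expo_lebesgue e0 mc bc).
  apply: eq_integrable => // t _ /=; rewrite -EFinM; congr EFin.
  by rewrite !mulrA mulVf// mul1r.
under eq_Rintegral do rewrite mulrA.
rewrite -(Rintegral_expo e0 mc bc).
under eq_Rintegral do rewrite cosE.
have mcc : measurable_fun setT (fun u : R * R => cos (z * u.1) * cos (u.1 * u.2)).
  have mcos : measurable_fun setT (@cos R) by exact: continuous_measurable_fun (@continuous_cos R).
  by apply: measurable_funM; apply: (measurableT_comp mcos); exact: measurable_funM.
have bcc (t r : R) : `|cos (z * t) * cos (t * r)| <= 1.
  by rewrite normrM -[leRHS]mulr1 ler_pM ?normr_cos_le1.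
rewrite (@Rintegral_Fubini _ _ _ _ _ (expo e0) E1 (fun u => cos (z * u.1) * cos (u.1 * u.2)) (cst 1))//; last first.
  exact: finite_measure_integrable_cst.
have inner (r : R) : \int[expo e0]_t (cos (z * t) * cos (t * r)) =
    2^-1 * (e ^+ 2 / (e ^+ 2 + (z + 1 * r) ^+ 2) + e ^+ 2 / (e ^+ 2 + (z + -1 * r) ^+ 2)).
  rewrite -!(Rintegral_expo_cos e0).
  have ic b : (expo e0).-integrable setT (EFin \o (fun t => cos (b * t))).
    apply: ie; last by move=> t; exact: normr_cos_le1.
    exact: continuous_measurable_fun (@continuous_coss R b).
  rewrite -RintegralD//= -RintegralZl//; last exact: integrableD (ic _) (ic _).
  apply: eq_Rintegral => t _.
  rewrite [(z + 1 * r) * t]mulrDl [(z + -1 * r) * t]mulrDl mul1r mulN1r mulNr cosD cosB (mulrC t r).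
  by field.
under eq_Rintegral do rewrite inner.
have iq s : E1.-integrable setT (EFin \o (fun r => e ^+ 2 / (e ^+ 2 + (z + s * r) ^+ 2))).
  have D t : 0 < e ^+ 2 + t ^+ 2 by rewrite ltr_pwDl ?sqr_ge0// exprn_gt0.
  apply: (integrable_bounded_expo _ (M := 1)).
    by apply: continuous_measurable_fun; exact: q_cont.
  move=> t /=; rewrite ger0_norm; last by rewrite divr_ge0 ?sqr_ge0// ltW.
  by rewrite ler_pdivrMr// mul1r lerDl sqr_ge0.
rewrite RintegralZl//; last exact: integrableD (iq _) (iq _).
rewrite RintegralD// !halfcos ?expr1n ?sqrrN ?expr1n//.
ring.
Qed.

(** Let the damping e tend to 0 in damped_cos. The Poisson kernels concentrate
    at r = z and r = - z, exactly one of which is positive when z is not 0,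
    and the exponential density is continuous there. *)
Lemma integral_cos_oneDsqr (z : R) :
  \int[mu]_(t in `[0, +oo[) (cos (z * t) / oneDsqr t) = pi / 2 * expR (- `|z|).
Proof.
have [->|z0] := eqVneq z 0.
  under eq_Rintegral do rewrite mul0r cos0 mul1r.
  by rewrite normr0 oppr0 expR0 mulr1 /Rintegral integral0y_oneDsqr.
pose e n : R := n.+1%:R^-1.
have e0 n : 0 < e n by rewrite invr_gt0.
have ecvg : e n @[n --> \oo] --> (0 : R) by exact: cvg_harmonic.
have oneD0 t : 0 <= (oneDsqr t)^-1 :> R.
  by rewrite invr_ge0 (le_trans _ (oneDsqr_ge1 _)).
have mV : measurable_fun setT (fun t : R => (oneDsqr t)^-1).
  exact: continuous_measurable_fun (@continuous_oneDsqrV R).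
have mc : measurable_fun setT (fun t => cos (z * t) / oneDsqr t : R).
  by apply: measurable_funM => //; exact: continuous_measurable_fun (@continuous_coss R z).
have H1 : \int[mu]_(t in `[0, +oo[) (expR (- e n * t) * (cos (z * t) / oneDsqr t)) @[n --> \oo]
    --> \int[mu]_(t in `[0, +oo[) (cos (z * t) / oneDsqr t).
  have [] := @Rdominated_cvg _ _ _ mu `[0, +oo[%classic
    (fun n t => expR (- e n * t) * (cos (z * t) / oneDsqr t))
    (fun t => cos (z * t) / oneDsqr t) (fun t => (oneDsqr t)^-1) => //.
  - move=> n; apply: measurable_funTS; apply: measurable_funM => //.
    exact: continuous_measurable_fun (@continuous_expRs R _).
  - move=> t _; rewrite -[X in _ --> X]mul1r; apply: cvgMl.
    rewrite -(@expR0 R); apply: continuous_cvg; first exact: continuous_expR.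
    by rewrite -[X in _ --> X](mul0r t); apply: cvgMl; rewrite -oppr0; apply: cvgN.
  - by apply: (@integrableS _ _ _ _ setT) => //; exact: integrable_oneDsqrV.
  - move=> n t /=; rewrite in_itv/= andbT => t0.
    rewrite !normrM mulrA -[leRHS]mul1r ler_pM//; last by rewrite ger0_norm.
    rewrite -[leRHS]mul1r ler_pM ?normr_cos_le1//.
    by rewrite ger0_norm ?expR_ge0// -[leRHS]expR0 ler_expR mulNr oppr_le0 mulr_ge0// ltW.
have PE s : s ^+ 2 = 1 -> P (e n) z s @[n --> \oo] --> pdf1 (- s * z) * pi.
  move=> s1.
  have s0 := sqr1_neq0 s1.
  rewrite -(@Rintegral_oneDsqrV R) -RintegralZl//; last exact: integrable_oneDsqrV.
  have [] := @Rdominated_cvg _ _ _ mu setT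
    (fun n r => pdf1 (s * (e n * r - z)) * (oneDsqr r)^-1)
    (fun t => pdf1 (- s * z) / oneDsqr t) (fun t => (oneDsqr t)^-1) => //.
  - move=> n; apply: measurable_funM => //; apply: measurableT_comp => //.
    by apply: measurable_funM => //; apply: measurable_funB => //; exact: measurable_funM.
  - move=> r _; apply: cvgMl.
    apply: continuous_cvg; first by apply: pdf1_cont; rewrite mulf_neq0// oppr_eq0.
    rewrite mulNr -mulrN; apply: cvgMr; rewrite -[X in _ --> X]sub0r.
    by apply: cvgB; last exact: cvg_cst; rewrite -[X in _ --> X](mul0r r); apply: cvgMl.
  - exact: integrable_oneDsqrV.
  - move=> n t _; rewrite normrM -[leRHS]mul1r ler_pM//.
    by rewrite ger0_norm.
move: H1; under eq_fun do rewrite damped_cos//.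
have H2 : 2^-1 * (P (e n) z 1 + P (e n) z (-1)) @[n --> \oo] --> 2^-1 * (pdf1 (- 1 * z) * pi + pdf1 (- (-1) * z) * pi).
  by apply: cvgMr; apply: cvgD; apply: PE; rewrite ?sqrrN expr1n.
move/cvg_lim => <- //; move/cvg_lim : H2 => -> //.
rewrite mulN1r opprK mul1r /pdf1.
have [z1|z1] := ltP 0 z.
  rewrite lt0_exponential_pdf ?oppr_lt0// exponential_pdfE ?ltW// gtr0_norm//.
  by rewrite mulN1r; field.
rewrite exponential_pdfE ?oppr_ge0// lt0_exponential_pdf; last by rewrite lt_neqAle z0.
by rewrite ler0_norm// mulN1r; field.
Qed.
End fourier_base.

(** * Exponential legs and the horizontal walk *)

Section bounded_measurable.
Context d (T : measurableType d) (R : realType).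

(** The bound M is explicit because integrability under every finite measure,
    and the passage of bounds through means, only need the sup norm. *)
Definition bmeas (M : R) (F : T -> R) :=
  measurable_fun setT F /\ forall x, `|F x| <= M.

Lemma bmeas_integrable (m : {finite_measure set T -> \bar R}) (M : R) (F : T -> R) :
  bmeas M F -> m.-integrable setT (EFin \o F).
Proof.
move=> [mF FM]; apply: (@le_integrableR _ _ _ m setT F (cst M)) => //.
exact: finite_measure_integrable_cst.
Qed.

Lemma bmeasD (M N : R) (F G : T -> R) : bmeas M F -> bmeas N G ->
  bmeas (M + N) (fun x => F x + G x).
Proof.
move=> [mF FM] [mG GM]; split; first exact: measurable_funD.
by move=> x; apply: le_trans (ler_normD _ _) _; exact: lerD.
Qed.

Lemma bmeasM (M N : R) (F G : T -> R) : bmeas M F -> bmeas N G ->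
  bmeas (M * N) (fun x => F x * G x).
Proof.
move=> [mF FM] [mG GM]; split; first exact: measurable_funM.
by move=> x; rewrite normrM ler_pM.
Qed.

Lemma bmeas_cst (c : R) : bmeas `|c| (fun=> c).
Proof. by split. Qed.

Lemma bmeasZ (c M : R) (F : T -> R) : bmeas M F -> bmeas (`|c| * M) (fun x => c * F x).
Proof. by apply: bmeasM; exact: bmeas_cst. Qed.

Lemma bmeas_indic (A : set T) : measurable A -> bmeas 1 (\1_A : T -> R).
Proof.
move=> mA; split; first exact: measurable_indic.
by move=> x; rewrite indicE; case: (_ \in _); rewrite ?normr1// normr0.
Qed.

Lemma EFin_Rintegral (m : {finite_measure set T -> \bar R}) (M : R) (F : T -> R) :
  bmeas M F -> (\int[m]_x F x)%:E = (\int[m]_x (F x)%:E)%E.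
Proof.
move=> bF; rewrite /Rintegral fineK//.
by apply: integrable_fin_num => //; exact: bmeas_integrable bF.
Qed.

Lemma prob_cst (P : probability T R) (c : R) : \int[P]_x c = c.
Proof.
have := Rintegral_cst P measurableT c.
by rewrite (_ : fine (P setT) = 1) ?mulr1// probability_setT.
Qed.

Lemma normr_prob_le (P : probability T R) (M : R) (F : T -> R) : bmeas M F ->
  `|\int[P]_x F x| <= M.
Proof.
move=> bF; have iF := bmeas_integrable P bF; have [mF FM] := bF.
apply: le_trans (le_normr_Rintegral _ _) _ => //.
rewrite -[leRHS](prob_cst P).
apply: le_Rintegral => //; first exact: integrable_norm.
exact: finite_measure_integrable_cst.
Qed.

Lemma prob_D (P : probability T R) (M N : R) (F G : T -> R) : bmeas M F -> bmeas N G ->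
  \int[P]_x (F x + G x) = \int[P]_x F x + \int[P]_x G x.
Proof. by move=> bF bG; rewrite RintegralD//; [exact: bmeas_integrable bF|exact: bmeas_integrable bG]. Qed.

Lemma prob_Z (P : probability T R) (c M : R) (F : T -> R) : bmeas M F ->
  \int[P]_x (c * F x) = c * \int[P]_x F x.
Proof. by move=> bF; rewrite RintegralZl//; exact: bmeas_integrable bF. Qed.

Lemma prob_le (P : probability T R) (M N : R) (F G : T -> R) : bmeas M F -> bmeas N G ->
  (forall x, F x <= G x) -> \int[P]_x F x <= \int[P]_x G x.
Proof. by move=> bF bG FG; apply: le_Rintegral => //; [exact: bmeas_integrable bF|exact: bmeas_integrable bG]. Qed.

End bounded_measurable.

Section shift_mean.
Context (R : realType).
Variables (a : R) (a0 : 0 < a).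
Local Notation mu := (@lebesgue_measure R).

Let pdf_ge0 z : 0 <= exponential_pdf a z.
Proof. by apply: exponential_pdf_ge0; exact: ltW. Qed.
Hint Resolve pdf_ge0 : core.

(** The mean of F after one leg of exponential length in the direction s,
    where s is 1 or - 1. *)
Definition shift_mean (s : R) (F : R -> R) (y : R) : R :=
  \int[expo a0]_r F (y + s * r).

(** The sign of the leg is fair, so the displacement has a Laplace
    distribution. *)
Definition laplace_mean (F : R -> R) (y : R) : R :=
  2^-1 * (shift_mean 1 F y + shift_mean (-1) F y).

Lemma bmeas_shift (s y M : R) (F : R -> R) : bmeas M F -> bmeas M (fun r => F (y + s * r)).
Proof.
move=> [mF FM]; split => //; apply: (measurableT_comp mF).
by apply: measurable_funD => //; exact: measurable_funM.
Qed.

Lemma bmeas_shift2 (s M : R) (F : R -> R) : bmeas M F -> bmeas M (fun u : R * R => F (u.1 + s * u.2)).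
Proof.
move=> [mF FM]; split => //; apply: (measurableT_comp mF).
by apply: measurable_funD => //; exact: measurable_funM.
Qed.

Lemma bmeas_shift_mean (s M : R) (F : R -> R) : bmeas M F -> bmeas M (shift_mean s F).
Proof.
move=> bF; split; last by move=> y; apply: normr_prob_le; exact: bmeas_shift.
have [mF FM] := bmeas_shift2 s bF.
apply: (@measurable_Rintegral2 _ _ _ _ _ (expo a0) (expo a0) (fun u => F (u.1 + s * u.2)) (cst M)) => //.
exact: finite_measure_integrable_cst.
Qed.

Lemma bmeas_laplace_mean (M : R) (F : R -> R) : bmeas M F -> bmeas M (laplace_mean F).
Proof.
move=> bF.
have := bmeasZ 2^-1 (bmeasD (bmeas_shift_mean 1 bF) (bmeas_shift_mean (-1) bF)).
rewrite ger0_norm ?invr_ge0// (_ : 2^-1 * (M + M) = M)//; by field.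
Qed.

Lemma shift_mean_ge0 (s : R) (F : R -> R) y : (forall x, 0 <= F x) -> 0 <= shift_mean s F y.
Proof. by move=> F0; apply: Rintegral_ge0. Qed.

Lemma laplace_mean_ge0 (F : R -> R) y : (forall x, 0 <= F x) -> 0 <= laplace_mean F y.
Proof. by move=> F0; rewrite mulr_ge0 ?invr_ge0 ?addr_ge0 ?shift_mean_ge0. Qed.

(** Tonelli: averaging the starting point over a leg of sign s averages the
    density, as a function of z - x, over a leg of sign - s. *)
Lemma shift_mean_density (s : R) (A : set R) (S g : R -> R) (M N : R) :
  measurable A -> bmeas M S -> bmeas N g -> (forall z, 0 <= g z) ->
  (forall x, (S x)%:E = \int[mu]_(z in A) (g (z - x))%:E)%E ->
  forall x, ((shift_mean s S x)%:E = \int[mu]_(z in A) (shift_mean (- s) g (z - x))%:E)%E.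
Proof.
move=> mA bS bg g0 Sg x.
rewrite /shift_mean (EFin_Rintegral (expo a0) (bmeas_shift s x bS)).
under eq_integral do rewrite Sg integral_mkcond.
under [RHS]eq_integral do rewrite (EFin_Rintegral (expo a0) (bmeas_shift _ _ bg)).
rewrite [RHS]integral_mkcond.
pose f (u : R * R) : \bar R := (\1_A u.2 * g (u.2 - (x + s * u.1)))%:E.
have [mg _] := bg.
have mf : measurable_fun setT f.
  apply/measurable_EFinP; apply: measurable_funM.
    by apply: measurableT_comp => //; exact: measurable_indic.
  apply: measurableT_comp => //; apply: measurable_funB => //.
  by apply: measurable_funD => //; exact: measurable_funM.
have f0 u : (0 <= f u)%E by rewrite lee_fin mulr_ge0// indicE.
transitivity (\int[expo a0]_r \int[mu]_z f (r, z))%E.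
  apply: eq_integral => r _; apply: eq_integral => z _; rewrite /f patchE indicE.
  by case: (_ \in _); rewrite ?mul1r ?mul0r.
transitivity (\int[mu]_z \int[expo a0]_r f (r, z))%E.
  exact: (@fubini_tonelli _ _ _ _ _ (expo a0) mu f mf f0).
apply: eq_integral => z _; rewrite /f patchE.
case: ifPn => zA; last by under eq_integral do rewrite indicE (negbTE zA) mul0r; rewrite integral0.
by apply: eq_integral => r _; rewrite indicE zA mul1r; congr (g _)%:E; rewrite opprD addrA mulNr.
Qed.

Lemma shift_mean_indic (s : R) (A : set R) (x : R) : measurable A -> s ^+ 2 = 1 ->
  ((shift_mean s (\1_A) x)%:E = \int[mu]_(z in A) (exponential_pdf a (s * (z - x)))%:E)%E.
Proof.
move=> mA s1.
have s0 := sqr1_neq0 s1.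
have ns1 := sqr1_norm s1.
have bA := bmeas_shift s x (bmeas_indic R mA).
rewrite /shift_mean (EFin_Rintegral (expo a0) bA) (integral_density (integrable_exponential_pdf a0) _ (bmeas_integrable (expo a0) bA))//.
have mpdf := measurable_exponential_pdf a.
have mF : measurable_fun setT (fun z => (\1_A z * exponential_pdf a (s * (z - x)))%:E).
  apply/measurable_EFinP; apply: measurable_funM; first exact: measurable_indic.
  apply: measurableT_comp => //; apply: measurable_funM => //; exact: measurable_funB.
transitivity (\int[mu]_z (\1_A z * exponential_pdf a (s * (z - x)))%:E)%E; last first.
  rewrite [RHS]integral_mkcond; apply: eq_integral => z _; rewrite patchE indicE.
  by case: (_ \in _); rewrite ?mul1r ?mul0r.
have F0 t : (0 <= (\1_A t * exponential_pdf a (s * (t - x)))%:E)%E.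
  by rewrite lee_fin; apply: mulr_ge0 => //; rewrite indicE ler0n.
have := ge0_integral_affine x s0 mF F0.
rewrite ns1 invr1 mul1e => <-.
apply: eq_integral => r _; rewrite -EFinM; congr (_ * exponential_pdf a _)%:E.
by rewrite addrAC subrr add0r mulrA -expr2 s1 mul1r.
Qed.

(** Density of the displacement after k + 1 legs of fair sign. *)
Definition walk_dens (k : nat) : R -> R :=
  iter k laplace_mean (fun z => a / 2 * expR (- (a * `|z|))).

(** Density of the displacement after a leg of sign s followed by k legs of
    fair sign. For k = 0 it jumps at 0, and its frequency integral converges
    only conditionally. *)
Definition first_dens (s : R) (k : nat) : R -> R :=
  if k is k'.+1 then shift_mean (- s) (walk_dens k') else fun z => exponential_pdf a (s * z).

Lemma walk_dens_ge0 k z : 0 <= walk_dens k z.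
Proof.
elim: k z => [|k IH] z /=; first by rewrite mulr_ge0 ?expR_ge0// divr_ge0// ltW.
exact: laplace_mean_ge0.
Qed.

Lemma bmeas_walk_dens k : bmeas a (walk_dens k).
Proof.
elim: k => [|k IH] /=; last exact: bmeas_laplace_mean.
split.
  apply: measurable_funM => //.
  under eq_fun do rewrite -mulNr.
  apply: (measurableT_comp (f := fun u : R => expR (- a * u))); last exact: normr_measurable.
  exact: continuous_measurable_fun (@continuous_expRs R _).
move=> z; rewrite ger0_norm; last by rewrite mulr_ge0 ?expR_ge0// divr_ge0// ltW.
rewrite -[leRHS]mulr1.
apply: ler_pM; rewrite ?expR_ge0 ?divr_ge0 ?(ltW a0)//.
  by move: a0; lra.
by rewrite -[leRHS]expR0 ler_expR oppr_le0 mulr_ge0// ltW.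
Qed.

Lemma first_dens_ge0 s k z : 0 <= first_dens s k z.
Proof.
case: k => [|k] /=; first exact: pdf_ge0.
by apply: shift_mean_ge0 => x; exact: walk_dens_ge0.
Qed.

Lemma bmeas_first_dens s k : bmeas a (first_dens s k).
Proof.
case: k => [|k] /=; last by apply: bmeas_shift_mean; exact: bmeas_walk_dens.
split; first by apply: (measurableT_comp (measurable_exponential_pdf a)); exact: measurable_funM.
move=> z; rewrite (ger0_norm (pdf_ge0 _)).
case: (leP 0 (s * z)) => sz; last by rewrite lt0_exponential_pdf// ltW.
rewrite exponential_pdfE//; apply: ler_piMr; first exact: ltW.
by rewrite -[leRHS]expR0 ler_expR mulNr oppr_le0 mulr_ge0// ltW.
Qed.

Lemma laplace_mean_density (A : set R) (S g : R -> R) (M N : R) :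
  measurable A -> bmeas M S -> bmeas N g -> (forall z, 0 <= g z) ->
  (forall x, (S x)%:E = \int[mu]_(z in A) (g (z - x))%:E)%E ->
  forall x, ((laplace_mean S x)%:E = \int[mu]_(z in A) (laplace_mean g (z - x))%:E)%E.
Proof.
move=> mA bS bg g0 Sg x.
rewrite /laplace_mean EFinM EFinD !(shift_mean_density _ mA bS bg g0 Sg) opprK.
have mh s : measurable_fun A (fun z => (shift_mean s g (z - x))%:E).
  apply/measurable_EFinP/measurable_funTS.
  by apply: (measurableT_comp (bmeas_shift_mean s bg).1); exact: measurable_funB.
have h0 s z : (0 <= (shift_mean s g (z - x))%:E)%E by rewrite lee_fin shift_mean_ge0.
rewrite addeC -ge0_integralD; [|exact: mA|by []|exact: mh|by []|exact: mh].
rewrite -ge0_integralZl_EFin; [|exact: mA|by move=> z _; exact: adde_ge0|apply: emeasurable_funD; exact: mh|by rewrite invr_ge0].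
by apply: eq_integral => z _; rewrite -EFinD -EFinM.
Qed.

(** Probability that the walk started at a given abscissa is in A after k legs
    of fair sign. *)
Definition walk_law (A : set R) (k : nat) : R -> R := iter k laplace_mean (\1_A).

Lemma bmeas_walk_law A k : measurable A -> bmeas 1 (walk_law A k).
Proof.
by move=> mA; elim: k => [|k IH] /=; [exact: bmeas_indic|exact: bmeas_laplace_mean].
Qed.

(** For one leg the two half-line densities add up to the Laplace density off
    the point x; further legs are handled by laplace_mean_density. *)
Lemma walk_law_density (A : set R) k x : measurable A ->
  ((walk_law A k.+1 x)%:E = \int[mu]_(z in A) (walk_dens k (z - x))%:E)%E.
Proof.
move=> mA; elim: k x => [|k IH] x; last first.
  exact: (laplace_mean_density mA (bmeas_walk_law k.+1 mA) (bmeas_walk_dens k) (walk_dens_ge0 k) IH).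
rewrite /walk_law /= /laplace_mean EFinM EFinD !shift_mean_indic//; last 2 first.
  by rewrite sqrrN expr1n.
  by rewrite expr1n.
have mp s : measurable_fun A (fun z => (exponential_pdf a (s * (z - x)))%:E).
  apply/measurable_EFinP/measurable_funTS.
  apply: (measurableT_comp (measurable_exponential_pdf a)); apply: measurable_funM => //; exact: measurable_funB.
have p0 s z : (0 <= (exponential_pdf a (s * (z - x)))%:E)%E.
  by rewrite lee_fin.
rewrite -ge0_integralD; [|exact: mA|by []|exact: mp|by []|exact: mp].
rewrite -ge0_integralZl_EFin; [|exact: mA|by move=> z _; exact: adde_ge0|apply: emeasurable_funD; exact: mp|by rewrite invr_ge0].
have mAx : measurable (A `\ x) by exact: measurableD.
rewrite -(@integral_setD1 _ _ x)//; last first.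
  apply: (@measurable_funS _ _ _ _ A) => //.
    by apply: measurable_funeM; exact: emeasurable_funD.
rewrite -[RHS](@integral_setD1 _ _ x)//; last first.
  apply/measurable_EFinP/measurable_funTS.
  by apply: (measurableT_comp (bmeas_walk_dens 0).1); exact: measurable_funB.
apply: eq_integral => z; rewrite inE => -[_ /= /eqP zx].
rewrite -EFinD -EFinM; congr EFin; rewrite mul1r mulN1r.
have [zx1|zx1|zx1] := ltgtP (z - x) 0; last by move: zx1 zx => /eqP; rewrite subr_eq0 => ->.
- rewrite (lt0_exponential_pdf _ zx1) exponential_pdfE ?oppr_ge0 ?ltW// ltr0_norm//.
  by rewrite add0r mulNr mulrA [2^-1 * a]mulrC.
- rewrite [X in _ + X]lt0_exponential_pdf ?oppr_lt0// exponential_pdfE ?ltW// gtr0_norm//.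
  by rewrite addr0 mulNr mulrA [2^-1 * a]mulrC.
Qed.

Lemma shift_walk_law_density (s : R) (A : set R) k x : measurable A -> s ^+ 2 = 1 ->
  ((shift_mean s (walk_law A k) x)%:E = \int[mu]_(z in A) (first_dens s k (z - x))%:E)%E.
Proof.
move=> mA s1; case: k => [|k]; first exact: shift_mean_indic.
exact: (shift_mean_density _ mA (bmeas_walk_law k.+1 mA) (bmeas_walk_dens k) (walk_dens_ge0 k)
  (fun x => walk_law_density k x mA)).
Qed.

End shift_mean.

(** * The frequency variable *)

Section frequency.
Context (R : realType).
Local Notation mu := (@lebesgue_measure R).

Definition rt (w : R) : R := Num.sqrt (1 - w ^+ 2).
(** The substitution t = w / sqrt (1 - w^2) maps ]0, 1[ onto ]0, +oo[, with dw
    / sqrt (1 - w^2) = dt / (1 + t^2) and 1 - w^2 = 1 / (1 + t^2). *)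
Definition al (w : R) : R := w / rt w.

Lemma itv01_itv11 (w : R) : 0 < w < 1 -> -1 < w < 1.
Proof. by move=> /andP[? ?]; apply/andP; lra. Qed.

Lemma rt_sub_gt0 (w : R) : -1 < w < 1 -> 0 < 1 - w ^+ 2.
Proof. by move=> /andP[w0 w1]; nra. Qed.

Lemma rt_gt0 (w : R) : -1 < w < 1 -> 0 < rt w.
Proof. by move=> w1; rewrite sqrtr_gt0 rt_sub_gt0. Qed.

Lemma rt_neq0 (w : R) : -1 < w < 1 -> rt w != 0.
Proof. by move=> w1; rewrite gt_eqF// rt_gt0. Qed.

Lemma rt_ge0 (w : R) : 0 <= rt w. Proof. exact: sqrtr_ge0. Qed.

Lemma rt_sqr (w : R) : -1 < w < 1 -> rt w ^+ 2 = 1 - w ^+ 2.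
Proof. by move=> w1; rewrite sqr_sqrtr// ltW// rt_sub_gt0. Qed.

Lemma rt_le1 (w : R) : rt w <= 1.
Proof. by rewrite -[leRHS]sqrtr1 ler_wsqrtr// gerBl sqr_ge0. Qed.

Lemma measurable_rt : measurable_fun setT rt.
Proof.
apply: (measurableT_comp (continuous_measurable_fun (@sqrt_continuous R))).
by apply: measurable_funB => //; exact: measurable_funX.
Qed.

Lemma measurable_rtV : measurable_fun setT (fun w => (rt w)^-1).
Proof.
under eq_fun do rewrite -(powR_inv1 (rt_ge0 _)).
exact: (measurableT_comp (measurable_powR (-1)) measurable_rt).
Qed.

Lemma measurable_al : measurable_fun setT al.
Proof. by apply: measurable_funM => //; exact: measurable_rtV. Qed.

Lemma is_derive_rt (w : R) : -1 < w < 1 -> is_derive w 1 rt (- al w).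
Proof.
move=> w1.
have d1 : is_derive w 1 (fun u : R => 1 + -1 * (u * u)) (- 2 * w).
  apply: (is_derive_eq (is_deriveDR (is_derive_cstR 1 w) (is_derive_mulcR (-1)
    (is_deriveMR (is_derive_id w 1) (is_derive_id w 1))))); ring.
have d2 : is_derive (1 + -1 * (w * w)) 1 Num.sqrt (2 * Num.sqrt (1 + -1 * (w * w)))^-1.
  by apply: is_derive1_sqrt; rewrite mulN1r -expr2 rt_sub_gt0.
have -> : rt = fun w => Num.sqrt (1 + -1 * (w * w)).
  by apply/funext => u; rewrite /rt mulN1r -expr2.
apply: (is_derive_eq (@is_derive_compR _ Num.sqrt (fun u => 1 + -1 * (u * u)) w _ _ d2 d1)).
rewrite mulN1r -expr2 /al -/(rt w); have := rt_neq0 w1 => ?; field.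
by rewrite ?andbT.
Qed.

Lemma is_derive_al (w : R) : -1 < w < 1 -> is_derive w 1 al ((rt w)^-1 ^+ 3).
Proof.
move=> w1; have r0 := rt_neq0 w1.
have dV : is_derive w 1 (fun u => (rt u)^-1) ((rt w)^-1 ^+ 2 * al w).
  apply: (is_derive_eq (is_deriveV r0 (is_derive_rt w1))).
  by rewrite /GRing.scale/= mulNr mulrN opprK exprVn.
apply: (is_derive_eq (is_deriveMR (is_derive_id w 1) dV)).
rewrite /al.
have -> : w * ((rt w)^-1 ^+ 2 * (w / rt w)) + (rt w)^-1 * 1 =
  ((rt w)^-1 ^+ 3) * (w ^+ 2 + rt w ^+ 2) by field.
by rewrite rt_sqr// addrC subrK mulr1.
Qed.

Lemma oneDsqr_al (w : R) : -1 < w < 1 -> oneDsqr (al w) = (rt w)^-1 ^+ 2.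
Proof.
move=> w1; have r0 := rt_neq0 w1.
rewrite /oneDsqr /al.
have -> : 1 + (w / rt w) ^+ 2 = (rt w ^+ 2 + w ^+ 2) * (rt w)^-1 ^+ 2 by field.
by rewrite rt_sqr// subrK mul1r.
Qed.

Lemma al_lt (v w : R) : 0 <= v -> v < w -> w < 1 -> al v < al w.
Proof.
move=> v0 vw w1.
have ? : -1 < v < 1 by apply/andP; lra.
have ? : -1 < w < 1 by apply/andP; lra.
rewrite /al ltr_pM ?invr_ge0 ?rt_ge0//.
rewrite ltf_pV2 ?posrE ?rt_gt0// ltr_sqrt ?rt_sub_gt0//.
nra.
Qed.

Lemma al_surj (t : R) : 0 <= t -> exists2 w, 0 <= w < 1 & al w = t.
Proof.
move=> t0.
pose q := Num.sqrt (1 + t ^+ 2).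
have q0 : 0 < q by rewrite sqrtr_gt0 ltr_pwDl// sqr_ge0.
have q2 : q ^+ 2 = 1 + t ^+ 2 by rewrite sqr_sqrtr// addr_ge0// sqr_ge0.
have qN0 : q != 0 by rewrite gt_eqF.
have tq : t / q < 1.
  rewrite ltr_pdivrMr// mul1r -(@ltr_pXn2r _ 2) ?nnegrE ?(ltW q0)// q2 ltrDr//.
exists (t / q).
  by rewrite divr_ge0 ?(ltW q0).
rewrite /al.
have -> : rt (t / q) = q^-1.
  rewrite /rt.
  have -> : 1 - (t / q) ^+ 2 = q^-1 ^+ 2.
    have -> : 1 - (t / q) ^+ 2 = (q ^+ 2 - t ^+ 2) * q^-1 ^+ 2 by field.
    by rewrite q2 addrK mul1r.
  by rewrite sqrtr_sqr ger0_norm// invr_ge0 ltW.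
by rewrite invrK divfK.
Qed.

Lemma continuous_rtV3 (w : R) : -1 < w < 1 -> {for w, continuous (fun w => (rt w)^-1 ^+ 3)}.
Proof.
move=> w1.
have c : (rt u)^-1 @[u --> w] --> (rt w)^-1.
  by apply: cvgV; [exact: rt_neq0|exact: is_derive_continuous (is_derive_rt w1)].
have -> : (fun w => (rt w)^-1 ^+ 3) = (fun w => (rt w)^-1 * ((rt w)^-1 * (rt w)^-1)).
  by apply/funext => u; rewrite exprS expr2.
by apply: cvgM => //; exact: cvgM.
Qed.

Lemma derive1_al (w : R) : -1 < w < 1 -> derive1 al w = (rt w)^-1 ^+ 3.
Proof. by move=> w1; rewrite derive1E; have h := is_derive_al w1; exact: derive_val. Qed.

Lemma continuous_derive1_al (w : R) : -1 < w < 1 -> derive1 al u @[u --> w] --> (rt w)^-1 ^+ 3.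
Proof.
move=> w1; apply: cvg_trans (continuous_rtV3 w1).
have /andP[w0 w2] := w1.
apply: near_eq_cvg; near=> u; rewrite derive1_al//; apply/andP; split.
  by near: u; exact: lt_nbhsr.
by near: u; exact: lt_nbhsl.
Unshelve. all: by end_near. Qed.

(** Substitution t = al w, whose derivative is the inverse cube of rt w. *)
Lemma integral_al (b : R) (G : R -> R) : 0 < b < 1 -> continuous G ->
  (\int[mu]_(w in `[0%R, b]) (G (al w) * (rt w)^-1 ^+ 3)%R%:E =
   \int[mu]_(t in `[0%R, al b]) (G t)%:E)%E.
Proof.
move=> /andP[b0 b1] cG.
have I w : 0 <= w <= b -> -1 < w < 1 by move=> /andP[? ?]; apply/andP; lra.
have al0 : al 0 = 0 by rewrite /al mul0r.
have := @integration_by_substitution_increasing R al G 0 b (ltW b0).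
rewrite al0 => ->.
- apply: eq_integral => w; rewrite inE/= in_itv/= => wb.
  by rewrite -derive1_al ?I.
- move=> v w; rewrite !in_itv/= => /andP[v0 vb] /andP[w0 wb] vw.
  by apply: al_lt => //; lra.
- move=> w; rewrite in_itv/= => /andP[w0 wb].
  have ? : -1 < w < 1 by apply/andP; lra.
  by rewrite /continuous_at derive1_al//; exact: continuous_derive1_al.
- apply/cvg_ex; exists ((rt 0)^-1 ^+ 3); apply: cvg_at_right_filter.
  by apply: continuous_derive1_al; apply/andP; lra.
- apply/cvg_ex; exists ((rt b)^-1 ^+ 3); apply: cvg_at_left_filter.
  by apply: continuous_derive1_al; apply/andP; lra.
- have c (w : R) : -1 < w < 1 -> al u @[u --> w] --> al w.
    by move=> w1; exact: is_derive_continuous (is_derive_al w1).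
  split.
  + move=> w; rewrite in_itv/= => /andP[w0 wb].
    have w1 : -1 < w < 1 by apply/andP; lra.
    by have [] := is_derive_al w1.
  + by apply: cvg_at_right_filter; apply: c; apply/andP; lra.
  + by apply: cvg_at_left_filter; apply: c; apply/andP; lra.
- exact: continuous_subspaceT.
Qed.

End frequency.

(** * Improper integrals in the frequency variable *)

Section improper.
Context (R : realType).
Local Notation mu := (@lebesgue_measure R).

Lemma Rintegral_left_cvg (f : R -> R) : mu.-integrable `]0, 1[ (EFin \o f) ->
  (fun b => \int[mu]_(w in `]0, b]) f w) @ 1^'- --> \int[mu]_(w in `]0, 1[) f w.
Proof.
move=> intf; apply/cvg_at_leftP => u [u1 ucvg].
apply: (@Rintegral_exhaustion _ `]0, 1[%classic (fun n => `]0, u n]%classic) f) => //.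
- move=> n w /=; rewrite !in_itv/= => /andP[-> wu].
  exact: le_lt_trans wu (u1 n).
- move=> w /=; rewrite in_itv/= => /andP[w0 w1].
  near=> n; rewrite in_itv/= w0/= ltW//.
  by near: n; exact: (cvgr_gt _ ucvg).
Unshelve. all: by end_near. Qed.

Lemma improper_integral01_integrable (f : R -> R) : mu.-integrable `]0, 1[ (EFin \o f) ->
  improper_integral01 f (\int[mu]_(w in `]0, 1[) f w).
Proof.
move=> intf; split; last exact: Rintegral_left_cvg.
move=> b /andP[b0 b1]; apply: (@integrableS _ _ _ mu `]0, 1[%classic) => //.
move=> w /=; rewrite !in_itv/= => /andP[-> wb].
exact: le_lt_trans wb b1.
Qed.

End improper.

Section frequency_weight.
Context (R : realType).
Local Notation mu := (@lebesgue_measure R).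

Let b_ (n : nat) : R := 1 - n.+2%:R^-1.

Let b_01 n : 0 < b_ n < 1.
Proof.
have h : n.+2%:R^-1 < 1 :> R by rewrite invf_lt1// ltr1n.
have h0 : 0 < n.+2%:R^-1 :> R by rewrite invr_gt0.
by rewrite /b_; move: h h0; move: (n.+2%:R^-1) => e *; apply/andP; lra.
Qed.

Let b_cvg : b_ n @[n --> \oo] --> (1 : R).
Proof.
rewrite -[X in _ --> X]subr0; apply: cvgB; first exact: cvg_cst.
by have := @cvg_harmonic R; rewrite -(@cvg_shiftS _ (fun n => n.+1%:R^-1 : R)).
Qed.

Let b_near w : w < 1 -> \forall n \near \oo, w < b_ n.
Proof. by move=> w1; exact: (cvgr_gt _ b_cvg). Qed.

(** The weight 1 / rt w is the pull-back of 1 / (1 + t^2) by al, hence of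
    total mass pi / 2. *)
Lemma integrable_rtV : mu.-integrable `]0, 1[ (fun w => ((rt w)^-1)%:E).
Proof.
apply/integrableP; split.
  by apply/measurable_EFinP/measurable_funTS; exact: measurable_rtV.
under eq_integral do rewrite /= ger0_norm ?invr_ge0 ?rt_ge0//.
apply: (@le_lt_trans _ _ (pi / 2)%:E); last exact: ltry.
have mf : measurable_fun setT (EFin \o (fun w : R => (rt w)^-1)).
  by apply/measurable_EFinP; exact: measurable_rtV.
have f0 (w : R) : (0 <= ((rt w)^-1)%:E)%E by rewrite lee_fin invr_ge0 rt_ge0.
have D : `]0, 1[%classic `<=` \bigcup_n `[0, b_ n]%classic.
  move=> w /=; rewrite in_itv/= => /andP[w0 w1].
  have [n _ /(_ n (leqnn n))/= h] := b_near w1.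
  by exists n => //=; rewrite in_itv/= !ltW.
have mU : measurable (\bigcup_n `[0, b_ n]%classic) by apply: bigcupT_measurable.
apply: (@le_trans _ _ (\int[mu]_(w in \bigcup_n `[0%R, b_ n]%classic) ((rt w)^-1)%:E)%E).
  apply: ge0_subset_integral => //; exact: measurable_funTS.
have h : (\int[mu]_(w in `[0%R, b_ n]%classic) ((rt w)^-1)%:E)%E @[n --> \oo] -->
    (\int[mu]_(w in \bigcup_n `[0%R, b_ n]%classic) ((rt w)^-1)%:E)%E.
  apply: ge0_nondecreasing_set_cvg_integral => //.
  - move=> m n mn; apply/subsetPset => w /=; rewrite !in_itv/= => /andP[-> wm]/=.
    by apply: le_trans wm _; rewrite /b_ lerB// lef_pV2 ?posrE// ler_nat.
  - by move=> n; exact: measurable_funTS.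
rewrite -(cvg_lim _ h)//; apply: lime_le; first by apply/cvg_ex; eexists; exact: h.
apply: nearW => n.
rewrite -integral0y_oneDsqr.
rewrite (_ : integral _ _ _ = \int[mu]_(w in `[0%R, b_ n]) ((oneDsqr (al w))^-1 * (rt w)^-1 ^+ 3)%R%:E)%E.
  rewrite (integral_al (b_01 n) (@continuous_oneDsqrV R)).
  apply: ge0_subset_integral => //=.
  - apply/measurable_EFinP/measurable_funTS.
    exact: continuous_measurable_fun (@continuous_oneDsqrV R).
  - by move=> w /=; rewrite !in_itv/= => /andP[->].
apply: eq_integral => w; rewrite inE/= in_itv/= => /andP[w0 wb].
have w1 : -1 < w < 1 by have := b_01 n => /andP[? ?]; apply/andP; lra.
have := rt_neq0 w1; rewrite oneDsqr_al// => r0; congr EFin; by field.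
Qed.

Lemma integrable_cos_al (y : R) :
  mu.-integrable `]0, 1[ (EFin \o (fun w => cos (y * al w) / rt w)).
Proof.
apply: (@le_integrableR _ _ _ mu _ _ (fun w => (rt w)^-1)) => //; last exact: integrable_rtV.
  apply: measurable_funTS; apply: measurable_funM; last exact: measurable_rtV.
  apply: (measurableT_comp (continuous_measurable_fun (@continuous_coss R y))).
  exact: measurable_al.
move=> w _; have r0 : 0 <= (rt w)^-1 by rewrite invr_ge0 rt_ge0.
by rewrite normrM (ger0_norm r0) ler_piMl ?normr_cos_le1.
Qed.

(** The substitution t = al w reduces this to the Fourier transform of the
    Cauchy density; the two improper ranges are exhausted by ]0, b_ n] and [0,
    al (b_ n)]. *)
Lemma Rintegral_cos_al (y : R) :
  \int[mu]_(w in `]0, 1[) (cos (y * al w) / rt w) = pi / 2 * expR (- `|y|).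
Proof.
pose G t : R := cos (y * t) / oneDsqr t.
have cG : continuous G.
  by move=> t; apply: cvgM; [exact: continuous_coss|exact: continuous_oneDsqrV].
have GE w : -1 < w < 1 -> G (al w) * (rt w)^-1 ^+ 3 = cos (y * al w) / rt w.
  by move=> w1; have := rt_neq0 w1; rewrite /G oneDsqr_al// => r0; field.
have iw := integrable_cos_al y.
have iG : mu.-integrable `[0, +oo[ (EFin \o G).
  apply: (@le_integrableR _ _ _ mu _ _ (fun t => (oneDsqr t)^-1)) => //.
  - by apply: measurable_funTS; exact: continuous_measurable_fun.
  - move=> t _; have t0 : 0 <= (oneDsqr t)^-1 by rewrite invr_ge0 (le_trans _ (oneDsqr_ge1 _)).
    by rewrite normrM (ger0_norm t0) ler_piMl ?normr_cos_le1.
  - by apply: (@integrableS _ _ _ _ setT) => //; exact: integrable_oneDsqrV.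
rewrite -integral_cos_oneDsqr.
have H1 := @Rintegral_exhaustion R `]0, 1[%classic (fun n => `]0, b_ n]%classic) _ _ _ _ _ iw.
have H2 := @Rintegral_exhaustion R `[0, +oo[%classic (fun n => `[0, al (b_ n)]%classic) _ _ _ _ _ iG.
have E n : \int[mu]_(w in `]0, b_ n]) (cos (y * al w) / rt w) = \int[mu]_(t in `[0, al (b_ n)]) G t.
  rewrite Rintegral_itv_obnd_cbnd; last first.
    apply: (@integrableS _ _ _ mu `]0, 1[%classic) => //.
    move=> w /=; rewrite !in_itv/= => /andP[-> wb].
    by apply: le_lt_trans wb _; have := b_01 n => /andP[].
  rewrite /Rintegral -(integral_al (b_01 n) cG); congr fine.
  apply: eq_integral => w; rewrite inE/= in_itv/= => /andP[w0 wb].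
  by rewrite GE//; have := b_01 n => /andP[? ?]; apply/andP; lra.
have H1' : \int[mu]_(w in `]0, b_ n]) (cos (y * al w) / rt w) @[n --> \oo] -->
    \int[mu]_(w in `]0, 1[) (cos (y * al w) / rt w).
  apply: H1 => //.
  - move=> n w /=; rewrite !in_itv/= => /andP[-> wb].
    by apply: le_lt_trans wb _; have := b_01 n => /andP[].
  - move=> w /=; rewrite in_itv/= => /andP[w0 w1].
    by near=> n; rewrite in_itv/= w0/= ltW//; near: n; exact: b_near.
have H2' : \int[mu]_(t in `[0, al (b_ n)]) G t @[n --> \oo] --> \int[mu]_(t in `[0, +oo[) G t.
  apply: H2 => //.
  - by move=> n t /=; rewrite !in_itv/= => /andP[->].
  - move=> t /=; rewrite in_itv/= andbT => t0.
    have [w /andP[w0 w1] <-] := al_surj t0.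
    near=> n; rewrite in_itv/= /al divr_ge0 ?rt_ge0//=.
    apply/ltW/al_lt => //; last by have := b_01 n => /andP[].
    by near: n; exact: b_near.
move: H1'; under eq_fun do rewrite E.
by move/cvg_lim => <- //; exact/cvg_lim.
Unshelve. all: by end_near. Qed.

End frequency_weight.

(** * Frequency representation of the walk densities *)

Section density_fourier.
Context (R : realType).
Local Notation mu := (@lebesgue_measure R).
Variables (a : R) (a0 : 0 < a).

(** The weight is extended by 0 to the whole line so that Fubini can be used
    with the full Lebesgue measure. *)
Definition freq_weight : R -> R := (fun w => (rt w)^-1) \_ `]0, 1[.

Lemma freq_weight_ge0 w : 0 <= freq_weight w.
Proof. by rewrite /freq_weight patchE; case: ifP => // _; rewrite invr_ge0 rt_ge0. Qed.

Lemma measurable_freq_weight : measurable_fun setT freq_weight.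
Proof.
apply/(measurable_restrictT (fun w => (rt w)^-1) (measurable_itv _)).
by apply: measurable_funTS; exact: measurable_rtV.
Qed.

Lemma integrable_freq_weight : mu.-integrable setT (EFin \o freq_weight).
Proof.
rewrite /freq_weight -restrict_EFin; apply/integrable_restrict => //=; rewrite ?setTI ?setIT.
exact: integrable_rtV.
Qed.

Lemma Rintegral_freq_weight (f : R -> R) :
  \int[mu]_w (freq_weight w * f w) = \int[mu]_(w in `]0, 1[) (f w / rt w).
Proof.
rewrite [RHS]Rintegral_mkcond; apply: eq_Rintegral => w _.
by rewrite /freq_weight !patchE; case: ifP => _; rewrite ?mul0r// mulrC.
Qed.

Lemma integrable_freq_weightM (f : R -> R) (M : R) : measurable_fun setT f ->
  (forall w, 0 < w < 1 -> `|f w| <= M) -> mu.-integrable setT (EFin \o (fun w => freq_weight w * f w)).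
Proof.
move=> mf fM.
have M0 : 0 <= M.
  by apply: le_trans (fM 2^-1 _); rewrite // invr_gt0 ltr0n/= invf_lt1// ltr1n.
apply: (@le_integrableR _ _ _ mu _ _ (fun w => M * freq_weight w)) => //.
- by apply: measurable_funM => //; exact: measurable_freq_weight.
- move=> w _; rewrite normrM (ger0_norm (freq_weight_ge0 w)) mulrC /freq_weight patchE.
  case: ifPn => [|_]; last by rewrite !mulr0.
  rewrite inE/= in_itv/= => w01.
  by rewrite ler_wpM2r ?invr_ge0 ?rt_ge0// fM.
- exact: (@integrableZl _ _ _ mu setT measurableT M _ integrable_freq_weight).
Qed.

Lemma sqr1_bound (w : R) k : 0 < w < 1 -> 0 <= (1 - w ^+ 2) ^+ k <= 1.
Proof.
move=> w1; have := rt_sub_gt0 (itv01_itv11 w1) => h.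
apply/andP; split; first by apply: exprn_ge0; exact: ltW.
by apply: exprn_ile1; [exact: ltW|rewrite gerBl sqr_ge0].
Qed.

Local Notation kint z k w := (cos (z * (a * al w)) * (1 - w ^+ 2) ^+ k).

Let measurable_scal z : measurable_fun setT (fun w : R => z * (a * al w)).
Proof. by apply: measurable_funM => //; apply: measurable_funM => //; exact: measurable_al. Qed.

Let measurable_sqr1 k : measurable_fun setT (fun w : R => (1 - w ^+ 2) ^+ k).
Proof. by apply: measurable_funX; apply: measurable_funB => //; exact: measurable_funX. Qed.

Let mcos : measurable_fun setT (@cos R).
Proof. exact: continuous_measurable_fun (@continuous_cos R). Qed.
Let msin : measurable_fun setT (@sin R).
Proof. exact: continuous_measurable_fun (@continuous_sin R). Qed.

Let kint_le1 (z : R) k w : 0 < w < 1 -> `|kint z k w| <= 1.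
Proof.
move=> w1; have /andP[s0 s1] := sqr1_bound k w1.
by rewrite normrM (ger0_norm s0) -[leRHS]mulr1 ler_pM ?normr_cos_le1.
Qed.

(** At frequency a * al w an exponential leg has characteristic function 1 /
    (1 - i s al w), whose real part is 1 - w^2 and whose imaginary part is s w
    rt w. *)
Lemma expo_osc (s z w : R) : s ^+ 2 = 1 -> 0 < w < 1 ->
  \int[expo a0]_r cos ((z + s * r) * (a * al w)) =
  cos (z * (a * al w)) * (1 - w ^+ 2) - s * (w * rt w * sin (z * (a * al w))).
Proof.
move=> s1 w1; have r0 := rt_neq0 (itv01_itv11 w1); have r2 := rt_sqr (itv01_itv11 w1).
pose b := s * (a * al w).
have bc : bmeas 1 (fun r : R => cos (b * r)).
  split; last by move=> r; exact: normr_cos_le1.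
  exact: continuous_measurable_fun (@continuous_coss R _).
have bs : bmeas 1 (fun r : R => sin (b * r)).
  split; last by move=> r; exact: normr_sin_le1.
  exact: continuous_measurable_fun (@continuous_sins R _).
transitivity (\int[expo a0]_r (cos (z * (a * al w)) * cos (b * r) + (- sin (z * (a * al w))) * sin (b * r))).
  apply: eq_Rintegral => r _; rewrite mulrDl cosD mulNr.
  by congr (_ * cos _ - _ * sin _); rewrite /b; ring.
rewrite (prob_D (expo a0) (bmeasZ _ bc) (bmeasZ _ bs)) (prob_Z (expo a0) _ bc) (prob_Z (expo a0) _ bs).
rewrite Rintegral_expo_cos Rintegral_expo_sin.
have aN : a != 0 by rewrite gt_eqF.
have -> : a ^+ 2 + b ^+ 2 = a ^+ 2 / rt w ^+ 2.
  have -> : b ^+ 2 = a ^+ 2 * (w / rt w) ^+ 2.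
    by rewrite /b /al exprMn s1 mul1r exprMn.
  have -> : a ^+ 2 + a ^+ 2 * (w / rt w) ^+ 2 = a ^+ 2 * (rt w ^+ 2 + w ^+ 2) / rt w ^+ 2 by field.
  by rewrite r2 subrK mulr1.
rewrite -r2 /b /al; by field; rewrite ?aN ?r0.
Qed.

(** One more leg, of sign s, multiplies the integrand by the characteristic
    function computed in expo_osc. *)
Lemma shift_mean_freq (s : R) (g : R -> R) (M : R) (k : nat) : s ^+ 2 = 1 -> bmeas M g ->
  (forall z, pi / a * g z = \int[mu]_w (freq_weight w * kint z k w)) ->
  forall z, pi / a * shift_mean a0 s g z =
    \int[mu]_w (freq_weight w * ((cos (z * (a * al w)) * (1 - w ^+ 2) - s * (w * rt w * sin (z * (a * al w)))) * (1 - w ^+ 2) ^+ k)).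
Proof.
move=> s1 bg gE z.
rewrite /shift_mean -(prob_Z (expo a0) _ (bmeas_shift s z bg)).
under eq_Rintegral do rewrite gE.
have mf : measurable_fun setT (fun u : R * R => freq_weight u.2 * kint (z + s * u.1) k u.2).
  apply: measurable_funM; first by apply: (measurableT_comp measurable_freq_weight).
  apply: measurable_funM; last by apply: (measurableT_comp (measurable_sqr1 k)).
  apply: (measurableT_comp mcos); apply: measurable_funM.
    by apply: measurable_funD => //; exact: measurable_funM.
  apply: measurable_funM => //; by apply: (measurableT_comp (@measurable_al R)).
have fom (r w : R) : `|freq_weight w * kint (z + s * r) k w| <= freq_weight w.
  rewrite normrM (ger0_norm (freq_weight_ge0 w)) /freq_weight patchE; case: ifPn => [|_]; last by rewrite mul0r.
  rewrite inE/= in_itv/= => w01.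
  by rewrite ler_piMr ?invr_ge0 ?rt_ge0// kint_le1.
rewrite (@Rintegral_Fubini _ _ _ _ _ (expo a0) mu (fun u => freq_weight u.2 * kint (z + s * u.1) k u.2) freq_weight mf integrable_freq_weight fom).
apply: eq_Rintegral => w _ /=.
rewrite /freq_weight patchE; case: ifPn => [|_]; last first.
  by under eq_Rintegral do rewrite mul0r; rewrite prob_cst mul0r.
rewrite inE/= in_itv/= => w01.
rewrite -(expo_osc _ s1 w01).
have bc : bmeas 1 (fun r => cos ((z + s * r) * (a * al w))).
  split; last by move=> r; exact: normr_cos_le1.
  by apply: (measurableT_comp mcos); apply: measurable_funM => //; apply: measurable_funD => //; exact: measurable_funM.
rewrite mulrA -(prob_Z (expo a0) _ bc) [RHS]mulrC -(prob_Z (expo a0) _ (bmeasZ _ bc)).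
apply: eq_Rintegral => r _; ring.
Qed.

(** The imaginary parts of the two signs cancel, so each leg of fair sign
    multiplies the integrand by 1 - w^2. *)
Lemma walk_dens_freq (k : nat) (z : R) :
  pi / a * walk_dens a0 k z = \int[mu]_w (freq_weight w * kint z k w).
Proof.
elim: k z => [|k IH] z.
  rewrite Rintegral_freq_weight.
  under eq_Rintegral do rewrite expr0 mulr1 mulrA.
  rewrite Rintegral_cos_al /= normrM (gtr0_norm a0) [a * `|z|]mulrC.
  by field; rewrite gt_eqF.
have bg := bmeas_walk_dens a0 k.
have h s (s1 : s ^+ 2 = 1) := shift_mean_freq s1 bg IH z.
rewrite [walk_dens a0 k.+1]/= /laplace_mean mulrCA mulrDr !h ?sqrrN ?expr1n//.
have bnd (s : R) : s ^+ 2 = 1 -> mu.-integrable setT (EFin \o (fun w => freq_weight w * ((cos (z * (a * al w)) * (1 - w ^+ 2) - s * (w * rt w * sin (z * (a * al w)))) * (1 - w ^+ 2) ^+ k))).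
  move=> s1.
  apply: (@integrable_freq_weightM _ 2).
    apply: measurable_funM => //; apply: measurable_funB.
      apply: measurable_funM; first exact: (measurableT_comp mcos).
      by have := measurable_sqr1 1; under eq_fun do rewrite expr1.
    apply: measurable_funM => //; apply: measurable_funM; last exact: (measurableT_comp msin).
    by apply: measurable_funM => //; exact: measurable_rt.
  move=> w w01.
  have /andP[q0 q1] := sqr1_bound k w01.
  have := sqr1_bound 1 w01; rewrite expr1 => /andP[p0 p1].
  have ns1 := sqr1_norm s1.
  rewrite normrM (ger0_norm q0) -[leRHS]mulr1 ler_pM//.
  apply: le_trans (ler_normB _ _) _.
  rewrite (_ : 2 = 1 + 1)//; apply: lerD.
    by rewrite normrM (ger0_norm p0) -[leRHS]mulr1 ler_pM ?normr_cos_le1.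
  rewrite normrM ns1 mul1r !normrM -[leRHS]mulr1 ler_pM ?mulr_ge0 ?normr_sin_le1//.
  case/andP: w01 => w0 w1; rewrite (ger0_norm (rt_ge0 _)) (gtr0_norm w0).
  by rewrite -[leRHS]mulr1 ler_pM ?rt_ge0 ?rt_le1// ltW.
have p1 : (1 : R) ^+ 2 = 1 by rewrite expr1n.
have m1 : (-1 : R) ^+ 2 = 1 by rewrite sqrrN expr1n.
rewrite -RintegralD//; [|exact: bnd p1|exact: bnd m1].
rewrite -RintegralZl//; last first.
  exact: (@integrableD _ _ _ mu setT measurableT _ _ (bnd _ p1) (bnd _ m1)).
apply: eq_Rintegral => w _; move: (1 - w ^+ 2) => p; rewrite [p ^+ k.+1]exprS.
by move: (p ^+ k) => q; field.
Qed.

End density_fourier.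

(** * The walk after one and two legs *)

Section one_sided.
Context (R : realType).
Local Notation mu := (@lebesgue_measure R).
Variables (a : R) (a0 : 0 < a).

Lemma walk_dens_even k z : walk_dens a0 k (- z) = walk_dens a0 k z.
Proof.
elim: k z => [|k IH] z /=; first by rewrite normrN.
rewrite /laplace_mean addrC /shift_mean; congr (_ * (_ + _)).
  by apply: eq_Rintegral => r _; rewrite -IH; congr walk_dens; ring.
by apply: eq_Rintegral => r _; rewrite -IH; congr walk_dens; ring.
Qed.

Let a20 : 0 < 2 * a. Proof. by rewrite mulr_gt0. Qed.

Lemma Rintegral_expR_tail (z : R) : 0 <= z ->
  \int[mu]_(r in `]z, +oo[) (2 * a * expR (- (2 * a) * r)) = expR (- (2 * a) * z).
Proof.
move=> z0; transitivity (fine (expo a20 `]z, +oo[%classic)); last by rewrite expo_tail.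
rewrite /Rintegral expoE /exponential_prob; congr fine.
apply: eq_integral => r; rewrite inE/= in_itv/= andbT => zr.
by rewrite exponential_pdfE// ltW// (le_lt_trans z0).
Qed.

Let integrable_expR2 : mu.-integrable `[0, +oo[ (EFin \o (fun r : R => 2 * a * expR (- (2 * a) * r))).
Proof.
have := integrable_expo_lebesgue a20 (@measurable_cst _ _ (measurableTypeR R) _ _ (1 : R)) (fun _ => lexx `|1|).
by apply: eq_integrable => // r _ /=; rewrite mulr1.
Qed.

(** The integration by parts in improper_osc leaves the frequency integrals of
    walk_dens 0 and walk_dens 1, and the combination that appears needs both in closed
    form. *)
Lemma walk_dens1_pos (z : R) : 0 < z -> walk_dens a0 1 z = a / 4 * (1 + a * z) * expR (- (a * z)).
Proof.
move=> z0.
have b0 := bmeas_walk_dens a0 0.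
have [m1 B1] := bmeas_shift 1 z b0.
have [m2 B2] := bmeas_shift (-1) z b0.
have E1 : shift_mean a0 1 (walk_dens a0 0) z = a / 4 * expR (- (a * z)).
  rewrite /shift_mean (Rintegral_expo a0 m1 B1).
  have H : \int[mu]_(r in `[0, +oo[) (2 * a * expR (- (2 * a) * r)) = 1.
    rewrite -Rintegral_itv_obnd_cbnd ?Rintegral_expR_tail ?mulr0 ?expR0//.
    apply: (@integrableS _ _ _ mu `[0, +oo[%classic) => //.
    by apply: subset_itvr; rewrite bnd_simp.
  have -> : a / 4 * expR (- (a * z)) = a / 4 * expR (- (a * z)) *
      (\int[mu]_(r in `[0, +oo[) (2 * a * expR (- (2 * a) * r))) by rewrite H mulr1.
  rewrite -RintegralZl//.
  apply: eq_Rintegral => r; rewrite inE/= in_itv/= andbT => r0.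
  rewrite mul1r (ger0_norm (addr_ge0 (ltW z0) r0)).
  have -> : expR (- (2 * a) * r) = expR (- a * r) * expR (- (a * r)) by rewrite -expRD; congr expR; ring.
  by rewrite mulrDr opprD expRD; field.
have E2 : shift_mean a0 (-1) (walk_dens a0 0) z = a ^+ 2 / 2 * z * expR (- (a * z)) + a / 4 * expR (- (a * z)).
  rewrite /shift_mean (Rintegral_expo a0 m2 B2).
  have I2 := integrable_expo_lebesgue a0 m2 B2.
  rewrite -[LHS](subrK (\int[mu]_(r in `[0, z]) (a * expR (- a * r) * walk_dens a0 0 (z + -1 * r)))).
  rewrite (Rintegral_itvB I2)//; last by rewrite bnd_simp ltW.
  rewrite addrC; congr (_ + _).
    rewrite (@eq_Rintegral _ _ _ mu _ (cst (a ^+ 2 / 2 * expR (- (a * z))))); last first.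
      move=> t; rewrite inE/= in_itv/= => /andP[t0 tz].
      rewrite mulN1r ger0_norm ?subr_ge0//.
      have -> : expR (- (a * z)) = expR (- a * t) * expR (- (a * (z - t))).
        by rewrite -expRD; congr expR; ring.
      by field.
    rewrite Rintegral_cst//= lebesgue_measure_itv/= lte_fin z0 oppr0 adde0/=.
    by ring.
  have -> : a / 4 * expR (- (a * z)) = a / 4 * expR (a * z) * expR (- (2 * a) * z).
    by rewrite -[RHS]mulrA -expRD; congr (_ * expR _); ring.
  rewrite -(Rintegral_expR_tail (ltW z0)) -RintegralZl//; last first.
    apply: (@integrableS _ _ _ mu `[0, +oo[%classic) => //.
    by apply: subset_itvr; rewrite bnd_simp ltW.
  apply: eq_Rintegral => t; rewrite inE/= in_itv/= andbT => zr.
  rewrite mulN1r ltr0_norm ?subr_lt0//.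
  have -> : expR (- (2 * a) * t) = expR (- a * t) * expR (- (a * - (z - t))) * (expR (a * z))^-1.
    by rewrite -expRN -!expRD; congr expR; ring.
  by field; rewrite gt_eqF ?expR_gt0.
rewrite [LHS]/= /laplace_mean -/(walk_dens a0 0) E1 E2; by field.
Qed.

End one_sided.

(** * Integration by parts for the oscillating term *)

Section osc.
Context (R : realType).
Local Notation mu := (@lebesgue_measure R).

(** A primitive of f y below. Near w = 1 the term with the sine is not
    integrable, whereas the one with the cosine is dominated by 1 / rt w, so
    integration by parts trades a conditionally convergent integral for an
    absolutely convergent one. *)
Let F (y w : R) := - (cos (y * al w) * (w * rt w)).
Let f (y w : R) := y * (w * sin (y * al w) / (1 - w ^+ 2)) - cos (y * al w) * (1 - 2 * w ^+ 2) / rt w.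

Let dF (y w : R) : -1 < w < 1 -> is_derive w 1 (F y) (f y w).
Proof.
move=> w1; have r0 := rt_neq0 w1; have r2 := rt_sqr w1.
have dc : is_derive w 1 (fun u => cos (y * al u)) (- (y * (rt w)^-1 ^+ 3 * sin (y * al w))).
  apply: (is_derive_eq (@is_derive_compR _ cos (fun u => y * al u) w _ _ (is_derive_cos _) (is_derive_mulcR y (is_derive_al w1)))).
  by rewrite mulrN.
have dm := is_deriveMR (is_derive_id w 1) (is_derive_rt w1).
have := is_derive_mulcR (-1) (is_deriveMR dc dm).
have -> : (fun r => -1 * (cos (y * al r) * (r * rt r))) = F y.
  by apply/funext => u; rewrite /F mulN1r.
move=> h; apply: (is_derive_eq h); rewrite /f -r2.
have -> : 1 - 2 * w ^+ 2 = rt w ^+ 2 - w ^+ 2 by rewrite r2; ring.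
by rewrite /al; field.
Qed.

Let I0b (b w : R) : 0 < b < 1 -> 0 <= w <= b -> -1 < w < 1.
Proof. by move=> /andP[? ?] /andP[? ?]; apply/andP; lra. Qed.

Let cont_al (y w : R) : -1 < w < 1 -> {for w, continuous (fun u => y * al u)}.
Proof. by move=> w1; exact: is_derive_continuous (is_derive_mulcR y (is_derive_al w1)). Qed.

Let cvg_sin (y w : R) : -1 < w < 1 -> sin (y * al u) @[u --> w] --> sin (y * al w).
Proof. by move=> w1; apply: continuous_comp; [exact: cont_al|exact: continuous_sin]. Qed.

Let cvg_cos (y w : R) : -1 < w < 1 -> cos (y * al u) @[u --> w] --> cos (y * al w).
Proof. by move=> w1; apply: continuous_comp; [exact: cont_al|exact: continuous_cos]. Qed.

Let cvg_sqr (w : R) : (1 - u ^+ 2) @[u --> w] --> (1 - w ^+ 2).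
Proof. by apply: cvgB; [exact: cvg_cst|exact: exprn_continuous]. Qed.

Let cvg_osc (y w : R) : -1 < w < 1 ->
  {for w, continuous (fun w : R => w * sin (y * al w) / (1 - w ^+ 2))}.
Proof.
move=> w1; apply: cvgM; last by apply: cvgV; [rewrite gt_eqF// rt_sub_gt0|exact: cvg_sqr].
by apply: cvgM; [exact: cvg_id|exact: cvg_sin].
Qed.

Let cvg_reg (y w : R) : -1 < w < 1 ->
  {for w, continuous (fun w : R => cos (y * al w) * (1 - 2 * w ^+ 2) / rt w)}.
Proof.
move=> w1; apply: cvgM.
  apply: cvgM; first exact: cvg_cos.
  by apply: cvgB; [exact: cvg_cst|apply: cvgMr; exact: exprn_continuous].
by apply: cvgV; [exact: rt_neq0|exact: is_derive_continuous (is_derive_rt w1)].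
Qed.

Let int_cont (g : R -> R) b : 0 < b < 1 -> (forall w : R, -1 < w < 1 -> {for w, continuous g}) ->
  mu.-integrable `[0, b] (EFin \o g).
Proof.
move=> b01 cg; apply: continuous_compact_integrable; first exact: segment_compact.
apply: continuous_in_subspaceT => w; rewrite inE/= in_itv/= => wb.
by apply: cg; exact: I0b wb.
Qed.

Let int_cont0 (g : R -> R) b : 0 < b < 1 -> (forall w : R, -1 < w < 1 -> {for w, continuous g}) ->
  mu.-integrable `]0, b] (EFin \o g).
Proof.
move=> b01 cg; apply: (@integrableS _ _ _ mu `[0, b]%classic) => //; last exact: int_cont.
by apply: subset_itvr; rewrite bnd_simp.
Qed.

Lemma integrable_osc (y b : R) : 0 < b < 1 ->
  mu.-integrable `]0, b] (EFin \o (fun w => w * sin (y * al w) / (1 - w ^+ 2))).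
Proof. by move=> b01; apply: (int_cont0 b01) => w; exact: cvg_osc. Qed.

Lemma integral_osc (y b : R) : 0 < b < 1 ->
  y * (\int[mu]_(w in `]0, b]) (w * sin (y * al w) / (1 - w ^+ 2))) =
  - (cos (y * al b) * (b * rt b)) + \int[mu]_(w in `]0, b]) (cos (y * al w) * (1 - 2 * w ^+ 2) / rt w).
Proof.
move=> b01; have /andP[b0 b1] := b01.
have i1 := int_cont b01 (@cvg_osc y).
have i2 := int_cont b01 (@cvg_reg y).
have sub : `]0, b]%classic `<=` (`[0, b]%classic : set R) by apply: subset_itvr; rewrite bnd_simp.
have iS g : mu.-integrable `[0, b] (EFin \o g) -> mu.-integrable `]0, b] (EFin \o g).
  by move=> ig; apply: (@integrableS _ _ _ mu `[0, b]%classic).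
rewrite !Rintegral_itv_obnd_cbnd; [|exact: iS|exact: iS].
apply: (canRL (subrK _)); rewrite -/(F y b).
rewrite -RintegralZl//.
have i1' : mu.-integrable `[0, b] (EFin \o (fun w => y * (w * sin (y * al w) / (1 - w ^+ 2)))).
  exact: (@integrableZl _ _ _ mu `[0, b]%classic (measurable_itv _) y _ i1).
rewrite -RintegralB//.
rewrite /Rintegral (@continuous_FTC2 _ (f y) (F y))//.
- by rewrite /= {2}/F mul0r mulr0 oppr0 subr0.
- apply: continuous_in_subspaceT => w; rewrite inE/= in_itv/= => wb.
  have w1 := I0b b01 wb.
  apply: cvgB; last exact: cvg_reg.
  by apply: cvgMr; exact: cvg_osc.
- have c (w : R) : -1 < w < 1 -> {for w, continuous (F y)}.
    by move=> w1; exact: is_derive_continuous (dF y w1).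
  split.
  + move=> w; rewrite in_itv/= => /andP[w0 wb].
    by have [] := dF y (I0b b01 (introT andP (conj (ltW w0) (ltW wb)))).
  + by apply: cvg_at_right_filter; apply: c; apply/andP; lra.
  + by apply: cvg_at_left_filter; apply: c; apply/andP; lra.
- move=> w; rewrite in_itv/= => /andP[w0 wb].
  rewrite derive1E; have h := dF y (I0b b01 (introT andP (conj (ltW w0) (ltW wb)))).
  exact: derive_val.
Qed.

End osc.

(** * The one-sided exponential density as an improper integral *)

Section improper_algebra.
Context (R : realType).
Local Notation mu := (@lebesgue_measure R).

Let sub01 (b w : R) : 0 < b < 1 -> w \in `]0, b]%classic -> 0 < w < 1.
Proof. by move=> /andP[b0 b1]; rewrite inE/= in_itv/= => /andP[w0 wb]; apply/andP; lra. Qed.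

Lemma improper_integral01_eq (f g : R -> R) (I : R) :
  (forall w, 0 < w < 1 -> f w = g w) -> improper_integral01 f I -> improper_integral01 g I.
Proof.
move=> fg [intf cvf]; split.
  move=> b b01; apply: eq_integrable (intf b b01) => // w wb /=.
  by rewrite fg// (sub01 b01 wb).
apply: cvg_trans cvf; apply: near_eq_cvg; near=> b.
apply: eq_Rintegral => w; rewrite inE/= in_itv/= => /andP[w0 wb].
by rewrite fg// w0/=; apply: le_lt_trans wb _; near: b; exact: nbhs_left_lt.
Unshelve. all: by end_near. Qed.

Lemma improper_integral01D (f g : R -> R) (I J : R) :
  improper_integral01 f I -> improper_integral01 g J ->
  improper_integral01 (fun w => f w + g w) (I + J).
Proof.
move=> [intf cvf] [intg cvg]; split.
  by move=> b b01; exact: (@integrableD _ _ _ mu _ (measurable_itv _) _ _ (intf b b01) (intg b b01)).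
apply: cvg_trans (cvgD cvf cvg); apply: near_eq_cvg; near=> b.
have b01 : 0 < b < 1.
  by apply/andP; split; near: b; [exact: nbhs_left_gt|exact: nbhs_left_lt].
by rewrite /= RintegralD//; [exact: intf|exact: intg].
Unshelve. all: by end_near. Qed.

Lemma improper_integral01Z (c : R) (f : R -> R) (I : R) :
  improper_integral01 f I -> improper_integral01 (fun w => c * f w) (c * I).
Proof.
move=> [intf cvf]; split.
  by move=> b b01; exact: (@integrableZl _ _ _ mu _ (measurable_itv _) c _ (intf b b01)).
have L : c * \int[mu]_(w in `]0, b]) f w @[b --> 1^'-] --> c * I by exact: cvgMr.
apply: cvg_trans L; apply: near_eq_cvg; near=> b.
have b01 : 0 < b < 1.
  by apply/andP; split; near: b; [exact: nbhs_left_gt|exact: nbhs_left_lt].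
by rewrite /= RintegralZl//; exact: intf.
Unshelve. all: by end_near. Qed.

End improper_algebra.

Section one_sided_limit.
Context (R : realType).
Local Notation mu := (@lebesgue_measure R).
Variables (a : R) (a0 : 0 < a).

Let rt_left : rt b @[b --> 1^'-] --> (0 : R).
Proof.
have -> : (0 : R) = rt 1 by rewrite /rt expr1n subrr sqrtr0.
apply: cvg_at_left_filter.
apply: (@continuous_comp _ _ _ (fun b : R => 1 - b ^+ 2) Num.sqrt); last exact: sqrt_continuous.
by apply: cvgB; [exact: cvg_cst|exact: exprn_continuous].
Qed.

Let bdry_left (y : R) : - (cos (y * al b) * (b * rt b)) @[b --> 1^'-] --> (0 : R).
Proof.
rewrite -[X in _ --> X]oppr0; apply: cvgN; apply/norm_cvg0P.
have H : \forall b \near (1 : R)^'-, cst 0 b <= `|cos (y * al b) * (b * rt b)| <= rt b.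
  near=> b; rewrite normr_ge0/= !normrM (ger0_norm (rt_ge0 b)).
  rewrite -[leRHS]mul1r ler_pM ?mulr_ge0 ?rt_ge0 ?normr_cos_le1//.
  rewrite ler_piMl ?rt_ge0// ger0_norm.
    by near: b; exact: nbhs_left_le.
  by near: b; exact: nbhs_left_ge.
exact: (squeeze_cvgr H (cvg_cst _) rt_left).
Unshelve. all: by end_near. Qed.

(** The boundary term in integral_osc is at most rt b and vanishes in the
    limit; the remaining integrand is 2 (1 - w^2) - 1 times the cosine over rt
    w, which walk_dens_freq evaluates. *)
Lemma improper_osc (z : R) : z != 0 ->
  improper_integral01 (fun w => w * sin (z * (a * al w)) / (1 - w ^+ 2))
    (pi / 2 * (`|z| / z) * expR (- (a * `|z|))).
Proof.
move=> z0; have aN : a != 0 by rewrite gt_eqF.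
under [X in improper_integral01 X]eq_fun do rewrite mulrA.
split; first by move=> b b01; exact: integrable_osc.
have y0 : z * a != 0 by rewrite mulf_neq0.
pose reg (w : R) := cos (z * a * al w) * (1 - 2 * w ^+ 2) / rt w.
have E : \int[mu]_(w in `]0, 1[) reg w = pi / 2 * (a * `|z|) * expR (- (a * `|z|)).
  have intk k : mu.-integrable setT (EFin \o (fun w => freq_weight w * (cos (z * (a * al w)) * (1 - w ^+ 2) ^+ k))).
    apply: (@integrable_freq_weightM _ _ 1).
      apply: measurable_funM; last by apply: measurable_funX; apply: measurable_funB => //; exact: measurable_funX.
      apply: (measurableT_comp (continuous_measurable_fun (@continuous_cos R))).
      by apply: measurable_funM => //; apply: measurable_funM => //; exact: measurable_al.
    move=> w w1; have /andP[s0 s1] := sqr1_bound k w1.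
    by rewrite normrM (ger0_norm s0) -[leRHS]mulr1 ler_pM ?normr_cos_le1.
  transitivity (2 * (\int[mu]_w (freq_weight w * (cos (z * (a * al w)) * (1 - w ^+ 2) ^+ 1))) -
      \int[mu]_w (freq_weight w * (cos (z * (a * al w)) * (1 - w ^+ 2) ^+ 0))).
    rewrite -Rintegral_freq_weight -RintegralZl// -RintegralB//.
      by apply: eq_Rintegral => w _; rewrite expr1 expr0 -[z * a * al w]mulrA; ring.
    exact: (@integrableZl _ _ _ mu setT measurableT 2 _ (intk 1%N)).
  rewrite -!walk_dens_freq //.
  have -> : walk_dens a0 1 z = a / 4 * (1 + a * `|z|) * expR (- (a * `|z|)).
    have [z1|z1] := ltP 0 z; first by rewrite gtr0_norm// walk_dens1_pos.
    rewrite -walk_dens_even ler0_norm// walk_dens1_pos// oppr_gt0 lt_neqAle z0//.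
  by rewrite /=; field.
have ireg : mu.-integrable `]0, 1[ (EFin \o reg).
  apply: (@le_integrableR _ _ _ mu _ _ (fun w => (rt w)^-1)) => //; last exact: integrable_rtV.
    apply: measurable_funTS; apply: measurable_funM; last exact: measurable_rtV.
    apply: measurable_funM.
      apply: (measurableT_comp (continuous_measurable_fun (@continuous_cos R))).
      by apply: measurable_funM => //; exact: measurable_al.
    by apply: measurable_funB => //; apply: measurable_funM => //; exact: measurable_funX.
  move=> w /=; rewrite in_itv/= => /andP[w0 w1].
  have r0 : 0 <= (rt w)^-1 by rewrite invr_ge0 rt_ge0.
  rewrite normrM (ger0_norm r0) ler_piMl// normrM -[leRHS]mulr1 ler_pM ?normr_cos_le1//.
  by rewrite ler_norml; apply/andP; split; nra.
have L : (z * a)^-1 * (- (cos (z * a * al b) * (b * rt b)) + \int[mu]_(w in `]0, b]) reg w) @[b --> 1^'-] -->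
    (z * a)^-1 * (pi / 2 * (a * `|z|) * expR (- (a * `|z|))).
  apply: cvgMr; rewrite -[X in _ --> X]add0r -E; apply: cvgD; first exact: bdry_left.
  exact: Rintegral_left_cvg.
have -> : pi / 2 * (`|z| / z) * expR (- (a * `|z|)) = (z * a)^-1 * (pi / 2 * (a * `|z|) * expR (- (a * `|z|))).
  by field; rewrite aN z0.
apply: cvg_trans L; apply: near_eq_cvg; near=> b.
have b01 : 0 < b < 1.
  by apply/andP; split; near: b; [exact: nbhs_left_gt|exact: nbhs_left_lt].
by rewrite /= -integral_osc// mulrA mulVf// mul1r.
Unshelve. all: by end_near. Qed.

(** The cosine part gives half of the symmetric exponential and the sine part
    gives s times the sign of z times the same, so they add on one side of 0
    and cancel on the other. *)
Lemma improper_first_dens0 (s z : R) : s ^+ 2 = 1 -> z != 0 ->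
  improper_integral01
    (fun w => (rt w * cos (z * (a * al w)) + s * (w * sin (z * (a * al w)))) / (1 - w ^+ 2))
    (pi / a * exponential_pdf a (s * z)).
Proof.
move=> s1 z0; have aN : a != 0 by rewrite gt_eqF.
have i1 := integrable_cos_al (z * a).
have := improper_integral01D (improper_integral01_integrable i1) (improper_integral01Z s (improper_osc z0)).
rewrite Rintegral_cos_al.
have -> : pi / 2 * expR (- `|z * a|) + s * (pi / 2 * (`|z| / z) * expR (- (a * `|z|))) =
    pi / a * exponential_pdf a (s * z).
  rewrite normrM (gtr0_norm a0) (mulrC `|z| a).
  have /orP[/eqP s1'|/eqP s1'] : (s == 1) || (s == -1) by rewrite -sqrf_eq1 s1.
  - rewrite s1' !mul1r; have [z1|z1] := ltP 0 z.
      by rewrite exponential_pdfE ?ltW// gtr0_norm// mulfV// mulNr; field.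
    rewrite lt0_exponential_pdf ?lt_neqAle ?z0// ler0_norm// mulNr mulfV//; by field.
  - rewrite s1' !mulN1r; have [z1|z1] := ltP 0 z.
      by rewrite lt0_exponential_pdf ?oppr_lt0// gtr0_norm// mulfV//; field.
    by rewrite exponential_pdfE ?oppr_ge0// ler0_norm// mulNr mulfV// !mulrN !mulNr !opprK; field.
apply: improper_integral01_eq => w w01.
have w1 := itv01_itv11 w01.
have := rt_neq0 w1; rewrite -(rt_sqr w1) -mulrA => r0; by field.
Qed.

End one_sided_limit.

(** * Mixtures of densities *)

Section mixture.
Context (R : realType).
Local Notation mu := (@lebesgue_measure R).
Variables (a : R) (a0 : 0 < a).
Variables (p : nat -> R) (C : R).
Hypotheses (p_ge0 : forall k, 0 <= p k) (p_le : forall n, \sum_(k < n) p k <= C).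
Variable G : nat -> R -> R.
Hypotheses (bG : forall k, bmeas a (G k)) (G_ge0 : forall k z, 0 <= G k z).

(** A pointwise limit of partial sums; it exists because the densities are
    bounded by a and the weights are summable. *)
Definition mixdens (z : R) : R := limn (fun n => \sum_(k < n) p k * G k z).

Lemma mixdens_cvg z : \sum_(k < n) p k * G k z @[n --> \oo] --> mixdens z.
Proof.
apply: nondecreasing_is_cvgn.
  apply/nondecreasing_seqP => n; rewrite big_ord_recr/= lerDl mulr_ge0//.
exists (a * C) => _ [n _ <-]; apply: le_trans (ler_wpM2l (ltW a0) (p_le n)).
rewrite mulr_sumr; apply: ler_sum => k _; rewrite mulrC ler_wpM2r//.
by apply: le_trans (ler_norm _) _; have [] := bG k.
Qed.

Lemma mixdens_ge0 z : 0 <= mixdens z.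
Proof.
apply: limr_ge; first by apply/cvg_ex; eexists; exact: mixdens_cvg.
apply: nearW => n; by apply: sumr_ge0 => k _; exact: mulr_ge0.
Qed.

Lemma measurable_mixdens : measurable_fun setT mixdens.
Proof.
apply: (@measurable_fun_cvg _ _ R setT (fun n z => \sum_(k < n) p k * G k z)).
  move=> n; apply: measurable_sum => k; apply: measurable_funM => //.
  by have [] := bG k.
by move=> z _; exact: mixdens_cvg.
Qed.

Lemma mixdensE z : (mixdens z)%:E = (\sum_(k <oo) (p k * G k z)%:E)%E.
Proof.
apply/esym/cvg_lim => //.
rewrite (_ : (fun n => _) = (fun n => (\sum_(k < n) p k * G k z)%:E)); last first.
  by apply/funext => n; rewrite sumEFin big_mkord.
by apply/cvg_EFin; [exact: nearW|exact: mixdens_cvg].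
Qed.

Lemma mixdens_law (A : set R) (x : R) : measurable A ->
  (\sum_(k <oo) (p k)%:E * \int[mu]_(z in A) (G k (z - x))%:E =
   \int[mu]_(z in A) (mixdens (z - x))%:E)%E.
Proof.
move=> mA; under [RHS]eq_integral do rewrite mixdensE.
have mG k : measurable_fun A (fun z => (G k (z - x))%:E).
  apply/measurable_EFinP/measurable_funTS.
  by apply: (measurableT_comp (bG k).1); exact: measurable_funB.
rewrite integral_nneseries//.
- apply: eq_eseriesr => k _.
  under [RHS]eq_integral do rewrite EFinM.
  rewrite ge0_integralZl_EFin//; first by move=> z _; rewrite lee_fin.
  exact: mG.
- move=> k; under eq_fun do rewrite EFinM.
  by apply: measurable_funeM; exact: mG.
- by move=> k z _; rewrite lee_fin mulr_ge0.
Qed.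

(** Dominated convergence in the frequency variable: the partial sums are
    bounded by C M / rt w. *)
Lemma mixdens_freq (z M : R) (F : nat -> R -> R) (U : R -> R) :
  (forall k, measurable_fun setT (F k)) ->
  (forall k w, 0 < w < 1 -> `|F k w| <= M) ->
  (forall k, \int[mu]_w (freq_weight w * F k w) = pi / a * G k z) ->
  (forall w, 0 < w < 1 -> \sum_(k < n) p k * F k w @[n --> \oo] --> U w) ->
  improper_integral01 (fun w => U w / rt w) (pi / a * mixdens z).
Proof.
move=> mF FM FE cF.
pose f (n : nat) (w : R) := freq_weight w * \sum_(k < n) p k * F k w.
have mS n : measurable_fun setT (fun w => \sum_(k < n) p k * F k w).
  by apply: measurable_sum => k; exact: measurable_funM.
have mf n : measurable_fun setT (f n).
  by apply: measurable_funM => //; exact: measurable_freq_weight.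
have cf w : setT w -> f n w @[n --> \oo] --> freq_weight w * U w.
  move=> _; rewrite /f; have [w01|w01] := boolP (0 < w < 1).
    by apply: cvgMr; exact: cF.
  have -> : freq_weight w = 0 by rewrite /freq_weight patchE memNset//= in_itv/=; exact/negP.
  by rewrite mul0r; under eq_fun do rewrite mul0r; exact: cvg_cst.
have iD : mu.-integrable setT (EFin \o (fun w => C * M * freq_weight w)).
  exact: (@integrableZl _ _ _ mu setT measurableT (C * M) _ (@integrable_freq_weight R)).
have bf n w : setT w -> `|f n w| <= C * M * freq_weight w.
  move=> _; rewrite /f normrM (ger0_norm (freq_weight_ge0 w)) mulrC.
  have [w01|w01] := boolP (0 < w < 1); last first.
    have -> : freq_weight w = 0 by rewrite /freq_weight patchE memNset//= in_itv/=; exact/negP.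
    by rewrite !mulr0.
  apply: ler_wpM2r; first exact: freq_weight_ge0.
  apply: le_trans (ler_norm_sum _ _ _) _.
  have M0 : 0 <= M by apply: le_trans (FM 0%N w w01).
  apply: le_trans (ler_wpM2r M0 (p_le n)).
  rewrite mulr_suml; apply: ler_sum => k _.
  by rewrite normrM (ger0_norm (p_ge0 k)) ler_wpM2l// FM.
have [intU cvU] := @Rdominated_cvg _ _ _ mu setT f (fun w => freq_weight w * U w) _ measurableT mf cf iD bf.
have iF k : mu.-integrable setT (EFin \o (fun w => freq_weight w * F k w)) by exact: (integrable_freq_weightM (mF k) (FM k)).
have E n : \int[mu]_w f n w = pi / a * \sum_(k < n) p k * G k z.
  elim: n => [|n IH].
    rewrite big_ord0 mulr0 /f; under eq_Rintegral do rewrite big_ord0 mulr0.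
    by rewrite Rintegral_cst// mul0r.
  rewrite big_ord_recr/= mulrDr -IH mulrCA -FE -RintegralZl// -RintegralD//.
  - by apply: eq_Rintegral => w _; rewrite /f big_ord_recr/= mulrDr mulrCA.
  - exact: (@le_integrableR _ _ _ mu setT _ _ measurableT (mf n) (fun w h => bf n w h) iD).
  - exact: (@integrableZl _ _ _ mu setT measurableT (p n) _ (iF n)).
have -> : pi / a * mixdens z = \int[mu]_(w in `]0, 1[) (U w / rt w).
  rewrite -Rintegral_freq_weight.
  move: cvU; under eq_fun do rewrite E.
  move/cvg_lim => <- //; apply/esym/cvg_lim => //.
  by apply: cvgMr; exact: mixdens_cvg.
apply: improper_integral01_integrable.
have : mu.-integrable `]0, 1[ (EFin \o (fun w => freq_weight w * U w)).
  by apply: (@integrableS _ _ _ mu setT).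
apply: eq_integrable => // w; rewrite inE/= => w01.
by rewrite /freq_weight patchE mem_set// mulrC.
Qed.

End mixture.

Section mixture_densities.
Context (R : realType).
Local Notation mu := (@lebesgue_measure R).
Variables (a : R) (a0 : 0 < a).
Variables (p : nat -> R) (C : R).
Hypotheses (p_ge0 : forall k, 0 <= p k) (p_le : forall n, \sum_(k < n) p k <= C).
Variable S : R -> R.
Hypothesis pS : forall w, 0 < w < 1 -> \sum_(k < n) p k * (1 - w ^+ 2) ^+ k @[n --> \oo] --> S w.

Let mcosz (z : R) : measurable_fun setT (fun w : R => cos (z * (a * al w))).
Proof.
apply: (measurableT_comp (continuous_measurable_fun (@continuous_cos R))).
by apply: measurable_funM => //; apply: measurable_funM => //; exact: measurable_al.
Qed.

Let msinz (z : R) : measurable_fun setT (fun w : R => sin (z * (a * al w))).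
Proof.
apply: (measurableT_comp (continuous_measurable_fun (@continuous_sin R))).
by apply: measurable_funM => //; apply: measurable_funM => //; exact: measurable_al.
Qed.

Let msqr : measurable_fun setT (fun w : R => 1 - w ^+ 2).
Proof. by apply: measurable_funB => //; exact: measurable_funX. Qed.

Lemma walk_mixture_improper z :
  improper_integral01 (fun w => cos (z * (a * al w)) * S w / rt w)
    (pi / a * mixdens p (walk_dens a0) z).
Proof.
apply: (mixdens_freq a0 p_ge0 p_le (bmeas_walk_dens a0) (walk_dens_ge0 a0) (M := 1)
  (F := fun k w => cos (z * (a * al w)) * (1 - w ^+ 2) ^+ k)).
- by move=> k; apply: measurable_funM => //; exact: measurable_funX.
- move=> k w w01; have /andP[s0 s1] := sqr1_bound k w01.
  by rewrite normrM (ger0_norm s0) -[leRHS]mulr1 ler_pM ?normr_cos_le1.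
- by move=> k; rewrite walk_dens_freq.
- move=> w w01.
  rewrite (_ : (fun n => _) = (fun n => cos (z * (a * al w)) * \sum_(k < n) p k * (1 - w ^+ 2) ^+ k)).
    by apply: cvgMr; exact: pS.
  by apply/funext => n; rewrite mulr_sumr; apply: eq_bigr => k _; rewrite mulrCA.
Qed.

(** Only the term k = 0 is conditionally convergent, so it is split off and
    given by improper_first_dens0. In the others a factor 1 - w^2 is available, and
    their sum (S w - p 0) / (1 - w^2) is treated by dominated convergence. *)
Lemma first_mixture_improper s z : s ^+ 2 = 1 -> z != 0 ->
  improper_integral01 (fun w => (rt w * cos (z * (a * al w)) + s * (w * sin (z * (a * al w)))) / (1 - w ^+ 2) * S w)
    (pi / a * mixdens p (first_dens a0 s) z).
Proof.
move=> s1 z0.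
have ns1 := sqr1_norm s1.
pose q k := p k.+1.
have q0 k : 0 <= q k by exact: p_ge0.
have qC n : \sum_(k < n) q k <= C.
  by apply: le_trans (p_le n.+1); rewrite big_ord_recl/= lerDr.
pose H k := first_dens a0 s k.+1.
have bH k : bmeas a (H k) by exact: bmeas_first_dens.
have H0 k u : 0 <= H k u by exact: first_dens_ge0.
have mixE : mixdens p (first_dens a0 s) z = p 0%N * exponential_pdf a (s * z) + mixdens q H z.
  have h := mixdens_cvg a0 q0 qC bH H0 (z := z).
  apply/cvg_lim => //.
  rewrite -(cvg_shiftS (fun n => \sum_(k < n) p k * first_dens a0 s k z)).
  under eq_fun do rewrite big_ord_recl/=.
  by apply: cvgD => //; exact: cvg_cst.
have I1 : improper_integral01
    (fun w => ((cos (z * (a * al w)) * (1 - w ^+ 2) - (- s) * (w * rt w * sin (z * (a * al w)))) * ((S w - p 0%N) / (1 - w ^+ 2))) / rt w)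
    (pi / a * mixdens q H z).
  apply: (mixdens_freq a0 q0 qC bH H0 (M := 2)
    (F := fun k w => (cos (z * (a * al w)) * (1 - w ^+ 2) - (- s) * (w * rt w * sin (z * (a * al w)))) * (1 - w ^+ 2) ^+ k)).
  - move=> k; apply: measurable_funM; last exact: measurable_funX.
    apply: measurable_funB; apply: measurable_funM => //.
    by apply: measurable_funM => //; apply: measurable_funM => //; exact: measurable_rt.
  - move=> k w w01.
    have /andP[q0' q1] := sqr1_bound k w01.
    have := sqr1_bound 1 w01; rewrite expr1 => /andP[p0 p1].
    rewrite normrM (ger0_norm q0') -[leRHS]mulr1 ler_pM//.
    apply: le_trans (ler_normB _ _) _.
    rewrite (_ : 2 = 1 + 1)//; apply: lerD.
      by rewrite normrM (ger0_norm p0) -[leRHS]mulr1 ler_pM ?normr_cos_le1.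
    rewrite normrM normrN ns1 mul1r !normrM -[leRHS]mulr1 ler_pM ?mulr_ge0 ?normr_sin_le1//.
    case/andP: w01 => w0 w1; rewrite (ger0_norm (rt_ge0 _)) (gtr0_norm w0).
    by rewrite -[leRHS]mulr1 ler_pM ?rt_ge0 ?rt_le1// ltW.
  - move=> k; rewrite /H/= (shift_mean_freq a0 (s := - s) (k := k) _ (bmeas_walk_dens a0 k))//.
      by rewrite sqrrN.
    by move=> u; exact: walk_dens_freq.
  - move=> w w01; have w1 := itv01_itv11 w01; have f0 := rt_sub_gt0 w1.
    set X := (X in X * ((S w - p 0%N) / _)).
    rewrite (_ : (fun n => _) = (fun n => X * ((\sum_(k < n.+1) p k * (1 - w ^+ 2) ^+ k - p 0%N) / (1 - w ^+ 2)))).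
      apply: cvgMr; apply: cvgMl; apply: cvgB; last exact: cvg_cst.
      by rewrite (cvg_shiftS (fun n => \sum_(k < n) p k * (1 - w ^+ 2) ^+ k)); exact: pS.
    apply/funext => n; rewrite big_ord_recl/= expr0 mulr1 [p 0%N + _ - _]addrAC subrr add0r mulr_suml mulr_sumr.
    apply: eq_bigr => k _; rewrite /X /q /bump/= add1n (exprS (1 - w ^+ 2) k).
    have := gt_eqF f0; move: (1 - w ^+ 2) => f fN; move: (f ^+ k) => e.
    by field; rewrite fN.
have I0 := improper_integral01Z (p 0%N) (improper_first_dens0 a0 s1 z0).
rewrite mixE mulrDr [pi / a * (p 0%N * _)]mulrCA.
apply: improper_integral01_eq (improper_integral01D I0 I1) => w w01.
have w1 := itv01_itv11 w01; have r0 := rt_neq0 w1.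
by rewrite -(rt_sqr w1); field.
Qed.

End mixture_densities.

(** * Exit weights of the vertical coordinate *)

Section vertical.
Context (R : realType).
Local Notation mu := (@lebesgue_measure R).
Variables (a : R) (a0 : 0 < a) (L : R).

Definition killed (F : R -> R) (y : R) : R := if 0 <= y <= L then F y else 0.

Definition killed_step (F : R -> R) : R -> R := killed (laplace_mean a0 F).

(** Seen from height y at the start of a horizontal leg: the probability that
    k vertical legs of fair sign keep the particle in the strip and that a
    last vertical leg then leads down across height 0. Horizontal legs do not
    change the height, and the value is 0 outside the strip. *)
Definition exit_weight (k : nat) : R -> R :=
  iter k killed_step (killed (fun y => expR (- (a * y)) / 2)).

Lemma killedE (F : R -> R) y : killed F y = \1_(`[0, L]%classic) y * F y.
Proof.
rewrite /killed indicE; case: ifPn => yL; first by rewrite mem_set ?mul1r//= in_itv/=.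
by rewrite memNset ?mul0r//= in_itv/=; exact/negP.
Qed.

Lemma measurable_killed (F : R -> R) : measurable_fun setT F -> measurable_fun setT (killed F).
Proof.
move=> mF; rewrite (funext (killedE F)).
by apply: measurable_funM => //; exact: measurable_indic.
Qed.

Lemma bmeas_killed (M : R) (F : R -> R) : measurable_fun setT F -> 0 <= M ->
  (forall y, 0 <= y <= L -> `|F y| <= M) -> bmeas M (killed F).
Proof.
move=> mF M0 FM; split; first exact: measurable_killed.
by move=> y; rewrite /killed; case: ifPn => [/FM//|_]; rewrite normr0.
Qed.

Lemma bmeas_killed_step (M : R) (F : R -> R) : bmeas M F -> bmeas M (killed_step F).
Proof.
move=> bF; have [mF FM] := bmeas_laplace_mean a0 bF.
by apply: bmeas_killed => //; exact: le_trans (FM 0).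
Qed.

Lemma killed_ge0 (F : R -> R) : (forall y, 0 <= F y) -> forall y, 0 <= killed F y.
Proof. by move=> F0 y; rewrite /killed; case: ifP. Qed.

Lemma exit_weight_ge0 k y : 0 <= exit_weight k y.
Proof.
elim: k y => [|k IH] y /=.
  by apply: killed_ge0 => {}y; rewrite divr_ge0 ?expR_ge0.
by apply: killed_ge0 => {}y; exact: laplace_mean_ge0.
Qed.

Lemma bmeas_exit_weight k : bmeas 1 (exit_weight k).
Proof.
elim: k => [|k IH] /=; last exact: bmeas_killed_step.
apply: bmeas_killed => //.
  apply: measurable_funM => //; under eq_fun do rewrite -mulNr.
  exact: continuous_measurable_fun (@continuous_expRs R _).
move=> y /andP[y0 _]; rewrite ger0_norm ?divr_ge0 ?expR_ge0//.
rewrite ler_pdivrMr// mul1r; apply: (@le_trans _ _ 1); last by rewrite ler1n.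
by rewrite -[leRHS]expR0 ler_expR oppr_le0 mulr_ge0// ltW.
Qed.

Lemma bmeas_sum (M : R) (F : nat -> R -> R) n : (forall k, bmeas M (F k)) ->
  bmeas (n%:R * M) (fun y => \sum_(k < n) F k y).
Proof.
move=> bF; elim: n => [|n IH].
  rewrite mul0r; split; last by move=> y; rewrite big_ord0 normr0.
  by under eq_fun do rewrite big_ord0; exact: measurable_cst.
under eq_fun do rewrite big_ord_recr/=.
by rewrite -[n.+1%:R]natr1 mulrDl mul1r; exact: bmeasD.
Qed.

Lemma shift_mean_sum (s M : R) (F : nat -> R -> R) n y : (forall k, bmeas M (F k)) ->
  shift_mean a0 s (fun y => \sum_(k < n) F k y) y = \sum_(k < n) shift_mean a0 s (F k) y.
Proof.
move=> bF; elim: n => [|n IH].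
  by rewrite big_ord0 /shift_mean; under eq_Rintegral do rewrite big_ord0; exact: prob_cst.
rewrite big_ord_recr/= -IH /shift_mean.
under eq_Rintegral do rewrite big_ord_recr/=.
exact: (prob_D (expo a0) (bmeas_shift s y (bmeas_sum n bF)) (bmeas_shift s y (bF n))).
Qed.

Lemma shift_meanD (s M N : R) (F G : R -> R) y : bmeas M F -> bmeas N G ->
  shift_mean a0 s (fun y => F y + G y) y = shift_mean a0 s F y + shift_mean a0 s G y.
Proof. by move=> bF bG; exact: (prob_D (expo a0) (bmeas_shift s y bF) (bmeas_shift s y bG)). Qed.

Lemma shift_meanZ (s c M : R) (F : R -> R) y : bmeas M F ->
  shift_mean a0 s (fun y => c * F y) y = c * shift_mean a0 s F y.
Proof. by move=> bF; exact: (prob_Z (expo a0) c (bmeas_shift s y bF)). Qed.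

Lemma shift_mean_le (s M N : R) (F G : R -> R) y : bmeas M F -> bmeas N G ->
  (forall x, F x <= G x) -> shift_mean a0 s F y <= shift_mean a0 s G y.
Proof.
by move=> bF bG FG; apply: (prob_le (expo a0) (bmeas_shift s y bF) (bmeas_shift s y bG)).
Qed.

Lemma shift_mean_down y : 0 <= y ->
  shift_mean a0 (-1) (\1_(`[0, +oo[%classic : set R)) y = 1 - expR (- (a * y)).
Proof.
move=> y0.
transitivity (fine (expo a0 `]-oo, y]%classic)).
  rewrite /shift_mean /Rintegral; congr fine.
  transitivity (\int[expo a0]_r (\1_(`]-oo, y]%classic : set R) r)%:E)%E.
    apply: eq_integral => r _; congr EFin; rewrite !indicE; congr (_ %:R); congr nat_of_bool.
    by apply/idP/idP; rewrite !inE/= !in_itv/= andbT mulN1r subr_ge0.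
  by rewrite integral_indic//= setIT.
have := @probability_setC _ _ _ (expo a0) `]y, +oo[%classic (measurable_itv _).
by rewrite setCitvr => ->; rewrite expo_tail// mulNr.
Qed.

(** The indicator of the strip is a supersolution: it is at most the indicator
    of [0, +oo[, whose mean over a downward leg from y is 1 - exp (- a y), and
    this leaves room for the term k = 0. *)
Lemma exit_weight_sum_le n y : \sum_(k < n) exit_weight k y <= 1.
Proof.
suff : forall y, \sum_(k < n) exit_weight k y <= killed (cst 1) y.
  by move=> /(_ y) h; apply: le_trans h _; rewrite /killed; case: ifP.
elim: n => [|n IH] {}y.
  by rewrite big_ord0 /killed; case: ifP.
rewrite big_ord_recl /=.
rewrite {2}/killed; case: ifPn => yL; last first.
  rewrite /killed (negbTE yL) add0r big1// => k _.
  by rewrite /killed_step /killed (negbTE yL).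
rewrite {1}/killed yL.
under eq_bigr do rewrite /killed_step/killed yL.
rewrite -mulr_sumr big_split/= -!(shift_mean_sum _ _ _ bmeas_exit_weight).
have bS := bmeas_sum n bmeas_exit_weight.
have /andP[y0 _] := yL.
have b1 := bmeas_indic R (measurable_itv `[0%R, +oo[ : measurable (`[0, +oo[%classic : set (measurableTypeR R))).
have S1 x : \sum_(k < n) exit_weight k x <= \1_(`[0, +oo[%classic) x.
  apply: le_trans (IH x) _; rewrite /killed indicE.
  by case: ifPn => [/andP[x0 _]|_//]; rewrite mem_set//= in_itv/= x0.
have h1 := shift_mean_le (-1) y bS b1 S1.
rewrite shift_mean_down// in h1.
have h2 : shift_mean a0 1 (fun x => \sum_(k < n) exit_weight k x) y <= 1.
  apply: le_trans (shift_mean_le 1 y bS b1 S1) _.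
  by apply: le_trans (ler_norm _) _; have [_ ->] := bmeas_shift_mean a0 1 b1.
move: h1 h2; set A := shift_mean _ _ _ _; set B := shift_mean _ _ _ _ => h1 h2.
by lra.
Qed.

End vertical.

(** * The generating function of the exit weights *)

Section generating_function.
Context (R : realType).
Local Notation mu := (@lebesgue_measure R).
Variables (a : R) (a0 : 0 < a) (L : R) (L0 : 0 < L).

(** A leg that starts at y stays in the strip for lengths up to y or L - y,
    and the generating function is a combination of two exponentials; this is
    the corresponding truncated mean. *)
Lemma Rintegral_exp_trunc (m l A B : R) : m != 1 -> m != -1 -> 0 <= l ->
  \int[mu]_(r in `[0, l]) (a * expR (- a * r) * (A * expR (a * m * r) + B * expR (- (a * m) * r))) =
  A * (1 - expR (- (a * (1 - m)) * l)) / (1 - m) + B * (1 - expR (- (a * (1 + m)) * l)) / (1 + m).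
Proof.
move=> m1 m2; have n1 : 1 - m != 0 by rewrite subr_eq0 eq_sym.
have n2 : 1 + m != 0 by rewrite addrC addr_eq0.
rewrite le_eqVlt => /predU1P[<-|l0].
  by rewrite set_itv1 Rintegral_set1 !mulr0 expR0 subrr !mulr0 !mul0r addr0.
pose F r := - A / (1 - m) * expR (- (a * (1 - m)) * r) + - B / (1 + m) * expR (- (a * (1 + m)) * r).
have dF (x : R) : is_derive x 1 F (a * expR (- a * x) * (A * expR (a * m * x) + B * expR (- (a * m) * x))).
  apply: (is_derive_eq (is_deriveDR (is_derive_mulcR (- A / (1 - m)) (is_derive_expRs (- (a * (1 - m))) x))
     (is_derive_mulcR (- B / (1 + m)) (is_derive_expRs (- (a * (1 + m))) x)))).
  have -> : expR (- (a * (1 - m)) * x) = expR (- a * x) * expR (a * m * x).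
    by rewrite -expRD; congr expR; ring.
  have -> : expR (- (a * (1 + m)) * x) = expR (- a * x) * expR (- (a * m) * x).
    by rewrite -expRD; congr expR; ring.
  move: (expR _) (expR _) (expR _) => e1 e2 e3; by field; rewrite n1 n2.
have cF (x : R) := is_derive_continuous (dF x).
rewrite /Rintegral (@continuous_FTC2 _ _ F)//=.
- by rewrite /F !mulr0 expR0; field; rewrite n1 n2.
- apply: continuous_subspaceT => x.
  apply: cvgM; first by apply: cvgMr; exact: continuous_expRs.
  by apply: cvgD; apply: cvgMr; exact: continuous_expRs.
- split; [by move=> x _; have [] := dF x| |].
    by apply: cvg_at_right_filter; exact: cF.
  by apply: cvg_at_left_filter; exact: cF.
- by move=> x _; rewrite derive1E; have h := dF x; exact: derive_val.
Qed.

Variables (w : R) (w01 : 0 < w < 1).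

Let w0 : 0 < w. Proof. by case/andP: w01. Qed.
Let w1 : w < 1. Proof. by case/andP: w01. Qed.

Definition exit_den : R := (1 + w) ^+ 2 * expR (a * L * w) - (1 - w) ^+ 2 * expR (- (a * L * w)).

Definition exit_num (y : R) : R :=
  (1 + w) * expR (a * (L - y) * w) - (1 - w) * expR (- (a * (L - y) * w)).

(** Closed form of the generating function of the exit weights at 1 - w^2.
    Exponentials with rate a w are eigenfunctions of the free leg operator for
    the eigenvalue 1 / (1 - w^2), and the two coefficients are fixed by the
    boundary terms at 0 and at L. *)
Definition exit_gf : R -> R := killed L (fun y => exit_num y / exit_den).

Lemma exit_den_gt0 : 0 < exit_den.
Proof.
rewrite subr_gt0; have := w0; have := w1 => w1' w0'; apply: ltr_pM.
- exact: sqr_ge0.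
- exact: expR_ge0.
- nra.
by rewrite ltr_expR gtrN// mulr_gt0// mulr_gt0.
Qed.

Let dN : exit_den != 0. Proof. by rewrite gt_eqF// exit_den_gt0. Qed.

Let E := expR (a * L * w).
Let E' := expR (- (a * L * w)).
Let EE : E * E' = 1. Proof. by rewrite /E /E' -expRD subrr expR0. Qed.

Let numE (s y r : R) : exit_num (y + s * r) =
  (1 + w) * E * expR (- (a * w) * y) * expR (- (a * w) * (s * r)) -
  (1 - w) * E' * expR (a * w * y) * expR (a * w * (s * r)).
Proof.
rewrite /exit_num /E /E' -!mulrA -!expRD; congr (_ * expR _ - _ * expR _); ring.
Qed.

Lemma measurable_exit_num : measurable_fun setT exit_num.
Proof.
rewrite (_ : exit_num = fun y => (1 + w) * E * expR (- (a * w) * y) + (- ((1 - w) * E')) * expR (a * w * y)).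
  by apply: measurable_funD; apply: measurable_funM => //; exact: continuous_measurable_fun (@continuous_expRs R _).
by apply/funext => y; have := numE 0 y 0; rewrite mulr0 addr0 !mulr0 expR0 !mulr1 mulNr.
Qed.

Lemma bmeas_exit_gf : exists M, bmeas M exit_gf.
Proof.
exists (((1 + w) * E + (1 - w)) / exit_den).
apply: bmeas_killed.
- by apply: measurable_funM => //; exact: measurable_exit_num.
- apply: divr_ge0; last exact/ltW/exit_den_gt0.
  apply: addr_ge0; last by have := w1; lra.
  by apply: mulr_ge0; [have := w0; lra|exact: expR_ge0].
move=> y /andP[y0 yL]; rewrite normrM normfV (gtr0_norm exit_den_gt0).
have w0' := w0; have w1' := w1.
apply: ler_wpM2r; first by rewrite invr_ge0 (ltW exit_den_gt0).
apply: le_trans (ler_normB _ _) _; rewrite !normrM !(ger0_norm (expR_ge0 _)).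
have -> : `|1 + w| = 1 + w by rewrite ger0_norm//; lra.
have -> : `|1 - w| = 1 - w by rewrite ger0_norm//; lra.
apply: lerD.
  apply: ler_wpM2l; first by lra.
  rewrite ler_expR; apply: ler_wpM2r; first exact: ltW.
  by apply: ler_wpM2l; [exact: ltW|rewrite gerBl].
rewrite ler_piMr; [by []|by lra|].
rewrite -[leRHS]expR0 ler_expR oppr_le0; apply: mulr_ge0; last exact: ltW.
by apply: mulr_ge0; [exact: ltW|rewrite subr_ge0].
Qed.

(** The boundary terms of the two truncated means combine into exit_den, which
    leaves exp (- a y). *)
Lemma shift_exit_gf_down y : 0 <= y <= L ->
  (1 - w ^+ 2) * shift_mean a0 (-1) exit_gf y =
  ((1 + w) ^+ 2 * expR (a * (L - y) * w) - (1 - w) ^+ 2 * expR (- (a * (L - y) * w))) / exit_den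
    - expR (- (a * y)).
Proof.
move=> /andP[y0 yL].
have [M bM] := bmeas_exit_gf; have [mF FM] := bmeas_shift (-1) y bM.
rewrite /shift_mean (Rintegral_expo a0 mF FM).
have -> : \int[mu]_(r in `[0, +oo[) (a * expR (- a * r) * exit_gf (y + -1 * r)) =
  \int[mu]_(r in `[0, y]) (a * expR (- a * r) *
     (((1 + w) * E * expR (- (a * w) * y) / exit_den) * expR (a * w * r) +
      (- ((1 - w) * E' * expR (a * w * y)) / exit_den) * expR (- (a * w) * r))).
  rewrite [LHS]Rintegral_mkcond [RHS]Rintegral_mkcond; apply: eq_Rintegral => r _.
  rewrite !patchE; case: ifPn => [|r0]; last first.
    rewrite ifF//; apply/negbTE; apply: contra r0.
    by rewrite !inE/= !in_itv/= andbT => /andP[].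
  rewrite inE/= in_itv/= andbT => r0.
  case: ifPn => [|ry].
    rewrite inE/= in_itv/= => /andP[_ ry].
    rewrite /exit_gf /killed ifT; last by apply/andP; lra.
    rewrite numE !mulN1r !mulNr !mulrN opprK; congr (_ * _); by field.
  rewrite /exit_gf /killed ifF ?mulr0//; apply/negbTE; apply: contra ry.
  by move=> /andP[h _]; rewrite inE/= in_itv/= r0/=; lra.
have N1 : 1 - w != 0 by rewrite gt_eqF// subr_gt0.
have N2 : 1 + w != 0 by rewrite gt_eqF// ltr_pwDl// ltW.
rewrite Rintegral_exp_trunc//; last 2 first.
- by rewrite lt_eqF.
- by rewrite gt_eqF//; have := w0; lra.
have -> : expR (- (a * (1 - w)) * y) = expR (- (a * y)) * expR (a * w * y) by rewrite -expRD; congr expR; ring.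
have -> : expR (- (a * (1 + w)) * y) = expR (- (a * y)) * expR (- (a * w) * y) by rewrite -expRD; congr expR; ring.
have -> : expR (a * (L - y) * w) = E * expR (- (a * w) * y) by rewrite -expRD; congr expR; ring.
have -> : expR (- (a * (L - y) * w)) = E' * expR (a * w * y) by rewrite -expRD; congr expR; ring.
have YY : expR (a * w * y) * expR (- (a * w) * y) = 1 by rewrite -expRD mulNr subrr expR0.
have dE : exit_den = (1 + w) ^+ 2 * E - (1 - w) ^+ 2 * E' by [].
move: YY dE dN; move: (expR (a * w * y)) (expR (- (a * w) * y)) (expR (- (a * y))) exit_den E E' => e1 e2 e3 D F F' YY dE DN.
transitivity (((1 + w) ^+ 2 * F * (e2 - e3 * (e1 * e2)) - (1 - w) ^+ 2 * F' * (e1 - e3 * (e1 * e2))) / D).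
  by field; rewrite DN N1 N2.
rewrite YY mulr1.
have -> : (1 + w) ^+ 2 * F * (e2 - e3) - (1 - w) ^+ 2 * F' * (e1 - e3) =
  (1 + w) ^+ 2 * (F * e2) - (1 - w) ^+ 2 * (F' * e1) - e3 * ((1 + w) ^+ 2 * F - (1 - w) ^+ 2 * F') by ring.
by rewrite -dE; field.
Qed.

(** The boundary terms of the two truncated means at height L cancel. *)
Lemma shift_exit_gf_up y : 0 <= y <= L ->
  shift_mean a0 1 exit_gf y = 2 * sinh (a * (L - y) * w) / exit_den.
Proof.
move=> /andP[y0 yL].
have [M bM] := bmeas_exit_gf; have [mF FM] := bmeas_shift 1 y bM.
rewrite /shift_mean (Rintegral_expo a0 mF FM).
have -> : \int[mu]_(r in `[0, +oo[) (a * expR (- a * r) * exit_gf (y + 1 * r)) =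
  \int[mu]_(r in `[0, L - y]) (a * expR (- a * r) *
     ((- ((1 - w) * E' * expR (a * w * y)) / exit_den) * expR (a * w * r) +
      ((1 + w) * E * expR (- (a * w) * y) / exit_den) * expR (- (a * w) * r))).
  rewrite [LHS]Rintegral_mkcond [RHS]Rintegral_mkcond; apply: eq_Rintegral => r _.
  rewrite !patchE; case: ifPn => [|r0]; last first.
    rewrite ifF//; apply/negbTE; apply: contra r0.
    by rewrite !inE/= !in_itv/= andbT => /andP[].
  rewrite inE/= in_itv/= andbT => r0.
  case: ifPn => [|ry].
    rewrite inE/= in_itv/= => /andP[_ ry].
    rewrite /exit_gf /killed ifT; last by apply/andP; lra.
    rewrite numE !mul1r; congr (_ * _); by field.
  rewrite /exit_gf /killed ifF ?mulr0//; apply/negbTE; apply: contra ry.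
  by move=> /andP[_ h]; rewrite inE/= in_itv/= r0/=; lra.
have N1 : 1 - w != 0 by rewrite gt_eqF// subr_gt0.
have N2 : 1 + w != 0 by rewrite gt_eqF// ltr_pwDl// ltW.
rewrite Rintegral_exp_trunc ?subr_ge0//; last 2 first.
- by rewrite lt_eqF.
- by rewrite gt_eqF//; have := w0; lra.
have -> : expR (- (a * (1 - w)) * (L - y)) = expR (- (a * (L - y))) * (E * expR (- (a * w) * y)) by rewrite -!expRD; congr expR; ring.
have -> : expR (- (a * (1 + w)) * (L - y)) = expR (- (a * (L - y))) * (E' * expR (a * w * y)) by rewrite -!expRD; congr expR; ring.
rewrite /sinh.
have -> : expR (a * (L - y) * w) = E * expR (- (a * w) * y) by rewrite -expRD; congr expR; ring.
have -> : expR (- (a * (L - y) * w)) = E' * expR (a * w * y) by rewrite -expRD; congr expR; ring.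
move: dN EE; move: (expR (a * w * y)) (expR (- (a * w) * y)) (expR (- (a * (L - y)))) exit_den E E' => e1 e2 e3 D F F' DN FF.
by field; rewrite DN N1 N2.
Qed.

(** The recursion of the generating function, obtained by adding the upward
    and the downward mean. *)
Lemma exit_gf_step y : exit_gf y = exit_weight a0 L 0 y + (1 - w ^+ 2) * killed_step a0 L exit_gf y.
Proof.
rewrite /exit_weight /= /killed_step {1}/exit_gf /killed; case: ifPn => [yL|_]; last by rewrite mulr0 addr0.
rewrite /laplace_mean (shift_exit_gf_up yL).
have -> : (1 - w ^+ 2) * (2^-1 * (2 * sinh (a * (L - y) * w) / exit_den + shift_mean a0 (-1) exit_gf y)) =
  2^-1 * ((1 - w ^+ 2) * (2 * sinh (a * (L - y) * w) / exit_den) + (1 - w ^+ 2) * shift_mean a0 (-1) exit_gf y) by ring.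
rewrite (shift_exit_gf_down yL) /exit_num /sinh.
move: dN; move: exit_den (expR _) (expR _) (expR _) => D e1 e2 e3 DN.
by field.
Qed.

End generating_function.

(** * Convergence of the generating series *)

Section exit_series.
Context (R : realType).
Local Notation mu := (@lebesgue_measure R).
Variables (a : R) (a0 : 0 < a) (L : R) (L0 : 0 < L).

Lemma laplace_meanDZ (c M N : R) (F G : R -> R) y : bmeas M F -> bmeas N G ->
  laplace_mean a0 (fun y => F y + c * G y) y = laplace_mean a0 F y + c * laplace_mean a0 G y.
Proof.
move=> bF bG; rewrite /laplace_mean.
rewrite !(shift_meanD a0 _ y bF (bmeasZ c bG)) !(shift_meanZ a0 _ c y bG); ring.
Qed.

Lemma killed_stepDZ (c M N : R) (F G : R -> R) y : bmeas M F -> bmeas N G ->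
  killed_step a0 L (fun y => F y + c * G y) y = killed_step a0 L F y + c * killed_step a0 L G y.
Proof.
move=> bF bG; rewrite /killed_step /killed; case: ifPn => _; last by rewrite mulr0 addr0.
exact: laplace_meanDZ bF bG.
Qed.

Variables (w : R) (w01 : 0 < w < 1).

Let q := exit_weight a0 L.
Let H := exit_gf a L w.
(** The remainder after n terms is the n-th iterate of the closed form; it
    stays bounded while its factor is geometric, so the closed form is the sum
    of the series. *)
Let rem n := iter n (killed_step a0 L) H.
Let M := xget 0 [set M | bmeas M H].

Let bH : bmeas M H.
Proof.
have [M' bM'] := bmeas_exit_gf a0 L0 w01.
exact: (@xgetPex _ 0 [set M | bmeas M H] (ex_intro _ M' bM')).
Qed.

Let b_rem n : bmeas M (rem n).
Proof. by elim: n => [|n IH] //=; exact: bmeas_killed_step. Qed.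

Let remE n y : rem n y = q n y + (1 - w ^+ 2) * rem n.+1 y.
Proof.
elim: n y => [|n IH] y; first exact: exit_gf_step.
rewrite [LHS]/= (funext IH) (killed_stepDZ _ y (bmeas_exit_weight a0 L n) (b_rem n.+1)).
by [].
Qed.

Let exitE n y : H y = \sum_(k < n) q k y * (1 - w ^+ 2) ^+ k + (1 - w ^+ 2) ^+ n * rem n y.
Proof.
elim: n => [|n IH]; first by rewrite big_ord0 add0r expr0 mul1r.
rewrite IH remE big_ord_recr/=.
rewrite [(1 - w ^+ 2) ^+ n.+1]exprS.
move: (1 - w ^+ 2) => f; move: (f ^+ n) (\sum_(i < n) _) (killed_step _ _ _ _) => *; ring.
Qed.

Let phi_cvg (K : R) (u : nat -> R) : (forall n, `|u n| <= K) -> (1 - w ^+ 2) ^+ n * u n @[n --> \oo] --> (0 : R).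
Proof.
move=> uK.
have w1 := itv01_itv11 w01.
have f0 := rt_sub_gt0 w1.
have g : (1 - w ^+ 2) ^+ n @[n --> \oo] --> (0 : R).
  apply: cvg_expr; rewrite gtr0_norm// ltrBlDr ltrDl exprn_gt0//; by case/andP: w01.
apply/norm_cvg0P.
have h : \forall n \near \oo, cst 0 n <= `|(1 - w ^+ 2) ^+ n * u n| <= K * (1 - w ^+ 2) ^+ n.
  apply: nearW => n; rewrite normr_ge0/= normrM mulrC.
  by rewrite (ger0_norm (exprn_ge0 n (ltW f0))) ler_wpM2r// exprn_ge0// (ltW f0).
apply: (squeeze_cvgr h (cvg_cst _)).
by rewrite -[X in _ --> X](mulr0 K); apply: cvgMr.
Qed.

Lemma exit_series_cvg y : \sum_(k < n) exit_weight a0 L k y * (1 - w ^+ 2) ^+ k @[n --> \oo] --> exit_gf a L w y.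
Proof.
rewrite (_ : (fun n => _) = (fun n => H y - (1 - w ^+ 2) ^+ n * rem n y)).
  rewrite -[X in _ --> X]subr0; apply: cvgB; first exact: cvg_cst.
  by apply: (@phi_cvg M) => n; have [_ ->] := b_rem n.
by apply/funext => n; rewrite [in RHS](exitE n) addrK.
Qed.

Lemma exit_shift_series_cvg s y :
  \sum_(k < n) shift_mean a0 s (exit_weight a0 L k) y * (1 - w ^+ 2) ^+ k @[n --> \oo] -->
  shift_mean a0 s (exit_gf a L w) y.
Proof.
rewrite (_ : (fun n => _) = (fun n => shift_mean a0 s H y - (1 - w ^+ 2) ^+ n * shift_mean a0 s (rem n) y)).
  rewrite -[X in _ --> X]subr0; apply: cvgB; first exact: cvg_cst.
  by apply: (@phi_cvg M) => n; have [_ ->] := bmeas_shift_mean a0 s (b_rem n).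
apply/funext => n.
elim: n => [|n IH]; first by rewrite big_ord0 expr0 mul1r subrr.
rewrite big_ord_recr/= IH.
have -> : shift_mean a0 s (rem n) y = shift_mean a0 s (q n) y + (1 - w ^+ 2) * shift_mean a0 s (rem n.+1) y.
  rewrite -(shift_meanZ a0 s _ y (b_rem n.+1)) -(shift_meanD a0 s y (bmeas_exit_weight a0 L n) (bmeasZ _ (b_rem n.+1))).
  by congr (shift_mean _ _ _ _); apply/funext => u; exact: remE.
rewrite [(1 - w ^+ 2) ^+ n.+1]exprS -/(rem n.+1).
move: (1 - w ^+ 2) => f; move: (f ^+ n) (shift_mean _ _ _ _) (shift_mean _ _ _ _) (shift_mean _ _ _ _) => *; ring.
Qed.

End exit_series.

(** * Joint measurability of the direction *)

Section counting.
Context (R : realType).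

(** When all counted indices are below p the number of events is a finite sum
    of indicators, which is measurable and computable on a leg. *)
Lemma card_fset_set_bounded (A : nat -> bool) (p : nat) :
  (forall n, (p <= n)%N -> ~~ A n) ->
  #|` fset_set [set n | A n] | = (\sum_(n < p) A n)%N.
Proof.
move=> Ap.
have -> : [set n | A n] = [set` [fset n in [seq n <- iota 0 p | A n]]%fset].
  apply/seteqP; split => n /=; rewrite !inE/= mem_filter mem_iota add0n leq0n/=.
    move=> An; rewrite An/= ltnNge; apply/negP => pn.
    by have := Ap n pn; rewrite An.
  by move=> /andP[].
rewrite set_fsetK card_fseq undup_id ?filter_uniq ?iota_uniq//.
rewrite size_filter -sum1_count big_mkcond/= -{1}[p]subn0 -/(index_iota 0 p) big_mkord.
by apply: eq_bigr => i _; case: (A i).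
Qed.

End counting.

Definition leg_dir (Omega : Type) (J0 : Omega -> 'Z_4) (turn : nat -> Omega -> bool)
    (n : nat) (w : Omega) : 'Z_4 :=
  J0 w + \sum_(k < n) (if turn k w then 1 else -1).

Section leg_directions.
Context d (Omega : measurableType d).
Variables (J0 : Omega -> 'Z_4) (turn : nat -> Omega -> bool).
Hypothesis mJ0 : forall j, measurable (J0 @^-1` [set j]).

Local Notation leg_dir := (leg_dir J0 turn).

Lemma leg_dirS n w : leg_dir n.+1 w = leg_dir n w + (if turn n w then 1 else -1).
Proof. by rewrite /leg_dir big_ord_recr/= addrA. Qed.

Lemma measurable_leg_dir n j : (forall k b, (k < n)%N -> measurable (turn k @^-1` [set b])) ->
  measurable (leg_dir n @^-1` [set j]).
Proof.
elim: n j => [|n IH] j mturn.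
  rewrite (_ : _ @^-1` _ = J0 @^-1` [set j])//.
  by apply/seteqP; split => w /=; rewrite /leg_dir big_ord0 addr0.
rewrite (_ : _ @^-1` _ = ((leg_dir n @^-1` [set j - 1]) `&` (turn n @^-1` [set true])) `|`
   ((leg_dir n @^-1` [set j + 1]) `&` (turn n @^-1` [set false]))).
  have IH' i : measurable (leg_dir n @^-1` [set i]) by apply: IH => k b kn; exact/mturn/ltnW.
  have mb b := mturn n b (ltnSn n).
  by apply: measurableU; apply: measurableI.
apply/seteqP; split => w /=; rewrite leg_dirS.
  by case: (turn n w) => <-; [left|right]; rewrite ?addrK ?subrK.
by move=> [[-> ->]|[-> ->]]; rewrite ?addrK ?subrK.
Qed.

End leg_directions.

Section joint_measurability.
Context d (Omega : measurableType d) (R : realType).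
Variables (J0 : Omega -> 'Z_4) (T : nat -> Omega -> R) (turn : nat -> Omega -> bool).
Hypotheses (mJ0 : forall j, measurable (J0 @^-1` [set j]))
  (mT : forall n, measurable_fun setT (T n))
  (mturn : forall n b, measurable (turn n @^-1` [set b])).

Let A (n : nat) : set (R * Omega) := [set u | event_time T n u.2 <= u.1].

Let mA n : measurable (A n).
Proof.
have me : measurable_fun setT (fun u : R * Omega => event_time T n u.2).
  apply: (measurableT_comp (f := event_time T n)) => //.
  by apply: measurable_sum.
have m1 : measurable_fun setT (fun u : R * Omega => u.1) by exact: measurable_fst.
have := measurable_fun_ler me m1.
move=> /(_ measurableT [set true] I); rewrite setTI.
by congr (measurable _); apply/seteqP.
Qed.

Let cnt (p : nat) (u : R * Omega) : nat := (\sum_(n < p) (event_time T n u.2 <= u.1)%R)%N.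

Let mcnt p m : measurable (cnt p @^-1` [set m]).
Proof.
elim: p m => [|p IH] m.
  have [->|m0] := eqVneq m 0%N.
    by rewrite (_ : _ @^-1` _ = setT)//; apply/seteqP; split => // u _ /=; rewrite /cnt big_ord0.
  rewrite (_ : _ @^-1` _ = set0)//; apply/seteqP; split => // u /=; rewrite /cnt big_ord0 => /esym/eqP.
  by rewrite (negbTE m0).
have cS u : cnt p.+1 u = (cnt p u + (event_time T p u.2 <= u.1)%R)%N by rewrite /cnt big_ord_recr.
rewrite (_ : _ @^-1` _ = ((cnt p @^-1` [set m]) `&` ~` A p) `|`
   (if m is m'.+1 then (cnt p @^-1` [set m']) `&` A p else set0)).
  apply: measurableU; first by apply: measurableI => //; exact: measurableC.
  by case: m => [|m] //; exact: measurableI.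
apply/seteqP; split => u /=; rewrite cS.
  move=> <-; have [hA|hA] := boolP (event_time T p u.2 <= u.1); last first.
    by left; rewrite addn0; split => //; exact/negP.
  by right; rewrite addn1.
move=> [[<- /negP]|].
  by rewrite /A/= => /negbTE ->; rewrite addn0.
by case: m => [//|m] [/= <-]; rewrite /A/= => ->; rewrite addn1.
Qed.

(** Some p bounds all the events up to time t, or there are infinitely many
    and the count has its default value 0; both alternatives are countable
    combinations of the events. *)
Lemma measurable_poisson_count m :
  measurable [set u : R * Omega | poisson_count T u.1 u.2 = m].
Proof.
pose B p : set (R * Omega) := \bigcap_(n in [set n | (p <= n)%N]) ~` A n.
have mB p : measurable (B p).
  by apply: bigcap_measurable; [exists p => /=|move=> n _; exact: measurableC].
rewrite (_ : [set u | _] = (\bigcup_p (B p `&` (cnt p @^-1` [set m]))) `|`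
   ((~` \bigcup_p B p) `&` (if m == 0%N then setT else set0))).
  apply: measurableU.
    by apply: bigcupT_measurable => p; exact: measurableI.
  apply: measurableI; last by case: ifP.
  by apply: measurableC; exact: bigcupT_measurable.
have cB p u : B p u -> poisson_count T u.1 u.2 = cnt p u.
  by move=> Bu; apply: card_fset_set_bounded => n /Bu/negP.
apply/seteqP; split => u /=.
  move=> um; have [[p _ Bp]|nB] := pselect ((\bigcup_p B p) u).
    by left; exists p => //; split => //=; rewrite -um (cB p).
  right; split => //.
  rewrite -um /poisson_count /fset_set; case: pselect => [fin|_]; last by rewrite cardfs0.
  exfalso; apply: nB.
  exists (\max_(n <- fset_set [set n | event_time T n u.2 <= u.1]) n).+1 => // n /= pn An.
  move: pn; rewrite ltnNge => /negP; apply.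
  by apply: leq_bigmax_seq => //; rewrite in_fset_set// inE.
move=> [[p _ [Bp]] um|[nB]]; first by rewrite (cB p).
case: eqVneq => // -> _.
rewrite /poisson_count /fset_set; case: pselect => [fin|_]; last by rewrite cardfs0.
exfalso; apply: nB.
exists (\max_(n <- fset_set [set n | event_time T n u.2 <= u.1]) n).+1 => // n /= pn An.
move: pn; rewrite ltnNge => /negP; apply.
by apply: leq_bigmax_seq => //; rewrite in_fset_set// inE.
Qed.

Lemma directionE s w : direction J0 T turn s w = leg_dir J0 turn (poisson_count T s w) w.
Proof. by []. Qed.

Lemma measurable_direction j :
  measurable [set u : R * Omega | direction J0 T turn u.1 u.2 = j].
Proof.
rewrite (_ : [set u | _] = \bigcup_m ([set u : R * Omega | poisson_count T u.1 u.2 = m] `&`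
  (snd @^-1` (leg_dir J0 turn m @^-1` [set j])))).
  apply: bigcupT_measurable => m; apply: measurableI; first exact: measurable_poisson_count.
  rewrite -[X in measurable X]setTI; apply: measurable_snd => //; exact: measurable_leg_dir.
apply/seteqP; split => u /=.
  by rewrite directionE => h; exists (poisson_count T u.1 u.2).
by move=> [m _ [<-]].
Qed.

Lemma measurable_fun_direction (f : 'Z_4 -> R) :
  measurable_fun setT (fun u : R * Omega => f (direction J0 T turn u.1 u.2)).
Proof.
rewrite (_ : (fun u => _) = (fun u : R * Omega => \sum_(j : 'Z_4) f j *
    \1_([set u : R * Omega | direction J0 T turn u.1 u.2 = j]) u)).
  apply: measurable_sum => j; apply: measurable_funM => //.
  by apply: measurable_indic; exact: measurable_direction.
apply/funext => u; rewrite (bigD1 (direction J0 T turn u.1 u.2))//= indicE mem_set// mulr1.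
rewrite big1 ?addr0// => j jN; rewrite indicE memNset ?mulr0//=.
by move=> e; rewrite e eqxx in jN.
Qed.

End joint_measurability.

(** * Joint measurability of the position *)

Section position_measurability.
Context d (Omega : measurableType d) (R : realType).
Local Notation mu := (@lebesgue_measure R).
Variables (g : R * Omega -> R).
Hypotheses (mg : measurable_fun setT g) (g1 : forall u, `|g u| <= 1).

Let pos (t : R) (w : Omega) : R := \int[mu]_(s in `[0, t]) g (s, w).

Lemma integrable_path (w : Omega) (A : set R) : measurable A -> (mu A < +oo)%E ->
  mu.-integrable A (EFin \o (fun s => g (s, w))).
Proof.
move=> mA fA; apply: measurable_bounded_integrable => //.
  by apply: measurable_funTS; exact: (measurableT_comp mg (pair2_measurable _)).
exists 1; split => // M M1 s _ /=; exact: le_trans (g1 _) (ltW M1).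
Qed.

Let integrable_cst1 (A : set R) : measurable A -> (mu A < +oo)%E ->
  mu.-integrable A (EFin \o (fun=> 1 : R)).
Proof.
move=> mA fA; apply: measurable_bounded_integrable => //.
by exists 1; split => // M M1 s _ /=; rewrite normr1 ltW.
Qed.

Let finite_seg (t : R) : (mu `[0%R, t]%classic < +oo)%E.
Proof. by rewrite lebesgue_measure_itv/=; case: ifP => _; rewrite ltry. Qed.

(** Adding 1 makes the integrand nonnegative, so that Tonelli gives joint
    measurability for signed g. *)
Let shifted (u : R * Omega) : R := fine (\int[mu]_s (\1_(`[0, u.1]%classic) s * (g (s, u.2) + 1))%:E)%E.

Let shiftedE t w : shifted (t, w) = pos t w + Num.max 0 t.
Proof.
rewrite /shifted /pos /=.
have -> : (\int[mu]_s (\1_(`[0%R, t]%classic) s * (g (s, w) + 1))%:E)%E =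
    (\int[mu]_(s in `[0%R, t]) (g (s, w) + 1)%:E)%E.
  rewrite [RHS]integral_mkcond; apply: eq_integral => s _; rewrite patchE indicE.
  by case: (_ \in _); rewrite ?mul1r ?mul0r.
rewrite -/(Rintegral mu `[0, t] (fun s => g (s, w) + 1)) RintegralD//; last 2 first.
- exact: integrable_path.
- exact: integrable_cst1.
congr (_ + _); rewrite Rintegral_cst//= mul1r lebesgue_measure_itv/= lte_fin.
by case: ltP => t0 /=; rewrite ?subr0.
Qed.

Let measurable_shifted : measurable_fun setT shifted.
Proof.
apply: (measurableT_comp (f := fine)); first exact: fine_measurable.
pose h (z : (R * Omega) * R) : \bar R := (\1_([set z : (R * Omega) * R | (0 <= z.2) && (z.2 <= z.1.1)]) z * (g (z.2, z.1.2) + 1))%:E.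
have mh : measurable_fun setT h.
  apply/measurable_EFinP; apply: measurable_funM.
    apply: measurable_indic.
    have m1 : measurable_fun setT (fun z : (R * Omega) * R => z.2) by exact: measurable_snd.
    have m2 : measurable_fun setT (fun z : (R * Omega) * R => z.1.1).
      by apply: (measurableT_comp (f := fst)).
    have := measurable_and (measurable_fun_ler (measurable_cst (0 : R)) m1) (measurable_fun_ler m1 m2).
    by move=> /(_ measurableT [set true] I); rewrite setTI; congr (measurable _); apply/seteqP.
  apply: measurable_funD => //; apply: (measurableT_comp mg).
  apply: measurable_fun_pair; first exact: measurable_snd.
  exact: (measurableT_comp measurable_snd measurable_fst).
have h0 z : (0 <= h z)%E.
  rewrite lee_fin; apply: mulr_ge0; first by rewrite indicE.
  by have := g1 (z.2, z.1.2); rewrite ler_norml => /andP[? _]; lra.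
have := @measurable_fun_fubini_tonelli_F _ _ _ _ R mu h mh h0.
suff -> : fubini_F mu h = (fun u : R * Omega => (\int[mu]_s (\1_(`[0%R, u.1]%classic) s * (g (s, u.2) + 1))%:E)%E) by [].
apply/funext => u; apply: eq_integral => s _.
rewrite /h !indicE; congr (_%:R * _)%:E; congr nat_of_bool.
Qed.

Lemma measurable_pos : measurable_fun setT (fun u : R * Omega => pos u.1 u.2).
Proof.
have -> : (fun u : R * Omega => pos u.1 u.2) = (fun u => shifted u - Num.max 0 u.1).
  by apply/funext => -[t w]; rewrite shiftedE addrK.
apply: measurable_funB => //; apply: measurable_maxr => //.
Qed.

Lemma pos_lipschitz (w : Omega) (s t : R) : 0 <= s -> s <= t -> `|pos t w - pos s w| <= t - s.
Proof.
move=> s0 st.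
rewrite /pos Rintegral_itvB//; last by first [exact: integrable_path|rewrite bnd_simp].
have f : (mu `]s, t]%classic < +oo)%E.
  by rewrite lebesgue_measure_itv/=; case: ifP => _; rewrite ltry.
apply: le_trans (le_normr_Rintegral _ _) _ => //; first exact: integrable_path.
apply: (@le_trans _ _ (\int[mu]_(u in `]s, t]) 1)).
  apply: le_Rintegral => //; first by apply: integrable_norm; exact: integrable_path.
  exact: integrable_cst1.
rewrite Rintegral_cst//= mul1r lebesgue_measure_itv/= lte_fin.
by case: ltP => // ts; rewrite /= subr_ge0.
Qed.

End position_measurability.

(** * Measurability of the exit *)

Section exit_measurability.
Context d (Omega : measurableType d) (R : realType).
Variables (L c : R) (X Y : R -> Omega -> R).
Hypotheses (c0 : 0 < c)
  (mX : measurable_fun setT (fun u : R * Omega => X u.1 u.2))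
  (mY : measurable_fun setT (fun u : R * Omega => Y u.1 u.2))
  (lipY : forall w s t, 0 <= s -> s <= t -> `|Y t w - Y s w| <= c * (t - s)).

Let r_ (k : nat) : R := if @choice.unpickle rat k is Some q then ratr q else 0.

Let out (k : nat) (w : Omega) : bool := (0 < r_ k) && ~~ (0 <= Y (r_ k) w <= L).

Let f (k : nat) (w : Omega) : \bar R := if out k w then (r_ k)%:E else +oo%E.

Let mYr t : measurable_fun setT (Y t).
Proof. exact: (measurableT_comp mY (pair1_measurable t)). Qed.

Let mf k : measurable_fun setT (f k).
Proof.
apply: measurable_fun_ifT => //.
apply: measurable_and => //; apply: measurable_neg; apply: measurable_and.
  by apply: measurable_fun_ler.
by apply: measurable_fun_ler.
Qed.

(** The height is Lipschitz, so if the path is outside the strip at time t it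
    stays outside for some time after t; the infimum is therefore the same
    over positive rational times. *)
Lemma measurable_exit_time : measurable_fun setT (exit_time (strip L) X Y).
Proof.
rewrite (_ : exit_time _ _ _ = (fun w => einfs (f ^~ w) 0%N)); last first.
  apply/funext => w; rewrite /exit_time /einfs; apply/eqP; rewrite eq_le; apply/andP; split.
    apply: le_ereal_inf_tmp => _ [k _ <-]; rewrite /f; case: ifPn => [/andP[r0 /negP rN]|_]; last exact: leey.
    by apply: ereal_inf_lbound; exists (r_ k).
  apply: le_ereal_inf_tmp => _ [t [t0 /= tN] <-].
  apply/lee_addgt0Pr => e e0.
  have [del del0 H] : exists2 del, 0 < del & forall s, t <= s -> s < t + del -> ~~ (0 <= Y s w <= L).
    have /negP := tN; rewrite /strip/= negb_and -!ltNge => /orP[h|h].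
      exists (- Y t w / c); first by rewrite divr_gt0// oppr_gt0.
      move=> s ts; rewrite -ltrBlDl ltr_pdivlMr// mulrC => sd.
      have := lipY w (ltW t0) ts; rewrite negb_and -!ltNge => l; apply/orP; left.
      by have := ler_norm (Y s w - Y t w); lra.
    exists ((Y t w - L) / c); first by rewrite divr_gt0// subr_gt0.
    move=> s ts; rewrite -ltrBlDl ltr_pdivlMr// mulrC => sd.
    have := lipY w (ltW t0) ts; rewrite negb_and -!ltNge => l; apply/orP; right.
    by have := ler_norm (- (Y s w - Y t w)); rewrite normrN; lra.
  have m0 : t < t + Num.min e del by rewrite ltrDl lt_min e0.
  have [q] := rat_in_itvoo m0; rewrite in_itv/= => /andP[tq].
  rewrite -ltrBlDl lt_min => /andP[qe qd].
  have rq : r_ (choice.pickle q) = ratr q by rewrite /r_ choice.pickleK.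
  apply: (@le_trans _ _ (f (choice.pickle q) w)).
    by apply: ereal_inf_lbound; exists (choice.pickle q).
  rewrite /f ifT; first by rewrite rq lee_fin; lra.
  by rewrite /out rq (lt_trans t0 tq)/=; apply: H; lra.
exact: measurable_fun_einfs.
Qed.

Lemma measurable_lower_exit (A : set R) : measurable A ->
  measurable (lower_exit (strip L) X Y A).
Proof.
move=> mA; have mtau := measurable_exit_time.
pose tau := exit_time (strip L) X Y.
have mft : measurable_fun setT (fun w => (fine (tau w), w)).
  by apply: measurable_fun_pair => //; apply: (measurableT_comp (f := fine)) => //; exact: fine_measurable.
rewrite (_ : lower_exit _ _ _ _ = (tau @^-1` [set x | (x < +oo)%E]) `&`
  (((fun w => X (fine (tau w)) w) @^-1` A) `&` ((fun w => Y (fine (tau w)) w) @^-1` [set 0]))); last first.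
  by apply/seteqP; split => w /=; [move=> [? ? ?]|move=> [? [? ?]]].
apply: measurableI; last apply: measurableI.
- rewrite -[X in measurable X]setTI.
  rewrite (_ : [set x | _] = `]-oo, +oo%E[%classic); last first.
    by apply/seteqP; split => x /=; rewrite in_itv.
  by apply: mtau => //; exact: emeasurable_itv.
- rewrite -[X in measurable X]setTI.
  exact: (measurableT_comp mX mft).
- rewrite -[X in measurable X]setTI.
  exact: (measurableT_comp mY mft).
Qed.

End exit_measurability.

(** * Directions and legs of the path *)

Section directions.
Context (R : realType).

Lemma Z4_cases (j : 'Z_4) : [\/ j = 0, j = 1, j = 2 | j = 3].
Proof.
case: j => -[|[|[|[|m]]]] h //.
- by apply: Or41; exact/val_inj.
- by apply: Or42; exact/val_inj.
- by apply: Or43; exact/val_inj.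
- by apply: Or44; exact/val_inj.
Qed.

Lemma Z4_steps :
  (((0 + 1)%R = 1%R :> 'Z_4) * ((0 - 1)%R = 3%R :> 'Z_4) * ((1 + 1)%R = 2%R :> 'Z_4) * ((1 - 1)%R = 0%R :> 'Z_4) *
  ((2 + 1)%R = 3%R :> 'Z_4) * ((2 - 1)%R = 1%R :> 'Z_4) * ((3 + 1)%R = 0%R :> 'Z_4) * ((3 - 1)%R = 2%R :> 'Z_4))%type.
Proof. by do !split; apply/val_inj. Qed.

Lemma dir_y0 : dir_y R 0 = 0. Proof. by rewrite /dir_y mulr0 mul0r sin0. Qed.
Lemma dir_x0 : dir_x R 0 = 1. Proof. by rewrite /dir_x mulr0 mul0r cos0. Qed.
Lemma dir_y1 : dir_y R 1 = 1. Proof. by rewrite /dir_y mulr1 sin_pihalf. Qed.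
Lemma dir_x1 : dir_x R 1 = 0. Proof. by rewrite /dir_x mulr1 cos_pihalf. Qed.
Lemma dir_y2 : dir_y R 2 = 0.
Proof. by rewrite /dir_y (_ : nat_of_ord 2 = 2%N)// mulfK// sinpi. Qed.
Lemma dir_x2 : dir_x R 2 = -1.
Proof. by rewrite /dir_x (_ : nat_of_ord 2 = 2%N)// mulfK// cospi. Qed.
Lemma dir_y3 : dir_y R 3 = -1.
Proof.
rewrite /dir_y (_ : nat_of_ord 3 = 3%N)// (_ : _ / 2 = pi / 2 + pi); last by field.
by rewrite sinDpi sin_pihalf.
Qed.
Lemma dir_x3 : dir_x R 3 = 0.
Proof.
rewrite /dir_x (_ : nat_of_ord 3 = 3%N)// (_ : _ / 2 = pi / 2 + pi); last by field.
by rewrite cosDpi cos_pihalf oppr0.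
Qed.

Lemma normr_dir_x_le1 j : `|dir_x R j| <= 1. Proof. exact: normr_cos_le1. Qed.
Lemma normr_dir_y_le1 j : `|dir_y R j| <= 1. Proof. exact: normr_sin_le1. Qed.

End directions.

(** The starting time of the n-th leg, that is the time of the n-th event,
    with leg 0 starting at time 0. *)
Definition leg_time (R : realType) (Omega : Type) (T : nat -> Omega -> R) (n : nat) (w : Omega) : R :=
  \sum_(k < n) T k w.

Definition leg_sum (R : realType) (Omega : Type) (J0 : Omega -> 'Z_4) (T : nat -> Omega -> R)
    (turn : nat -> Omega -> bool) (f : 'Z_4 -> R) (n : nat) (w : Omega) : R :=
  \sum_(k < n) f (leg_dir J0 turn k w) * T k w.

Section path.
Context d (Omega : measurableType d) (R : realType).
Local Notation mu := (@lebesgue_measure R).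
Variables (J0 : Omega -> 'Z_4) (T : nat -> Omega -> R) (turn : nat -> Omega -> bool).
Hypotheses (mJ0 : forall j, measurable (J0 @^-1` [set j]))
  (mT : forall n, measurable_fun setT (T n))
  (mturn : forall n b, measurable (turn n @^-1` [set b])).
Variable w : Omega.
Hypotheses (T0 : forall k, 0 < T k w) (T1 : forall m, exists2 k, (m <= k)%N & 1 < T k w).

Local Notation D := (direction J0 T turn).
Local Notation dirn n := (leg_dir J0 turn n w).
Local Notation tm n := (leg_time T n w).

Lemma leg_timeS n : tm n.+1 = tm n + T n w. Proof. by rewrite /leg_time big_ord_recr. Qed.

Lemma leg_time_lt n : tm n < tm n.+1. Proof. by rewrite leg_timeS ltrDl. Qed.

Lemma leg_time_le m n : (m <= n)%N -> tm m <= tm n.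
Proof.
move=> mn; rewrite -(subnK mn) addnC; elim: (n - m)%N => [|k IH]; first by rewrite addn0.
by rewrite addnS; apply: le_trans IH _; exact/ltW/leg_time_lt.
Qed.

Lemma leg_time_ge0 n : 0 <= tm n. Proof. by apply: sumr_ge0 => k _; exact: ltW. Qed.

Lemma leg_time_unbounded (s : R) : exists n, s < tm n.
Proof.
suff H (N : nat) : exists n, N%:R <= tm n.
  have [n h] := H (Num.truncn s).+1.
  by exists n; apply: lt_le_trans h; exact: Num.Theory.truncnS_gt.
elim: N => [|N [n h]]; first by exists 0%N; exact: leg_time_ge0.
have [k nk Tk] := T1 n.
exists k.+1; rewrite leg_timeS -natr1; apply: lerD; last exact: ltW.
exact: le_trans h (leg_time_le nk).
Qed.

Lemma leg_time_cover (s : R) : 0 <= s -> exists n, tm n <= s < tm n.+1.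
Proof.
move=> s0; have ex : exists n, s < tm n by exact: leg_time_unbounded.
case: (ex_minnP ex) => -[|n] h hmin.
  by move: h; rewrite /leg_time big_ord0 ltNge s0.
exists n; rewrite h andbT leNgt; apply/negP => /hmin.
by rewrite ltnn.
Qed.

Lemma count_leg n s : tm n <= s < tm n.+1 -> poisson_count T s w = n.
Proof.
move=> /andP[ns sn].
have E m : (event_time T m w <= s) = (m < n)%N.
  rewrite -/(leg_time T m.+1 w); case: ltnP => mn.
    exact: le_trans (leg_time_le mn) ns.
  apply/negbTE; rewrite -ltNge; apply: lt_le_trans sn _; exact: leg_time_le.
rewrite /poisson_count (@card_fset_set_bounded (fun m => event_time T m w <= s) n).
  rewrite (eq_bigr (fun=> 1%N)); last by move=> i _; rewrite E ltn_ord.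
  by rewrite sum1_card card_ord.
by move=> m nm; rewrite E -leqNgt.
Qed.

Lemma direction_leg n s : tm n <= s < tm n.+1 -> D s w = dirn n.
Proof. by move=> h; rewrite directionE (count_leg h). Qed.

Lemma direction_start : D 0 w = J0 w.
Proof.
rewrite (@direction_leg 0%N) /leg_dir ?big_ord0 ?addr0//.
by rewrite {1}/leg_time big_ord0 lexx/= -[X in X < _]/(0 : R); apply: le_lt_trans (leg_time_lt 0); rewrite leg_time_ge0.
Qed.

Variable f : 'Z_4 -> R.
Hypothesis f1 : forall j, `|f j| <= 1.

Local Notation fpos n := (leg_sum J0 T turn f n w).

Let ipath A : measurable A -> (mu A < +oo)%E -> mu.-integrable A (EFin \o (fun s => f (D s w))).
Proof.
move=> mA fA.
exact: (@integrable_path _ _ _ (fun u => f (D u.1 u.2)) (measurable_fun_direction mJ0 mT mturn f) (fun u => f1 _) w A mA fA).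
Qed.

Let leg_step n s : tm n <= s <= tm n.+1 ->
  \int[mu]_(u in `[0, tm n]) f (D u w) = fpos n ->
  \int[mu]_(u in `[0, s]) f (D u w) = fpos n + f (dirn n) * (s - tm n).
Proof.
move=> /andP[ns sn] H0.
have fin (b1 b2 : bool) (p q : R) : (mu [set` Interval (BSide b1 p) (BSide b2 q)] < +oo)%E.
  by rewrite lebesgue_measure_itv/=; case: ifP => _; rewrite ltry.
rewrite -[LHS](subrK (\int[mu]_(u in `[0, tm n]) f (D u w))) Rintegral_itvB; last 3 first.
- by apply: ipath => //; exact: fin.
- by rewrite bnd_simp ?leg_time_ge0.
- by rewrite bnd_simp ?leg_time_ge0.
rewrite H0 addrC; congr (_ + _).
rewrite -Rintegral_itv_bndo_bndc; last by apply: ipath => //; exact: fin.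
rewrite (@eq_Rintegral _ _ _ mu _ (cst (f (dirn n)))); last first.
  move=> u; rewrite inE/= in_itv/= => /andP[nu us].
  by rewrite (@direction_leg n)// (ltW nu)/=; exact: lt_le_trans sn.
rewrite Rintegral_cst//= lebesgue_measure_itv/= lte_fin.
by case: ltP => // sn'; have -> : s = tm n; [apply/eqP; rewrite eq_le ns sn'|rewrite subrr !mulr0].
Qed.

(** The direction is constant on each leg, and the integral is split at the
    starting time of the current one. *)
Lemma integral_leg n s : tm n <= s <= tm n.+1 ->
  \int[mu]_(u in `[0, s]) f (D u w) = fpos n + f (dirn n) * (s - tm n).
Proof.
suff H : \int[mu]_(u in `[0, tm n]) f (D u w) = fpos n by move=> h; exact: leg_step.
elim: n => [|n IH]; first by rewrite /leg_time /leg_sum !big_ord0 set_itv1 Rintegral_set1.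
rewrite (@leg_step n)//; last by rewrite lexx andbT ltW// leg_time_lt.
by rewrite /leg_sum big_ord_recr/= leg_timeS addrAC subrr add0r.
Qed.

End path.

(** * The exit through the lower side, leg by leg *)

Section legs.
Context (Omega : Type) (R : realType).
Variables (J0 : Omega -> 'Z_4) (T : nat -> Omega -> R) (turn : nat -> Omega -> bool).
Variables (c L x y : R).

Definition leg_x n w : R := x + c * leg_sum J0 T turn (dir_x R) n w.
Definition leg_y n w : R := y + c * leg_sum J0 T turn (dir_y R) n w.

(** The strip contains the starting points of the legs 0, ..., n; since the
    height is monotone along a leg, the path is then in the strip up to that
    time. *)
Fixpoint alive (n : nat) (w : Omega) : bool :=
  (0 <= leg_y n w <= L) && (if n is n'.+1 then alive n' w else true).

Lemma alive_le m n w : (m <= n)%N -> alive n w -> alive m w.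
Proof.
elim: n => [|n IH]; first by rewrite leqn0 => /eqP ->.
by rewrite leq_eqVlt => /predU1P[->//|mn] /= /andP[_]; exact: IH.
Qed.

Lemma alive_y n w : alive n w -> 0 <= leg_y n w <= L.
Proof. by case: n => [|n] /= /andP[]. Qed.

Lemma leg_xS n w : leg_x n.+1 w = leg_x n w + dir_x R (leg_dir J0 turn n w) * (c * T n w).
Proof. by rewrite /leg_x /leg_sum big_ord_recr/=; ring. Qed.

Lemma leg_yS n w : leg_y n.+1 w = leg_y n w + dir_y R (leg_dir J0 turn n w) * (c * T n w).
Proof. by rewrite /leg_y /leg_sum big_ord_recr/=; ring. Qed.

End legs.

Section exit_path.
Context d (Omega : measurableType d) (R : realType).
Local Notation mu := (@lebesgue_measure R).
Variables (J0 : Omega -> 'Z_4) (T : nat -> Omega -> R) (turn : nat -> Omega -> bool).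
Variables (c L x y : R).
Local Notation leg_x := (leg_x J0 T turn c x).
Local Notation leg_y := (leg_y J0 T turn c y).
Local Notation alive := (alive J0 T turn c L y).

Hypotheses (mJ0 : forall j, measurable (J0 @^-1` [set j]))
  (mT : forall n, measurable_fun setT (T n))
  (mturn : forall n b, measurable (turn n @^-1` [set b])).
Hypotheses (c0 : 0 < c) (L0 : 0 < L) (y0 : 0 <= y) (yL : y <= L).
Variable w : Omega.
Hypotheses (T0 : forall k, 0 < T k w) (T1 : forall m, exists2 k, (m <= k)%N & 1 < T k w).

Local Notation D := (direction J0 T turn).
Local Notation X := (position_x c x D).
Local Notation Y := (position_y c y D).
Local Notation tm n := (leg_time T n w).
Local Notation dirn n := (leg_dir J0 turn n w).

Let XE n s : tm n <= s <= tm n.+1 -> X s w = leg_x n w + c * (dir_x R (dirn n) * (s - tm n)).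
Proof.
move=> h; rewrite /position_x (integral_leg mJ0 mT mturn T0 (@normr_dir_x_le1 R) h) /leg_x.
by ring.
Qed.

Let YE n s : tm n <= s <= tm n.+1 -> Y s w = leg_y n w + c * (dir_y R (dirn n) * (s - tm n)).
Proof.
move=> h; rewrite /position_y (integral_leg mJ0 mT mturn T0 (@normr_dir_y_le1 R) h) /leg_y.
by ring.
Qed.

(** Along a leg the height is affine in time, so it stays between its values
    at the two ends. *)
Let Yconv n s : tm n <= s <= tm n.+1 -> 0 <= leg_y n w <= L -> 0 <= leg_y n.+1 w <= L -> 0 <= Y s w <= L.
Proof.
move=> h; rewrite (YE h) leg_yS; move: h; rewrite leg_timeS => /andP[h1 h2].
set u := s - tm n; have u0 : 0 <= u by rewrite subr_ge0.
have u1 : u <= T n w by rewrite lerBlDl.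
set v := dir_y _ _.
have cu : c * u <= c * T n w by rewrite ler_pM2l.
have cu0 : 0 <= c * u by rewrite mulr_ge0// ltW.
have -> : c * (v * u) = v * (c * u) by ring.
move: cu cu0; move: (c * u) (c * T n w) => p q pq p0 /andP[a1 a2] /andP[b1 b2].
by have [v0|v0] := leP 0 v; apply/andP; split; nra.
Qed.

Let alive0 : alive 0 w.
Proof. by rewrite /= /leg_y /leg_sum big_ord0 mulr0 addr0 y0 yL. Qed.

Let inside n s : alive n w -> 0 <= s <= tm n -> 0 <= Y s w <= L.
Proof.
move=> al /andP[s0 sn].
have [m mh] := leg_time_cover T0 T1 s0.
have [mn|nm] := ltnP m n.
  have /andP[m1 m2] := mh.
  apply: (@Yconv m); first by rewrite m1 ltW.
    by apply: alive_y; apply: alive_le al; exact: ltnW.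
  by apply: alive_y; exact: alive_le al.
have tn : tm n <= tm m by exact: leg_time_le.
have /andP[m1 m2] := mh.
have -> : s = tm n by apply/eqP; rewrite eq_le sn (le_trans tn).
rewrite (@YE n) ?lexx ?subrr ?mulr0 ?addr0 ?alive_y//=.
by rewrite ltW// leg_time_lt.
Qed.

(** It suffices to be inside up to time v and outside on a right neighbourhood
    of v, here up to the end of the leg. *)
Lemma exit_time_at (n : nat) (v : R) : 0 <= v -> v < tm n.+1 ->
  (forall s, 0 <= s <= v -> 0 <= Y s w <= L) ->
  (forall s, v < s <= tm n.+1 -> ~~ (0 <= Y s w <= L)) ->
  exit_time (strip L) X Y w = v%:E.
Proof.
move=> v0 vt Yin Yout; rewrite /exit_time; apply/eqP; rewrite eq_le; apply/andP; split.
  apply/lee_addgt0Pr => e e0.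
  pose s := Num.min (v + e) (tm n.+1).
  have vs : v < s by rewrite lt_min ltrDl e0.
  apply: (@le_trans _ _ s%:E); last by rewrite lee_fin ge_min lexx.
  apply: ereal_inf_lbound; exists s => //; split; first exact: le_lt_trans vs.
  by apply/negP/Yout; rewrite vs ge_min lexx orbT.
apply: le_ereal_inf_tmp => _ [s [s0 sN] <-]; rewrite lee_fin leNgt; apply/negP => sv.
by apply: sN; apply: Yin; rewrite !ltW.
Qed.

(** The path leaves the strip during the first leg whose end is outside. A
    horizontal leg cannot do this; an upward one leaves at height L, which is
    not 0; a downward one leaves at height 0, with the abscissa of its
    starting point. *)
Lemma lower_exitP (A : set R) :
  lower_exit (strip L) X Y A w <->
  exists n, [/\ alive n w, dirn n = 3, leg_y n w < c * T n w & A (leg_x n w)].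
Proof.
have down n : alive n w -> dirn n = 3 -> leg_y n w < c * T n w ->
    [/\ exit_time (strip L) X Y w = (tm n + leg_y n w / c)%:E,
        X (tm n + leg_y n w / c) w = leg_x n w & Y (tm n + leg_y n w / c) w = 0].
  move=> al d3 yT; have /andP[Y0 YL] := alive_y al.
  have v0 : 0 <= leg_y n w / c by rewrite divr_ge0// ltW.
  have v1 : leg_y n w / c < T n w by rewrite ltr_pdivrMr// mulrC.
  have h : tm n <= tm n + leg_y n w / c <= tm n.+1.
    by rewrite lerDl v0 leg_timeS lerD2l ltW.
  have cc : c != 0 by rewrite gt_eqF.
  split.
  - apply: (@exit_time_at n).
    + by rewrite addr_ge0// leg_time_ge0.
    + by rewrite leg_timeS ltrD2l.
    + move=> s /andP[s0 sv]; have [sn|sn] := leP s (tm n).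
        by apply: (inside al); rewrite s0.
      have hs : tm n <= s <= tm n.+1 by case/andP: h => _ h2; rewrite (ltW sn)/= (le_trans sv).
      rewrite (YE hs) d3 dir_y3 mulN1r mulrN.
      have : c * (s - tm n) <= leg_y n w.
        by rewrite mulrC -ler_pdivlMr// lerBlDl.
      have : 0 <= c * (s - tm n) by rewrite mulr_ge0 ?(ltW c0)// subr_ge0 ltW.
      by move: (c * (s - tm n)) => p p0 p1; apply/andP; lra.
    + move=> s /andP[vs sn].
      have hs : tm n <= s <= tm n.+1 by case/andP: h => h1 _; rewrite sn andbT (le_trans h1)// ltW.
      rewrite (YE hs) d3 dir_y3 mulN1r mulrN negb_and -!ltNge; apply/orP; left.
      have : leg_y n w < c * (s - tm n) by rewrite mulrC -ltr_pdivrMr// ltrBrDl.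
      lra.
  - by rewrite (XE h) d3 dir_x3 mul0r mulr0 addr0.
  - by rewrite (YE h) d3 dir_y3; field.
split; last first.
  move=> [n [al d3 yT Ax]]; have [tE XX YY] := down n al d3 yT.
  by rewrite /lower_exit/= tE; split; rewrite ?ltry//= XX.
have [allal|] := pselect (forall n, alive n w).
  move=> [+ _ _]; rewrite /exit_time (_ : [set t | _] = set0) ?image_set0 ?ereal_inf0//.
  apply/seteqP; split => // s [s0 sN]; apply: sN.
  have [m mh] := leg_time_cover T0 T1 (ltW s0).
  by apply: (@inside m.+1) => //; rewrite (ltW s0)/= ltW//; case/andP: mh.
move=> /existsNP ex'; have ex : exists n, ~~ alive n w by case: ex' => n /negP; exists n.
case: (ex_minnP ex) => -[|n] nal nmin; first by rewrite alive0 in nal.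
have al : alive n w.
  by apply/negPn/negP => /nmin; rewrite ltnn.
have /andP[Y0 YL] := alive_y al.
move: nal; rewrite [alive n.+1 w]/= al andbT leg_yS.
have cT : 0 < c * T n w by rewrite mulr_gt0.
have [d0|d1|d2|d3] := Z4_cases (dirn n).
- by rewrite d0 dir_y0 mul0r addr0 alive_y.
- rewrite d1 dir_y1 mul1r => nL.
  have LT : L < leg_y n w + c * T n w.
    by rewrite ltNge; apply: contra nL => h; rewrite h andbT addr_ge0// ltW.
  have v0 : 0 <= (L - leg_y n w) / c by rewrite divr_ge0 ?subr_ge0// ltW.
  have v1 : (L - leg_y n w) / c < T n w by rewrite ltr_pdivrMr// mulrC ltrBlDl.
  have h : tm n <= tm n + (L - leg_y n w) / c <= tm n.+1.
    by rewrite lerDl v0 leg_timeS lerD2l ltW.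
  have cc : c != 0 by rewrite gt_eqF.
  have tE : exit_time (strip L) X Y w = (tm n + (L - leg_y n w) / c)%:E.
    apply: (@exit_time_at n).
    + by rewrite addr_ge0// leg_time_ge0.
    + by rewrite leg_timeS ltrD2l.
    + move=> s /andP[s0 sv]; have [sn|sn] := leP s (tm n).
        by apply: (inside al); rewrite s0.
      have hs : tm n <= s <= tm n.+1 by case/andP: h => _ h2; rewrite (ltW sn)/= (le_trans sv).
      rewrite (YE hs) d1 dir_y1 mul1r.
      have : c * (s - tm n) <= L - leg_y n w.
        by rewrite mulrC -ler_pdivlMr// lerBlDl.
      have : 0 <= c * (s - tm n) by rewrite mulr_ge0 ?(ltW c0)// subr_ge0 ltW.
      by move: (c * (s - tm n)) => p p0 p1; apply/andP; lra.
    + move=> s /andP[vs sn].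
      have hs : tm n <= s <= tm n.+1 by case/andP: h => h1 _; rewrite sn andbT (le_trans h1)// ltW.
      rewrite (YE hs) d1 dir_y1 mul1r negb_and -!ltNge; apply/orP; right.
      have : L - leg_y n w < c * (s - tm n) by rewrite mulrC -ltr_pdivrMr// ltrBrDl.
      lra.
  rewrite /lower_exit/= tE /= => -[_ _].
  rewrite (YE h) d1 dir_y1 mul1r (_ : leg_y n w + _ = L) => [L00|]; last by field.
  by move: L0; rewrite L00 ltxx.
- by rewrite d2 dir_y2 mul0r addr0 alive_y.
- rewrite d3 dir_y3 mulN1r => nL.
  have yT : leg_y n w < c * T n w.
    rewrite ltNge; apply: contra nL => h; rewrite subr_ge0 h/=.
    by rewrite lerBlDr; apply: (le_trans YL); rewrite lerDl ltW.
  have [tE XX YY] := down n al d3 yT.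
  by rewrite /lower_exit/= tE /= XX => -[_ Ax _]; exists n; split.
Qed.

End exit_path.

(** * Independence of the past *)

Section grouping.
Context d (Omega : measurableType d) (R : realType) (P : probability Omega R).
Variables (I : choiceType) (F : I -> set (set Omega)).
Hypotheses (indep : mutually_independent P F)
  (mF : forall i A, F i A -> measurable A) (FT : forall i, F i setT)
  (FI : forall i, setI_closed (F i)).

(** A generating pi-system for the sigma-algebra of the family indexed by J. *)
Definition boxes (J : {fset I}) : set (set Omega) :=
  [set V | exists2 E : I -> set Omega, forall i, F i (E i) & V = \bigcap_(i in [set` J]) E i].

Lemma boxes_measurable J V : boxes J V -> measurable V.
Proof.
move=> [E FE ->]; rewrite bigcap_fset; apply: big_ind => //.
- by move=> A B; exact: measurableI.
- by move=> i _; exact: mF (FE i).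
Qed.

Lemma sigma_boxes_measurable J V : <<s boxes J >> V -> measurable V.
Proof.
by move: V; apply: smallest_sub; [exact: sigma_algebra_measurable|exact: boxes_measurable].
Qed.

Lemma boxes_setI J : setI_closed (boxes J).
Proof.
move=> _ _ [E1 F1 ->] [E2 F2 ->]; exists (fun i => E1 i `&` E2 i).
  by move=> i; exact: FI.
by rewrite bigcapI.
Qed.

Lemma boxes_coord (J : {fset I}) i A : i \in J -> F i A -> boxes J A.
Proof.
move=> iJ FA; exists (fun k => if k == i then A else setT).
  by move=> k; case: eqP => // ->.
apply/seteqP; split => w /=.
  by move=> Aw k _; case: eqP.
by move=> /(_ i iJ); rewrite eqxx.
Qed.

(** Mutual independence gives the product rule on boxes, and Dynkin's lemma
    extends it to the sigma-algebra that they generate. *)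
Lemma independent_boxes (J : {fset I}) i0 V E0 : i0 \notin J ->
  <<s boxes J >> V -> F i0 E0 -> P (V `&` E0) = (P V * P E0)%E.
Proof.
move=> iJ sV FE0; have mE0 := mF FE0.
pose Q (V : set Omega) := P (V `&` E0) = (P V * P E0)%E.
apply: (@dynkin_induction _ (g_sigma_algebraType (boxes J)) (boxes J) Q) => //.
- exact: boxes_setI.
- by rewrite /Q setTI probability_setT mul1e.
- move=> _ [E FE ->]; rewrite /Q.
  pose E' i := if i == i0 then E0 else E i.
  have E'E i : i \in J -> E' i = E i.
    by rewrite /E'; case: eqP => // -> h; rewrite h in iJ.
  have -> : \bigcap_(i in [set` J]) E i = \bigcap_(i in [set` J]) E' i.
    by apply: eq_bigcapr => i /= iJ'; rewrite E'E.
  have FE' i : F i (E' i) by rewrite /E'; case: eqP => // ->.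
  have := indep (J := (i0 |` J)%fset) (fun i _ => FE' i).
  rewrite set_fsetU1 bigcap_setU1 big_fsetU1//= {1 3}/E' eqxx.
  rewrite -(indep (fun i _ => FE' i)) => h.
  by rewrite setIC h muleC.
- move=> S /sigma_boxes_measurable mS; rewrite /Q => QS.
  have h : P E0 = (P (~` S `&` E0) + P S * P E0)%E.
    by rewrite -QS setIC -setDE [S `&` E0]setIC; exact: measureDI.
  rewrite probability_setC// muleBl ?fin_num_measure// mul1e {1}h addeK//.
  by rewrite fin_numM// fin_num_measure.
- move=> G mG tG; rewrite /Q => QG.
  have mG' n : d.-measurable (G n : set Omega) := sigma_boxes_measurable (mG n).
  rewrite setI_bigcupl !measure_bigcup//; last 2 first.
  - by move=> n _; exact: measurableI.
  - exact: trivIset_setIr.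
  have eE : P E0 = (fine (P E0))%:E by rewrite fineK ?fin_num_measure.
  rewrite muleC eE -nneseriesZl//.
  by apply: eq_eseriesr => n _; rewrite -eE muleC; exact: QG.
Qed.

End grouping.

Section freezing.
Context d (Omega : measurableType d) (R : realType) (P : probability Omega R).
Variables (C : set (set Omega)) (mC : forall V, <<s C >> V -> measurable V).
Context d2 (E : measurableType d2).
Variables (tau : Omega -> E) (mtau : measurable_fun setT tau) (nu : probability E R).
Hypothesis tau_law : forall V B, <<s C >> V -> measurable B ->
  P (V `&` tau @^-1` B) = (P V * nu B)%E.
Local Notation Omega' := (g_sigma_algebraType C).

(** If tau is independent of a sigma-algebra, the law of the pair formed by
    the outcome, seen through this sigma-algebra, and tau is a product
    measure; Fubini then integrates tau first with the past frozen. Taking the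
    sample space itself with a smaller sigma-algebra as first component avoids
    naming the past variables. *)
Lemma Rintegral_freeze (M : R) (f : Omega' * E -> R) : bmeas M f ->
  \int[P]_w f (w, tau w) = \int[P]_w \int[nu]_t f (w, t).
Proof.
move=> [mf fM].
have mid : measurable_fun setT (id : Omega -> Omega').
  by move=> _ Y mY; rewrite setTI; exact: mC.
pose idX : {mfun Omega >-> Omega'} := mfun_Sub (mem_set mid).
pose phi (w : Omega) : Omega' * E := (w, tau w).
have mphi : measurable_fun setT phi by exact: measurable_fun_pair.
pose phiX : {mfun Omega >-> [the measurableType _ of (Omega' * E)%type]} := mfun_Sub (mem_set mphi).
pose m := distribution P phiX.
pose P' := distribution P idX.
have lawE X : measurable X -> (P' \x nu)%E X = m X.
  apply: (@product_measure_unique _ _ _ _ R P' nu) => // A B mA mB.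
have imf : (P' \x nu)%E.-integrable setT (EFin \o f).
  apply: (@le_integrableR _ _ _ (P' \x nu)%E setT f (cst M)) => //.
  apply/integrableP; split; first exact/measurable_EFinP.
  rewrite (eq_integral (cst `|M|%:E))// integral_cst//.
  apply: lte_mul_pinfty => //; apply: le_lt_trans (ltry 1); rewrite le_eqVlt.
  by apply/orP; left; apply/eqP; transitivity (m setT); [exact: lawE|exact: probability_setT].
have E1 : \int[P]_w f (w, tau w) = \int[m]_u f u.
  rewrite /Rintegral integral_pushforward//.
  - exact/measurable_EFinP.
  - apply: (@le_integrableR _ _ _ P setT (fun w => f (w, tau w)) (cst M)) => //.
    + exact: (measurableT_comp mf (g := phi)) mphi.
    + exact: finite_measure_integrable_cst.
have E2 : \int[m]_u f u = \int[(P' \x nu)%E]_u f u.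
  by rewrite /Rintegral; congr fine; apply: eq_measure_integral => X mX _; exact: esym (lawE X mX).
have sec w : nu.-integrable setT (fun t => (f (w, t))%:E).
  apply: (@le_integrableR _ _ _ nu setT (fun t => f (w, t)) (cst M)) => //.
    exact: measurableT_comp mf (pair1_measurable _).
  exact: finite_measure_integrable_cst.
have mF : measurable_fun setT (fun w : Omega' => \int[nu]_t f (w, t)).
  apply: (@measurable_Rintegral2 _ _ _ _ _ P' nu f (cst M)) => //.
  exact: finite_measure_integrable_cst.
rewrite E1 E2 {1}/Rintegral -(integral12_prod_meas1 imf) [RHS]/Rintegral; congr fine.
transitivity (\int[P']_w (\int[nu]_t f (w, t))%:E)%E.
  by apply: eq_integral => w _; rewrite /Rintegral fineK//; exact: integrable_fin_num.
rewrite integral_pushforward//.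
- exact/measurable_EFinP.
- apply: (@le_integrableR _ _ _ P setT (fun w => \int[nu]_t f (w, t)) (cst M)) => //.
  + exact: (measurableT_comp mF mid).
  + move=> w _; apply: normr_prob_le => //.
    split => //; exact: measurableT_comp mf (pair1_measurable _).
  + exact: finite_measure_integrable_cst.
Qed.
End freezing.

(** * The state after finitely many legs *)

Lemma measurable_Z4_family d (E : measurableType d) (R : realType) (D : E -> 'Z_4) (h : 'Z_4 -> E -> R) :
  (forall j, measurable (D @^-1` [set j])) -> (forall j, measurable_fun setT (h j)) ->
  measurable_fun setT (fun w => h (D w) w).
Proof.
move=> mD mh.
rewrite (_ : (fun w => _) = (fun w => \sum_(j : 'Z_4) h j w * \1_(D @^-1` [set j]) w)).
  by apply: measurable_sum => j; apply: measurable_funM => //; exact: measurable_indic.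
apply/funext => w; rewrite (bigD1 (D w))//= indicE mem_set// mulr1.
rewrite big1 ?addr0// => j jN; rewrite indicE memNset ?mulr0//=.
by move=> e; rewrite e eqxx in jN.
Qed.

Section state.
Context d (Omega : measurableType d) (R : realType).
Variables (J0 : Omega -> 'Z_4) (T : nat -> Omega -> R) (turn : nat -> Omega -> bool).
Variables (c L x y : R) (p q : nat).
Hypotheses (mJ0 : forall j, measurable (J0 @^-1` [set j]))
  (mT : forall k, (k < p)%N -> measurable_fun setT (T k))
  (mturn : forall k b, (k < q)%N -> measurable (turn k @^-1` [set b])).
Local Notation leg_dir := (leg_dir J0 turn).
Local Notation leg_sum := (leg_sum J0 T turn).
Local Notation leg_x := (leg_x J0 T turn c x).
Local Notation leg_y := (leg_y J0 T turn c y).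
Local Notation alive := (alive J0 T turn c L y).

Let mdir n : (n <= q)%N -> forall j, measurable (leg_dir n @^-1` [set j]).
Proof. by move=> nq j; apply: measurable_leg_dir => // k b kn; apply: mturn; exact: leq_trans nq. Qed.

Let mleg_sum f n : (n <= p)%N -> (n <= q.+1)%N -> measurable_fun setT (leg_sum f n).
Proof.
move=> np nq; apply: measurable_sum => k; apply: measurable_funM; last exact/mT/(leq_trans (ltn_ord k)).
apply: (@measurable_Z4_family _ _ _ (leg_dir k) (fun j _ => f j)) => //.
by apply: mdir; have := leq_trans (ltn_ord k) nq.
Qed.

Let mleg_x n : (n <= p)%N -> (n <= q.+1)%N -> measurable_fun setT (leg_x n).
Proof. by move=> np nq; apply: measurable_funD => //; apply: measurable_funM => //; exact: mleg_sum. Qed.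

Let mleg_y n : (n <= p)%N -> (n <= q.+1)%N -> measurable_fun setT (leg_y n).
Proof. by move=> np nq; apply: measurable_funD => //; apply: measurable_funM => //; exact: mleg_sum. Qed.

Let malive n : (n <= p)%N -> (n <= q.+1)%N -> measurable_fun setT (alive n).
Proof.
elim: n => [|n IH] np nq.
  rewrite (_ : alive 0 = fun w => (0 <= leg_y 0 w <= L) && true)//.
  by apply: measurable_and => //; apply: measurable_and; apply: measurable_fun_ler => //; exact: mleg_y.
rewrite (_ : alive n.+1 = fun w => (0 <= leg_y n.+1 w <= L) && alive n w)//.
apply: measurable_and; last by apply: IH; exact: ltnW.
by apply: measurable_and; apply: measurable_fun_ler => //; exact: mleg_y.
Qed.

Variable j0 : 'Z_4.

(** The indicator of the event that the motion starts in direction j0 and is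
    in the strip at the start of each leg up to the n-th. *)
Definition surviving n w : R := ((J0 w == j0) && alive n w)%:R.

Lemma measurable_surviving n : (n <= p)%N -> (n <= q.+1)%N -> measurable_fun setT (surviving n).
Proof.
move=> np nq.
have mJ : measurable_fun setT (fun w => J0 w == j0).
  apply: (measurable_fun_bool true); rewrite setTI.
  rewrite (_ : _ @^-1` _ = J0 @^-1` [set j0])//; apply/seteqP; split => w /=; first by move/eqP.
  by move=> ->; rewrite eqxx.
have mb : measurable_fun setT (fun w => (J0 w == j0) && alive n w) by apply: measurable_and => //; exact: malive.
rewrite (_ : surviving n = fun w => if (J0 w == j0) && alive n w then 1 else 0).
  by apply: measurable_fun_ifT.
by apply/funext => w; rewrite /surviving; case: ifP.
Qed.

Lemma surviving_le1 n w : `|surviving n w| <= 1.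
Proof. by rewrite /surviving; case: (_ && _); rewrite ?normr1// normr0. Qed.

Variable phi : 'Z_4 -> R * R -> R.
Hypothesis bphi : forall j, bmeas 1 (phi j).

Lemma bmeas_move n : (n <= p)%N -> (n <= q)%N ->
  bmeas 1 (fun u : Omega * R => surviving n u.1 * phi (leg_dir n u.1)
    (leg_x n u.1 + dir_x R (leg_dir n u.1) * u.2, leg_y n u.1 + dir_y R (leg_dir n u.1) * u.2)).
Proof.
move=> np nq; have nq1 := leqW nq; rewrite -[X in bmeas X _]mulr1; apply: bmeasM.
  split; last by move=> u; exact: surviving_le1.
  exact: (measurableT_comp (measurable_surviving np nq1) measurable_fst).
split; last by move=> u; case: (bphi (leg_dir n u.1)) => _; exact.
apply: (@measurable_Z4_family _ _ _ (fun u : Omega * R => leg_dir n u.1)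
  (fun j u => phi j (leg_x n u.1 + dir_x R j * u.2, leg_y n u.1 + dir_y R j * u.2))).
  move=> j; rewrite (_ : _ @^-1` _ = (leg_dir n @^-1` [set j]) `*` setT).
    by apply: measurableX => //; exact: mdir.
  by apply/seteqP; split => u //= -[].
move=> j; have [mphi _] := bphi j; apply: (measurableT_comp mphi).
apply: measurable_fun_pair; apply: measurable_funD.
- exact: (measurableT_comp (mleg_x np nq1) measurable_fst).
- by apply: measurable_funM.
- exact: (measurableT_comp (mleg_y np nq1) measurable_fst).
- by apply: measurable_funM.
Qed.

Lemma bmeas_turn n : (n < p)%N -> (n <= q)%N ->
  bmeas 1 (fun u : Omega * bool => surviving n u.1 *
    phi (leg_dir n u.1 + (if u.2 then 1 else -1)) (leg_x n.+1 u.1, leg_y n.+1 u.1)).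
Proof.
move=> np nq; have nq1 := leqW nq; rewrite -[X in bmeas X _]mulr1; apply: bmeasM.
  split; last by move=> u; exact: surviving_le1.
  exact: (measurableT_comp (measurable_surviving (ltnW np) nq1) measurable_fst).
split; last by move=> u; case: (bphi (leg_dir n u.1 + (if u.2 then 1 else -1))) => _; exact.
have m1 i : measurable_fun setT (fun w => phi (leg_dir n w + i) (leg_x n.+1 w, leg_y n.+1 w)).
  apply: (@measurable_Z4_family _ _ _ (leg_dir n) (fun j w => phi (j + i) (leg_x n.+1 w, leg_y n.+1 w))).
    exact: mdir.
  move=> j; have [mphi _] := bphi (j + i); apply: (measurableT_comp mphi).
  by apply: measurable_fun_pair; [exact: mleg_x|exact: mleg_y].
rewrite (_ : (fun u => _) = (fun u : Omega * bool =>
  if u.2 then phi (leg_dir n u.1 + 1) (leg_x n.+1 u.1, leg_y n.+1 u.1)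
  else phi (leg_dir n u.1 - 1) (leg_x n.+1 u.1, leg_y n.+1 u.1))).
  apply: measurable_fun_ifT => //.
    exact: (measurableT_comp (m1 1) measurable_fst).
  exact: (measurableT_comp (m1 (-1)) measurable_fst).
by apply/funext => -[w []].
Qed.

End state.

(** * The Markov property at the turns *)

(** A leg has length c times an exponential variable of rate lambda. *)
Lemma expo_scaled (R : realType) (lambda c : R) (a0 : 0 < lambda / c) (B : set R) :
  0 < lambda -> 0 < c -> measurable B ->
  exponential_prob lambda ((fun t => c * t) @^-1` B) = expo a0 B.
Proof.
move=> l0 c0 mB; rewrite expoE /exponential_prob.
have pdfE (t : R) : exponential_pdf lambda t = c * exponential_pdf (lambda / c) (0 + c * t).
  rewrite add0r; have [t0|t0] := leP 0 t.
    rewrite !exponential_pdfE ?mulr_ge0 ?(ltW c0)// mulrA; congr (_ * expR _); first by field; rewrite gt_eqF.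
    by field; rewrite gt_eqF.
  by rewrite !lt0_exponential_pdf ?mulr0// pmulr_rlt0.
have mpdf : measurable_fun B (fun t : R => (exponential_pdf (lambda / c) t)%:E).
  by apply: measurable_funTS; apply/measurable_EFinP; exact: measurable_exponential_pdf.
have pdf0 t : (0 <= (exponential_pdf (lambda / c) t)%:E)%E.
  by rewrite lee_fin exponential_pdf_ge0// ltW.
have cN0 : c != 0 by rewrite gt_eqF.
have h := @ge0_integral_affine_set R 0 c B _ cN0 mB mpdf (fun t _ => pdf0 t).
have eB : (fun t => 0 + c * t) @^-1` B = (fun t => c * t) @^-1` B.
  by apply/seteqP; split => t /=; rewrite add0r.
transitivity (\int[lebesgue_measure]_(t in (fun t => (0 + c * t)%R) @^-1` B)
    (c%:E * (exponential_pdf (lambda / c) (0 + c * t)%R)%:E))%E.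
  by rewrite eB; apply: eq_integral => t _; rewrite pdfE EFinM.
have mpre : measurable ((fun t => 0 + c * t) @^-1` B).
  rewrite eB -[X in measurable X]setTI.
  by apply: (measurable_funM (D := setT) (f := cst c) (g := id)) => //; exact: measurableT.
rewrite ge0_integralZl//; last first.
- by rewrite lee_fin ltW.
- apply/measurable_EFinP; apply: measurable_funTS.
  apply: (measurableT_comp (measurable_exponential_pdf (lambda / c))).
  by apply: measurable_funD => //; exact: measurable_funM.
by rewrite h muleA -EFinM gtr0_norm// mulfV// mul1e.
Qed.

Section leg_operator.
Context (R : realType) (a L : R) (a0 : 0 < a).

(** Mean over the two turns at the end u of a leg in direction j, provided u
    is in the strip. *)
Definition leg_mean (f : 'Z_4 -> R * R -> R) (j : 'Z_4) (u : R * R) : R :=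
  if 0 <= u.2 <= L then 2^-1 * (f (j + 1) u + f (j - 1) u) else 0.

(** Transition operator of one leg followed by a turn, for the motion killed
    when it leaves the strip. *)
Definition leg_op (f : 'Z_4 -> R * R -> R) (j : 'Z_4) (u : R * R) : R :=
  \int[expo a0]_r leg_mean f j (u.1 + dir_x R j * r, u.2 + dir_y R j * r).

(** Bounds for all four directions; the constant 1 is enough since the
    operator is applied to probabilities. *)
Definition bounded_family (f : 'Z_4 -> R * R -> R) := forall j, bmeas 1 (f j).

Lemma bounded_leg_mean f : bounded_family f -> bounded_family (leg_mean f).
Proof.
move=> nf j; split; last first.
  move=> u; rewrite /leg_mean; case: ifP => _; last by rewrite normr0.
  have [_ /(_ u) f1] := nf (j + 1); have [_ /(_ u) f2] := nf (j - 1).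
  rewrite normrM gtr0_norm//; apply: le_trans (ler_wpM2l _ (ler_normD _ _)) _ => //.
  lra.
have [m1 _] := nf (j + 1); have [m2 _] := nf (j - 1).
apply: measurable_fun_ifT => //.
  by apply: measurable_and; apply: measurable_fun_ler => //; exact: measurable_snd.
by apply: measurable_funM => //; exact: measurable_funD.
Qed.

Lemma bmeas_leg f j : bounded_family f ->
  bmeas 1 (fun v : (R * R) * R => f j (v.1.1 + dir_x R j * v.2, v.1.2 + dir_y R j * v.2)).
Proof.
move=> nf; have [mf f1] := nf j; split => //.
apply: (measurableT_comp mf); apply: measurable_fun_pair.
  apply: measurable_funD; last exact: measurable_funM.
  exact: measurableT_comp measurable_fst measurable_fst.
apply: measurable_funD; last exact: measurable_funM.
exact: measurableT_comp measurable_snd measurable_fst.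
Qed.

Lemma bounded_leg_op f : bounded_family f -> bounded_family (leg_op f).
Proof.
move=> /bounded_leg_mean nf j; have [mf f1] := bmeas_leg j nf; split.
  rewrite /leg_op.
  apply: (@measurable_Rintegral2 _ _ _ _ R (@dirac _ (R * R)%type ((0 : R), (0 : R)) R) (expo a0) (fun v : (R * R) * R => leg_mean f j (v.1.1 + dir_x R j * v.2, v.1.2 + dir_y R j * v.2)) (cst 1)) => //.
  exact: finite_measure_integrable_cst.
move=> u; apply: normr_prob_le; split => //.
  exact: measurableT_comp mf (pair1_measurable u).
by move=> r; exact: (f1 (u, r)).
Qed.

(** Probability that the leg starting at u in direction j crosses height 0
    with an abscissa in A: the leg must go down, and its length exceeds the
    height v with probability exp (- a v). *)
Definition last_leg (A : set R) (j : 'Z_4) (u : R * R) : R :=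
  if j == 3 then killed L (fun v => expR (- (a * v))) u.2 * \1_A u.1 else 0.

Lemma bounded_last_leg A : measurable A -> bounded_family (last_leg A).
Proof.
move=> mA j; rewrite /last_leg; case: (j == 3); last by split => // u; rewrite normr0.
split.
  apply: measurable_funM; last first.
    have mi : measurable_fun setT (\1_A : R -> R) by exact: measurable_indic.
    exact: (measurableT_comp mi measurable_fst).
  apply: measurable_fun_ifT => //.
    by apply: measurable_and; apply: measurable_fun_ler => //; exact: measurable_snd.
  apply: measurableT_comp => //; apply: measurable_funN.
  by apply: measurable_funM => //; exact: measurable_snd.
move=> u; rewrite normrM; have [_ /(_ u.1) i1] := bmeas_indic R mA.
rewrite -[leRHS]mulr1; apply: ler_pM => //; rewrite /killed.
case: ifP => [/andP[u0 _]|_]; last by rewrite normr0.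
by rewrite ger0_norm ?expR_ge0// -expR0 ler_expR oppr_le0 mulr_ge0// ltW.
Qed.

End leg_operator.

Section markov.
Context d (Omega : measurableType d) (R : realType) (P : probability Omega R).
Variables (lambda c L : R) (J0 : Omega -> 'Z_4) (T : nat -> {RV P >-> R}) (turn : nat -> {RV P >-> bool}).
Hypotheses (l0 : 0 < lambda) (c0 : 0 < c) (driver : motion_driver lambda J0 T turn).
Variable a0 : 0 < lambda / c.

Local Notation F := (driver_events J0 T turn).

Definition past (p q : nat) : {fset option (nat + nat)} :=
  [fset i in None :: [seq Some (inl k) | k <- iota 0 p] ++ [seq Some (inr k) | k <- iota 0 q]]%fset.

Lemma past_J0 p q : None \in past p q.
Proof. by rewrite !inE. Qed.

Lemma past_T p q k : (Some (inl k) \in past p q) = (k < p)%N.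
Proof.
rewrite !inE/=; apply/orP/idP.
  move=> [/mapP[i]|/mapP[i _] []//]; rewrite mem_iota => /andP[_ h] [->] //.
by move=> kp; left; apply/mapP; exists k => //; rewrite mem_iota.
Qed.

Lemma past_turn p q k : (Some (inr k) \in past p q) = (k < q)%N.
Proof.
rewrite !inE/=; apply/orP/idP.
  move=> [/mapP[i _] []//|/mapP[i]]; rewrite mem_iota => /andP[_ h] [->] //.
by move=> kp; right; apply/mapP; exists k => //; rewrite mem_iota.
Qed.

Let mF i A : F i A -> measurable A.
Proof.
case: i => [[n|n]|] /= [B mB <-]; rewrite ?setTI.
- by rewrite -[X in measurable X]setTI; exact: measurable_funP.
- by rewrite -[X in measurable X]setTI; exact: measurable_funP.
rewrite (_ : _ @^-1` _ = \big[setU/set0]_(j : 'Z_4 | j \in B) (J0 @^-1` [set j])).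
  apply: bigsetU_measurable => j _; exact: (initial_measurable driver).
rewrite -bigcup_seq_cond.
apply/seteqP; split => w /=.
  by move=> Bw; exists (J0 w) => //=; rewrite mem_index_enum mem_set.
by move=> [j /= /andP[_]]; rewrite inE => Bj ->.
Qed.

Let FT i : F i setT.
Proof. by case: i => [[n|n]|] /=; exists setT; rewrite ?preimage_setT ?setTI//; exact: measurableT. Qed.

Let FI i : setI_closed (F i).
Proof.
by case: i => [[n|n]|] /= _ _ [A mA <-] [B mB <-]; exists (A `&` B); rewrite ?setTI ?preimage_setI//; exact: measurableI.
Qed.

Local Notation C p q := (boxes F (past p q)).

Let mC p q V : <<s C p q >> V -> measurable V.
Proof. exact: sigma_boxes_measurable. Qed.

Let pJ0 p q j : measurable (J0 @^-1` [set j] : set (g_sigma_algebraType (C p q))).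
Proof.
apply: sub_sigma_algebra; apply: (boxes_coord FT (past_J0 p q)) => /=.
by exists [set j]; rewrite ?setTI.
Qed.

Let pT p q k : (k < p)%N -> measurable_fun setT (T k : g_sigma_algebraType (C p q) -> R).
Proof.
rewrite -(past_T p q) => kp _ B mB; apply: sub_sigma_algebra.
by apply: (boxes_coord FT kp) => /=; exists B.
Qed.

Let pturn p q k b : (k < q)%N -> measurable (turn k @^-1` [set b] : set (g_sigma_algebraType (C p q))).
Proof.
rewrite -(past_turn p q) => kq; apply: sub_sigma_algebra.
by apply: (boxes_coord FT kq) => /=; exists [set b]; rewrite ?setTI.
Qed.

Variables (x y : R) (j0 : 'Z_4).
Local Notation dirn := (leg_dir J0 turn).
Local Notation xn := (leg_x J0 T turn c x).
Local Notation yn := (leg_y J0 T turn c y).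
Local Notation aliven := (alive J0 T turn c L y).
Local Notation surv := (surviving J0 T turn c L y j0).

Let indep := driver_independent driver.

Let law_wait n V B : <<s C n n >> V -> measurable B ->
  P (V `&` (fun w => c * T n w) @^-1` B) = (P V * expo a0 B)%E.
Proof.
move=> sV mB.
have mcB : measurable ((fun t : R => c * t) @^-1` B).
  rewrite -[X in measurable X]setTI.
  by apply: (measurable_funM (D := setT) (f := cst c) (g := id)) => //; exact: measurableT.
rewrite (independent_boxes indep mF FI (i0 := Some (inl n)) _ sV).
- congr (_ * _)%E; rewrite -(expo_scaled a0 l0 c0 mB); exact: (waiting_exponential driver n mcB).
- by rewrite past_T ltnn.
- by exists ((fun t : R => c * t) @^-1` B); rewrite ?setTI.
Qed.

Let law_turn n V B : <<s C n.+1 n >> V -> measurable B ->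
  P (V `&` turn n @^-1` B) = (P V * distribution P (turn n) B)%E.
Proof.
move=> sV mB; rewrite (independent_boxes indep mF FI (i0 := Some (inr n)) _ sV)//.
- by rewrite past_turn ltnn.
- by exists B; rewrite ?setTI.
Qed.

Let Rintegral_turn n (g : bool -> R) :
  \int[distribution P (turn n)]_b g b = 2^-1 * (g true + g false).
Proof.
have bg b : bmeas 1 (\1_[set b] : bool -> R) by exact: bmeas_indic.
have fr b : fine (distribution P (turn n) [set b]) = 2^-1.
  by rewrite /distribution /pushforward/= (turn_fair driver n b).
transitivity (\int[distribution P (turn n)]_b (g true * \1_[set true] b + g false * \1_[set false] b)).
  have e (b b' : bool) : (b \in [set b']) = (b == b') by apply/idP/eqP; rewrite in_setE.
  by congr Rintegral; apply/funext => -[]; rewrite !indicE !e/= ?(mulr1, mulr0, addr0, add0r).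
rewrite (prob_D _ (bmeasZ _ (bg true)) (bmeasZ _ (bg false))) !(prob_Z _ _ (bg _)).
have ii b : \int[distribution P (turn n)]_z \1_[set b] z = 2^-1 by rewrite /Rintegral integral_indic// setIT fr.
by rewrite !ii; ring.
Qed.

Local Notation lmean := (leg_mean L).
Local Notation lop := (leg_op L a0).

(** Mean of f at the start of the n-th leg, on the event that the motion
    started in direction j0 and has survived. *)
Definition state_mean n (f : 'Z_4 -> R * R -> R) : R :=
  \int[P]_w (surv n w * f (dirn n w) (xn n w, yn n w)).

Lemma state_mean0 f : 0 <= y <= L -> state_mean 0 f = 4^-1 * f j0 (x, y).
Proof.
move=> yL; rewrite /state_mean.
transitivity (\int[P]_w (f j0 (x, y) * \1_(J0 @^-1` [set j0]) w)).
  congr Rintegral; apply/funext => w; rewrite /surviving /= /leg_x /leg_y /leg_sum !big_ord0 !mulr0 !addr0 yL andbT /=.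
  rewrite indicE; have [e|ne] := eqVneq (J0 w) j0.
    by rewrite mem_set//= mulr1 mul1r /leg_dir big_ord0 addr0 e.
  by rewrite memNset ?mulr0 ?mul0r//=; exact/eqP.
have mJ := initial_measurable driver j0.
rewrite (prob_Z _ _ (bmeas_indic R mJ)) /Rintegral integral_indic// setIT.
have -> : fine (P (J0 @^-1` [set j0])) = 4^-1 by rewrite (initial_uniform driver).
by rewrite mulrC.
Qed.

(** First the n-th turn is averaged with the first n + 1 waiting times and the
    earlier turns frozen, then the length of the n-th leg with the remaining
    past frozen. *)
Lemma state_meanS n f : bounded_family f -> state_mean n.+1 f = state_mean n (lop f).
Proof.
move=> nf; have nm := bounded_leg_mean L nf.
pose kf j u := if 0 <= u.2 <= L then f j u else 0.
have nk : bounded_family kf.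
  move=> j; have [mf f1] := nf j; split; last by move=> u; rewrite /kf; case: ifP; rewrite ?normr0.
  apply: measurable_fun_ifT => //.
  by apply: measurable_and; apply: measurable_fun_ler => //; exact: measurable_snd.
transitivity (\int[P]_w (surv n w * kf (dirn n w + (if turn n w then 1 else -1)) (xn n.+1 w, yn n.+1 w))).
  congr Rintegral; apply/funext => w; rewrite leg_dirS /surviving /= /kf /=.
  by case: (boolP (0 <= yn n.+1 w <= L)) => h /=; rewrite ?andbF ?mul0r ?mulr0.
have mtau : measurable_fun setT (fun w => c * T n w) by exact: measurable_funM.
rewrite (Rintegral_freeze (mC (p := n.+1) (q := n)) (measurable_funP (turn n)) (@law_turn n) (@bmeas_turn _ (g_sigma_algebraType (C n.+1 n)) R J0 T turn c L x y n.+1 n (@pJ0 n.+1 n) (@pT n.+1 n) (@pturn n.+1 n) j0 kf nk n (ltnSn n) (leqnn n))).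
transitivity (\int[P]_w (surv n w * lmean f (dirn n w) (xn n w + dir_x R (dirn n w) * (c * T n w), yn n w + dir_y R (dirn n w) * (c * T n w)))).
  congr Rintegral; apply/funext => w; rewrite Rintegral_turn/= -leg_xS -leg_yS /leg_mean /kf/=.
  by case: ifP => _; ring.
rewrite (@Rintegral_freeze _ Omega R P (C n n) (@mC n n) _ (measurableTypeR R) (fun w => c * T n w) mtau (expo a0) (@law_wait n) 1 _ (@bmeas_move _ (g_sigma_algebraType (C n n)) R J0 T turn c L x y n n (@pJ0 n n) (@pT n n) (@pturn n n) j0 _ nm n (leqnn n) (leqnn n))).
congr Rintegral; apply/funext => w /=; rewrite (prob_Z _ _ (M := 1))//.
have [mf f1] := bmeas_leg (dirn n w) nm; split => //.
  exact: measurableT_comp mf (pair1_measurable (xn n w, yn n w)).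
by move=> r; exact: (f1 ((xn n w, yn n w), r)).
Qed.

Lemma state_meanE n f : 0 <= y <= L -> bounded_family f -> state_mean n f = 4^-1 * iter n lop f j0 (x, y).
Proof.
move=> yL; elim: n f => [|n IH] f nf; first exact: state_mean0.
by rewrite state_meanS// IH; [rewrite iterSr|exact: bounded_leg_op].
Qed.

Variable A : set R.
Hypothesis mA : measurable A.

(** The event that the motion starts in direction j0 and leaves the strip
    through the lower side, in A, during the n-th leg. *)
Definition exit_leg n : set Omega :=
  [set w | [/\ J0 w = j0, aliven n w, dirn n w = 3, yn n w < c * T n w & A (xn n w)]].

(** The indicator of exit_leg is surviving times this function of the end
    point of the leg: the end point has a negative height, and a downward leg
    keeps its abscissa. *)
Let crossing (j : 'Z_4) (u : R * R) : R :=
  if j == 3 then (if u.2 < 0 then 1 else 0) * \1_A u.1 else 0.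

Let bounded_crossing : bounded_family crossing.
Proof.
move=> j; rewrite /crossing; case: (j == 3); last by split => // u; rewrite normr0.
split.
  apply: measurable_funM; last first.
    have mi : measurable_fun setT (\1_A : R -> R) by exact: measurable_indic.
    exact: (measurableT_comp mi measurable_fst).
  by apply: measurable_fun_ifT => //; apply: measurable_fun_ltr => //; exact: measurable_snd.
move=> u; rewrite normrM; have [_ /(_ u.1) i1] := bmeas_indic R mA.
rewrite -[leRHS]mulr1; apply: ler_pM => //.
by case: ifP; rewrite ?normr1 ?normr0.
Qed.

Let exit_legE n w : \1_(exit_leg n) w = surv n w * crossing (dirn n w)
  (xn n w + dir_x R (dirn n w) * (c * T n w), yn n w + dir_y R (dirn n w) * (c * T n w)).
Proof.
rewrite indicE /crossing /surviving /=.
have [d3|d3] := eqVneq (dirn n w) 3; last first.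
  by rewrite mulr0 memNset//= => -[_ _ /eqP]; rewrite (negbTE d3).
rewrite d3 dir_x3 dir_y3 mul0r addr0 mulN1r subr_lt0 indicE.
have [J|J] := eqVneq (J0 w) j0; last first.
  by rewrite mul0r memNset//= => -[/eqP]; rewrite (negbTE J).
have [al|al] := boolP (aliven n w); last first.
  by rewrite mul0r memNset//= => -[_]; rewrite (negbTE al).
have [yT|yT] := boolP (yn n w < c * T n w); last first.
  by rewrite mul0r mulr0 memNset//= => -[_ _ _]; rewrite (negbTE yT).
by rewrite !mul1r; congr (nat_of_bool _)%:R; apply/idP/idP; rewrite !inE => //= -[].
Qed.

Lemma measurable_exit_leg n : measurable (exit_leg n).
Proof.
have mtau : measurable_fun setT (fun w => c * T n w) by exact: measurable_funM.
have mT k : (k < n)%N -> measurable_fun setT (T k) by [].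
have mt k b : (k < n)%N -> measurable (turn k @^-1` [set b]).
  by move=> _; rewrite -[X in measurable X]setTI; exact: measurable_funP.
have [mf _] := @bmeas_move _ Omega R J0 T turn c L x y n n (initial_measurable driver) mT mt j0 _ bounded_crossing n (leqnn n) (leqnn n).
have m2 : measurable_fun setT (fun w : Omega => (w, c * T n w)) by exact: measurable_fun_pair.
have := measurableT_comp mf m2 measurableT (measurable_set1 (1 : R)).
rewrite setTI; congr measurable; apply/seteqP; split => w /=.
  by rewrite -exit_legE indicE => /eqP; rewrite pnatr_eq1 eqb1 inE.
by move=> ew; rewrite -exit_legE indicE mem_set.
Qed.

(** Freezing the past at the start of the n-th leg and averaging its length
    turns crossing into last_leg; state_meanE then moves the n previous legs
    onto the initial state. *)
Lemma prob_exit_leg n : 0 <= y <= L ->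
  P (exit_leg n) = (4^-1 * iter n lop (last_leg (lambda / c) L A) j0 (x, y))%:E.
Proof.
move=> yL; rewrite -(state_meanE n yL (bounded_last_leg L a0 mA)).
have me := measurable_exit_leg n.
have mtau : measurable_fun setT (fun w => c * T n w) by exact: measurable_funM.
rewrite -[LHS]fineK ?fin_num_measure//; congr EFin.
transitivity (\int[P]_w \1_(exit_leg n) w); first by rewrite /Rintegral integral_indic// setIT.
transitivity (\int[P]_w (surv n w * crossing (dirn n w)
  (xn n w + dir_x R (dirn n w) * (c * T n w), yn n w + dir_y R (dirn n w) * (c * T n w)))).
  by congr Rintegral; apply/funext => w; rewrite -exit_legE.
rewrite (@Rintegral_freeze _ Omega R P (C n n) (@mC n n) _ (measurableTypeR R) (fun w => c * T n w) mtau (expo a0) (@law_wait n) 1 _ (@bmeas_move _ (g_sigma_algebraType (C n n)) R J0 T turn c L x y n n (@pJ0 n n) (@pT n n) (@pturn n n) j0 _ bounded_crossing n (leqnn n) (leqnn n))).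
congr Rintegral; apply/funext => w /=; rewrite (prob_Z _ _ (M := 1)); last first.
  have [mf f1] := bmeas_leg (dirn n w) bounded_crossing; split => //.
    exact: measurableT_comp mf (pair1_measurable (xn n w, yn n w)).
  by move=> r; exact: (f1 ((xn n w, yn n w), r)).
rewrite /surviving; case: (boolP (aliven n w)) => al; last by rewrite andbF !mul0r.
congr (_ * _); rewrite /last_leg /crossing.
have [d3|d3] := eqVneq (dirn n w) 3; last exact: prob_cst.
have /andP[y0 yL'] := alive_y al.
rewrite d3 dir_x3 dir_y3/= /killed y0 yL' /=.
transitivity (\int[expo a0]_r (\1_A (xn n w) * \1_(`]yn n w, +oo[%classic) r)).
  congr Rintegral; apply/funext => r; rewrite mul0r addr0 mulN1r subr_lt0 mulrC; congr (_ * _).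
  by rewrite indicE mem_setE in_itv/= andbT; case: ifP.
rewrite (prob_Z _ _ (M := 1)); last exact: bmeas_indic.
rewrite mulrC; congr (_ * _).
transitivity (fine (expo a0 `]yn n w, +oo[%classic)).
  by rewrite /Rintegral integral_indic// setIT.
by rewrite expo_tail//= mulNr.
Qed.

End markov.

(** * Separation of the horizontal and vertical coordinates *)

Lemma one_neqN1 (R : realType) : ((1 : R) == -1) = false.
Proof. by apply/negbTE; rewrite eq_sym lt_eqF// (lt_trans _ ltr01)// oppr_lt0. Qed.

Section kernel.
Context (R : realType) (a L : R) (a0 : 0 < a).
Local Notation lop := (leg_op L a0).
Variable A : set R.
Hypothesis mA : measurable A.

(** Vertical factor of the kernel for a motion that starts with a vertical leg
    of sign s. For k = 0 the first leg is the exiting one, which requires s =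
    - 1. *)
Definition vertical_weight (s : R) (k : nat) : R -> R :=
  if k is k'.+1 then shift_mean a0 s (exit_weight a0 L k')
  else if s == -1 then killed L (fun v => expR (- (a * v))) else fun=> 0.

Let leg_op_vertical (f : 'Z_4 -> R * R -> R) (V1 V3 S : R -> R) (M : R) : bmeas M S ->
  (forall u, f 0 u = 0) -> (forall u, f 1 u = V1 u.2 * S u.1) ->
  (forall u, f 2 u = 0) -> (forall u, f 3 u = V3 u.2 * S u.1) ->
  forall u, [/\ lop f 0 u = killed L (fun y => 2^-1 * (V1 y + V3 y)) u.2 * shift_mean a0 1 S u.1,
    lop f 1 u = 0, lop f 2 u = killed L (fun y => 2^-1 * (V1 y + V3 y)) u.2 * shift_mean a0 (-1) S u.1
    & lop f 3 u = 0].
Proof.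
move=> bS f0 f1 f2 f3 [p q]; rewrite /lop /leg_mean /=.
have hor s (V : R) : \int[expo a0]_r (V * S (p + s * r)) = V * shift_mean a0 s S p.
  exact: (prob_Z (expo a0) V (bmeas_shift s p bS)).
split.
- rewrite -hor; congr Rintegral; apply/funext => r.
  rewrite dir_x0 dir_y0 mul0r addr0 !Z4_steps f1 f3 /= /killed; case: ifP => _; rewrite ?mul0r//; ring.
- rewrite -[RHS](prob_cst (expo a0) 0); congr Rintegral; apply/funext => r.
  by rewrite !Z4_steps f0 f2 addr0 mulr0; case: ifP.
- rewrite -hor; congr Rintegral; apply/funext => r.
  rewrite dir_x2 dir_y2 mul0r addr0 !Z4_steps f1 f3 /= /killed; case: ifP => _; rewrite ?mul0r//; ring.
- rewrite -[RHS](prob_cst (expo a0) 0); congr Rintegral; apply/funext => r.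
  by rewrite !Z4_steps f0 f2 addr0 mulr0; case: ifP.
Qed.

Let leg_op_horizontal (f : 'Z_4 -> R * R -> R) (q S0 S2 : R -> R) (M : R) : bmeas M q ->
  (forall y, ~~ (0 <= y <= L) -> q y = 0) ->
  (forall u, f 0 u = q u.2 * S0 u.1) -> (forall u, f 1 u = 0) ->
  (forall u, f 2 u = q u.2 * S2 u.1) -> (forall u, f 3 u = 0) ->
  forall u, [/\ lop f 0 u = 0, lop f 1 u = shift_mean a0 1 q u.2 * (2^-1 * (S0 u.1 + S2 u.1)),
    lop f 2 u = 0 & lop f 3 u = shift_mean a0 (-1) q u.2 * (2^-1 * (S0 u.1 + S2 u.1))].
Proof.
move=> bq q0 f0 f1 f2 f3 [x y]; rewrite /lop /leg_mean /=.
have ver s (V : R) : \int[expo a0]_r (V * q (y + s * r)) = V * shift_mean a0 s q y.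
  exact: (prob_Z (expo a0) V (bmeas_shift s y bq)).
split.
- rewrite -[RHS](prob_cst (expo a0) 0); congr Rintegral; apply/funext => r.
  by rewrite !Z4_steps f1 f3 addr0 mulr0; case: ifP.
- rewrite mulrC -ver; congr Rintegral; apply/funext => r.
  rewrite dir_x1 dir_y1 mul0r addr0 !Z4_steps f0 f2 /=.
  by case: ifPn => [_|/q0 ->]; rewrite ?mulr0//; ring.
- rewrite -[RHS](prob_cst (expo a0) 0); congr Rintegral; apply/funext => r.
  by rewrite !Z4_steps f1 f3 addr0 mulr0; case: ifP.
- rewrite mulrC -ver; congr Rintegral; apply/funext => r.
  rewrite dir_x3 dir_y3 mul0r addr0 !Z4_steps f0 f2 /=.
  by case: ifPn => [_|/q0 ->]; rewrite ?mulr0//; ring.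
Qed.

Let q_outside k y : ~~ (0 <= y <= L) -> exit_weight a0 L k y = 0.
Proof. by move=> /negbTE h; case: k => [|k]; rewrite /= /killed_step /killed h. Qed.

Let q_vert k y : exit_weight a0 L k y = killed L (fun v => 2^-1 * (vertical_weight 1 k v + vertical_weight (-1) k v)) y.
Proof.
case: k => [|k] //=; rewrite eqxx /killed; case: ifP => // h.
rewrite one_neqN1.
by rewrite add0r mulrC.
Qed.

Local Notation fl n := (iter n lop (last_leg a L A)).

(** Horizontal and vertical legs alternate whatever the turns are, and each
    new sign is fair and independent of the others, so the kernel is a product
    of a vertical and a horizontal factor. The last leg goes down, so only the
    parity of the number of legs that matches the initial direction
    contributes. *)
Lemma iter_leg_op k u :
  [/\ fl k.*2 0 u = 0,
      fl k.*2 1 u = vertical_weight 1 k u.2 * walk_law a0 A k u.1,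
      fl k.*2 2 u = 0 &
      fl k.*2 3 u = vertical_weight (-1) k u.2 * walk_law a0 A k u.1] /\
  [/\ fl k.*2.+1 0 u = exit_weight a0 L k u.2 * shift_mean a0 1 (walk_law a0 A k) u.1,
      fl k.*2.+1 1 u = 0,
      fl k.*2.+1 2 u = exit_weight a0 L k u.2 * shift_mean a0 (-1) (walk_law a0 A k) u.1 &
      fl k.*2.+1 3 u = 0].
Proof.
have odd_of_even m : (forall u, [/\ fl m.*2 0 u = 0,
      fl m.*2 1 u = vertical_weight 1 m u.2 * walk_law a0 A m u.1,
      fl m.*2 2 u = 0 &
      fl m.*2 3 u = vertical_weight (-1) m u.2 * walk_law a0 A m u.1]) ->
  forall u, [/\ fl m.*2.+1 0 u = exit_weight a0 L m u.2 * shift_mean a0 1 (walk_law a0 A m) u.1,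
      fl m.*2.+1 1 u = 0,
      fl m.*2.+1 2 u = exit_weight a0 L m u.2 * shift_mean a0 (-1) (walk_law a0 A m) u.1 &
      fl m.*2.+1 3 u = 0].
  move=> h v; rewrite !q_vert iterS.
  by apply: (leg_op_vertical (bmeas_walk_law a0 m mA)) => z; case: (h z).
suff ev m : forall u, [/\ fl m.*2 0 u = 0,
      fl m.*2 1 u = vertical_weight 1 m u.2 * walk_law a0 A m u.1,
      fl m.*2 2 u = 0 &
      fl m.*2 3 u = vertical_weight (-1) m u.2 * walk_law a0 A m u.1].
  by split; [exact: ev|exact: odd_of_even].
elim: m => [|m IH] v.
  rewrite /= /last_leg /= eqxx.
  rewrite one_neqN1.
  by rewrite mul0r.
have od := odd_of_even m IH.
rewrite doubleS iterS /=.
by apply: (leg_op_horizontal (bmeas_exit_weight a0 L m) (q_outside m)) => z; case: (od z).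
Qed.

End kernel.

(** * The null set of degenerate paths *)

Section almost_sure.
Context d (Omega : measurableType d) (R : realType) (P : probability Omega R).
Variables (lambda : R) (J0 : Omega -> 'Z_4) (T : nat -> {RV P >-> R}) (turn : nat -> {RV P >-> bool}).
Hypotheses (l0 : 0 < lambda) (driver : motion_driver lambda J0 T turn).

(** Paths on which every leg has positive duration and the event times are
    unbounded, since infinitely many durations exceed 1. *)
Definition good : set Omega :=
  [set w | (forall k, 0 < T k w) /\ (forall m, exists2 k, (m <= k)%N & 1 < T k w)].

Let p : R := 1 - expR (- lambda).

Let short_prob k r : 0 <= r -> P (T k @^-1` `]-oo, r]) = (1 - expR (- lambda * r))%:E.
Proof.
move=> r0; have -> : T k @^-1` `]-oo, r] = ~` (T k @^-1` `]r, +oo[).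
  by rewrite preimage_setC setCitvr.
have mr : measurable (`]r, +oo[%classic : set R) by exact: measurable_itv.
have m1 : measurable (T k @^-1` `]r, +oo[).
  by rewrite -[X in measurable X]setTI; exact: measurable_funP.
rewrite probability_setC//.
have := waiting_exponential driver k mr; rewrite /distribution /pushforward => ->.
by rewrite -(expoE l0) expo_tail// -EFinB.
Qed.

Fixpoint waits (m n : nat) : {fset option (nat + nat)} :=
  if n is n'.+1 then (Some (inl (m + n')%N) |` waits m n')%fset else fset0.

Let waitsP m n i : i \in waits m n -> exists2 k, (k < n)%N & i = Some (inl (m + k)%N).
Proof.
elim: n => [|n IH]; first by rewrite /= inE.
rewrite [waits _ _]/= in_fset1U => /predU1P[->|/IH[k kn ->]]; first by exists n.
by exists k => //; exact: leqW.
Qed.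

Let E (i : option (nat + nat)) : set Omega :=
  if i is Some (inl k) then T k @^-1` `]-oo, 1%R] else setT.

Let prob_waits m n : P (\bigcap_(i in [set` waits m n]) E i) = (p ^+ n)%:E.
Proof.
rewrite (driver_independent driver); last first.
  move=> i /waitsP[k _ ->] /=; exists `]-oo, 1%R]%classic; rewrite ?setTI//; exact: measurable_itv.
elim: n => [|n IH]; first by rewrite big_seq_fset0.
rewrite big_fsetU1/= ?IH ?short_prob// ?mulr1 ?exprS ?EFinM//.
by apply/negP => /waitsP[k kn] [] /addnI e; rewrite e ltnn in kn.
Qed.

(** A waiting time is almost surely positive, and by independence n given ones
    are all at most 1 with probability (1 - exp (- lambda))^n, which tends to
    0. *)
Lemma good_ae : P.-negligible (~` good).
Proof.
have mT k r : measurable (T k @^-1` `]-oo, r]).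
  by rewrite -[X in measurable X]setTI; exact: measurable_funP.
pose N1 k := T k @^-1` `]-oo, 0%R].
pose N2 m := \bigcap_(n in setT) (T (m + n)%N @^-1` `]-oo, 1%R]).
have mN2 m : measurable (N2 m) by exact: bigcap_measurable.
have N1z k : P (N1 k) = 0%E by rewrite short_prob// mulr0 expR0 subrr.
have N2z k : P (N2 k) = 0%E.
  have p0 : 0 <= p by rewrite subr_ge0 -expR0 ler_expR oppr_le0 ltW.
  have p1 : p < 1 by rewrite ltrBlDr ltrDl expR_gt0.
  have le n : fine (P (N2 k)) <= p ^+ n.
    rewrite -lee_fin fineK ?fin_num_measure// -(prob_waits k n); apply: le_measure; rewrite ?inE//.
    - rewrite bigcap_fset; apply: big_ind => //; first by move=> A B; exact: measurableI.
      by move=> [[i|i]|] _ //=; exact: mT.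
    - by move=> w Nw i /= /waitsP[j _ ->]; exact: Nw.
  rewrite -[LHS]fineK ?fin_num_measure//; congr EFin; apply/eqP; rewrite eq_le fine_ge0// andbT.
  have cv : p ^+ n @[n --> \oo] --> (0 : R) by apply: cvg_expr; rewrite ger0_norm.
  rewrite -(cvg_lim _ cv)//; apply: limr_ge; first by apply/cvg_ex; exists 0.
  by apply: nearW.
apply: (negligibleS (A := (\bigcup_k N1 k) `|` (\bigcup_m N2 m))); last first.
  by apply: negligibleU; apply: negligible_bigcup => k; apply/negligibleP => //; [exact: mT|exact: N1z|exact: N2z].
move=> w /= /not_andP[/existsNP[k /negP]|/existsNP[m H]].
  by rewrite -leNgt => h; left; exists k => //=; rewrite in_itv/=.
right; exists m => // n _ /=; rewrite in_itv/= leNgt; apply/negP => h.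
by apply: H; exists (m + n)%N => //; exact: leq_addr.
Qed.

End almost_sure.

(** Used with one term of each pair equal to 0, by the parity of the number of
    legs. *)
Lemma nneseries_pair (R : realType) (f : nat -> \bar R) : (forall n, 0 <= f n)%E ->
  (\sum_(n <oo) f n = \sum_(k <oo) (f k.*2 + f k.*2.+1))%E.
Proof.
move=> f0; apply/esym/cvg_lim => //.
have cvf : (fun n => \sum_(0 <= i < n) f i)%E @ \oo --> (\sum_(n <oo) f n)%E by exact: is_cvg_nneseries.
have dbl : (fun n => n.*2) @ \oo --> \oo.
  move=> A [N _ NA]; exists N => // n /= Nn; apply: NA => /=.
  by rewrite -addnn; exact: leq_trans Nn (leq_addr _ _).
rewrite (_ : (fun n => _) = (fun n => \sum_(0 <= i < n) f i)%E \o (fun n => n.*2)).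
  exact: cvg_comp dbl cvf.
apply/funext => n /=; elim: n => [|n IH]; first by rewrite !big_geq.
by rewrite big_nat_recr//= IH doubleS !big_nat_recr//= addeA.
Qed.

(** * The exit law as a series over the legs *)

Section law.
Context d (Omega : measurableType d) (R : realType) (P : probability Omega R).
Variables (lambda c L : R) (J0 : Omega -> 'Z_4) (T : nat -> {RV P >-> R}) (turn : nat -> {RV P >-> bool}).
Hypotheses (l0 : 0 < lambda) (c0 : 0 < c) (L0 : 0 < L) (driver : motion_driver lambda J0 T turn).
Variables (a0 : 0 < lambda / c) (x y : R).
Hypotheses (y0 : 0 <= y) (yL : y <= L).
Variables (j0 : 'Z_4) (A : set R).
Hypothesis mA : measurable A.
Local Notation D := (direction J0 T turn).
Local Notation X := (position_x c x D).
Local Notation Y := (position_y c y D).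
Local Notation exit_leg := (exit_leg c L J0 T turn x y j0 A).

Let mJ0 := initial_measurable driver.
Let mT k : measurable_fun setT (T k). Proof. by []. Qed.
Let mturn k b : measurable (turn k @^-1` [set b]).
Proof. by rewrite -[X in measurable X]setTI; exact: measurable_funP. Qed.

Lemma probability_eq_good (E1 E2 : set Omega) : measurable E1 -> measurable E2 ->
  (forall w, good T w -> E1 w <-> E2 w) -> P E1 = P E2.
Proof.
move=> m1 m2 h; have [N [mN N0 bN]] := good_ae l0 driver.
rewrite -(measureU0 m1 mN N0) -(measureU0 m2 mN N0); congr (P _).
apply/seteqP; split => w [Ew|Nw]; try by right.
  by have [g|ng] := pselect (good T w); [left; exact/h|right; exact: bN].
by have [g|ng] := pselect (good T w); [left; exact/h|right; exact: bN].
Qed.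

Let mexit : measurable (lower_exit (strip L) X Y A).
Proof.
apply: (@measurable_lower_exit _ _ _ L c) => //.
- apply: measurable_funD => //; apply: measurable_funM => //.
  exact: (@measurable_pos _ _ _ (fun u => dir_x R (D u.1 u.2)) (measurable_fun_direction mJ0 mT mturn (dir_x R)) (fun u => normr_dir_x_le1 R _)).
- apply: measurable_funD => //; apply: measurable_funM => //.
  exact: (@measurable_pos _ _ _ (fun u => dir_y R (D u.1 u.2)) (measurable_fun_direction mJ0 mT mturn (dir_y R)) (fun u => normr_dir_y_le1 R _)).
- move=> w s t s0 st; rewrite /position_y opprD addrACA subrr add0r -mulrBr normrM gtr0_norm// ler_pM2l//.
  exact: (@pos_lipschitz _ _ _ (fun u => dir_y R (D u.1 u.2)) (measurable_fun_direction mJ0 mT mturn (dir_y R)) (fun u => normr_dir_y_le1 R _)).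
Qed.

Let mstart : measurable [set w | D 0 w = j0].
Proof.
have := measurable_direction mJ0 mT mturn j0.
have m2 : measurable_fun setT (fun w : Omega => ((0 : R), w)) by exact: measurable_fun_pair.
by move=> /(m2 measurableT); rewrite setTI.
Qed.

Let mleg n : measurable (exit_leg n).
Proof. exact: (@measurable_exit_leg _ _ _ _ _ c L _ _ _ driver x y j0 A mA n). Qed.

Let prob_start : P [set w | D 0 w = j0] = (4^-1)%:E.
Proof.
rewrite -(initial_uniform driver j0); apply: probability_eq_good => // w [T0 _] /=.
by rewrite (direction_start J0 turn T0).
Qed.

Let exit_leg_trivIset : trivIset setT exit_leg.
Proof.
apply/trivIsetP.
suff H m n w : (m < n)%N -> exit_leg m w -> exit_leg n w -> False.
  move=> m n _ _ mn; apply/seteqP; split => // w [em en].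
  by move: mn; rewrite neq_ltn => /orP[mn|nm]; [exact: (H _ _ w mn)|exact: (H _ _ w nm)].
move=> mn [_ _ d3 yT _] [_ al _ _ _].
have := alive_y (alive_le mn al); rewrite leg_yS d3 dir_y3 mulN1r subr_ge0 => /andP[+ _].
by rewrite leNgt yT.
Qed.

(** Off a null set the lower exit is the disjoint union over n of the events
    exit_leg n. Conditioning on the initial direction, which has probability 1
    / 4, cancels the factor 1 / 4 in prob_exit_leg. *)
Lemma lower_exit_law_series : lower_exit_law P c L x y D j0 A =
  (\sum_(n <oo) (iter n (leg_op L a0) (last_leg (lambda / c) L A) j0 (x, y))%:E)%E.
Proof.
have yy : 0 <= y <= L by rewrite y0.
rewrite /lower_exit_law /cond_prob prob_start.
have -> : P (lower_exit (strip L) X Y A `&` [set w | D 0 w = j0]) = P (\bigcup_n exit_leg n).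
  apply: probability_eq_good; [exact: measurableI|exact: bigcupT_measurable|].
  move=> w [T0 T1] /=; rewrite (direction_start J0 turn T0); split.
    move=> [/(lower_exitP x mJ0 mT mturn c0 L0 y0 yL T0 T1)[n [? ? ? ?]] J]; exists n => //.
  by move=> [n _ [J ? ? ? ?]]; split => //; apply/(lower_exitP x mJ0 mT mturn c0 L0 y0 yL T0 T1); exists n.
have mU : measurable (\bigcup_n exit_leg n) by exact: bigcupT_measurable.
rewrite invrK EFinM fineK ?fin_num_measure// measure_semi_bigcup//.
rewrite muleC -nneseriesZl//.
apply: eq_eseriesr => n _.
apply: (etrans (congr1 (fun z => (4%:E * z)%E) (prob_exit_leg l0 c0 driver a0 x j0 mA n yy))).
by rewrite -EFinM mulrA mulfV ?mul1r// pnatr_eq0.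
Qed.

End law.

(** * The exit densities *)

(** The density is the mixture itself; the improper integral is only asked for
    off the null set {x}, where the one-sided densities have their jump. *)
Lemma mixture_density_formula (R : realType) (a : R) (a0 : 0 < a) (nu sing : set R -> \bar R) (K C x : R)
    (f : R -> R -> R) (p : nat -> R) (G : nat -> R -> R) :
  (forall k, 0 <= p k) -> (forall n, \sum_(k < n) p k <= C) ->
  (forall k, bmeas a (G k)) -> (forall k z, 0 <= G k z) -> K != 0 ->
  (forall A, measurable A -> nu A = (sing A +
     \sum_(k <oo) (p k)%:E * \int[lebesgue_measure]_(z in A) (G k (z - x))%:E)%E) ->
  (forall z, z != x -> improper_integral01 (f z) (K^-1 * mixdens p G (z - x))) ->
  density_formula nu sing K f.
Proof.
move=> p0 pC bG G0 K0 nuE If; exists (fun z => mixdens p G (z - x)); split.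
- apply: (measurableT_comp (measurable_mixdens a0 p0 pC bG G0)).
  by apply: measurable_funB.
- by move=> z; exact: (mixdens_ge0 a0 p0 pC bG G0).
- by move=> A mA; rewrite nuE// (mixdens_law a0 p0 pC bG G0).
- exists [set x]; split => //; first exact: lebesgue_measure_set1.
  move=> z /= H; apply: contrapT => /eqP zx; apply: H.
  by exists (K^-1 * mixdens p G (z - x)); [exact: If|rewrite mulrA mulfV// mul1r].
Qed.

Section formulas.
Context (R : realType) (d : measure_display) (Omega : measurableType d) (P : probability Omega R).
Variables (lambda c L : R) (J0 : Omega -> 'Z_4) (T : nat -> {RV P >-> R}) (turn : nat -> {RV P >-> bool}).
Hypotheses (l0 : 0 < lambda) (c0 : 0 < c) (L0 : 0 < L) (driver : motion_driver lambda J0 T turn).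
Variables (x y : R).
Hypotheses (y0 : 0 < y) (yL : y < L).
Local Notation a := (lambda / c).
Variable a0 : 0 < a.
Local Notation law := (lower_exit_law P c L x y (direction J0 T turn)).
Local Notation q := (exit_weight a0 L).
Local Notation mu := (@lebesgue_measure R).

Let yy : 0 <= y <= L. Proof. by rewrite !ltW. Qed.

Let walk_law_ge0 A k z : measurable A -> 0 <= walk_law a0 A k z.
Proof.
move=> mA; elim: k z => [|k IH] z /=; first by rewrite indicE.
exact: laplace_mean_ge0.
Qed.

(** Starting horizontally, the first leg has the sign s of the initial
    direction, and after it the height contributes the exit weight at y. *)
Lemma horizontal_law s j A : (j, s) \in [:: (0 : 'Z_4, 1 : R); (2, -1)] -> measurable A ->
  law j A = (\sum_(k <oo) (q k y)%:E * \int[mu]_(z in A) (first_dens a0 s k (z - x))%:E)%E.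
Proof.
move=> js mA; rewrite (lower_exit_law_series l0 c0 L0 driver a0 x (ltW y0) (ltW yL) j mA).
have [s1 H] : s ^+ 2 = 1 /\ forall k, iter k.*2 (leg_op L a0) (last_leg a L A) j (x, y) = 0 /\
    iter k.*2.+1 (leg_op L a0) (last_leg a L A) j (x, y) = q k y * shift_mean a0 s (walk_law a0 A k) x.
  move: js; rewrite !inE => /orP[] /eqP[-> ->]; split; rewrite ?expr1n ?sqrrN ?expr1n// => k.
    by have [[-> _ _ _] [-> _ _ _]] := iter_leg_op L a0 mA k (x, y).
  by have [[_ _ -> _] [_ _ -> _]] := iter_leg_op L a0 mA k (x, y).
have nn n : (0 <= (iter n (leg_op L a0) (last_leg a L A) j (x, y))%:E)%E.
  rewrite lee_fin -(odd_double_half n); have [H0 H1] := H n./2.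
  case: (odd n); rewrite ?add0n ?add1n ?H0// H1 mulr_ge0 ?exit_weight_ge0//.
  by apply: shift_mean_ge0 => z; exact: walk_law_ge0.
rewrite nneseries_pair//; apply: eq_eseriesr => k _; have [-> ->] := H k.
by rewrite add0e EFinM (shift_walk_law_density a0 _ _ mA s1).
Qed.

(** Starting vertically, either the first leg already exits, with abscissa x,
    which is the atom of the downward direction, or it is followed by a
    horizontal leg of fair sign. *)
Lemma vertical_law s j A : (j, s) \in [:: (1 : 'Z_4, 1 : R); (3, -1)] -> measurable A ->
  law j A = ((vertical_weight L a0 s 0 y * \1_A x)%:E +
    \sum_(k <oo) (shift_mean a0 s (q k) y)%:E * \int[mu]_(z in A) (walk_dens a0 k (z - x))%:E)%E.
Proof.
move=> js mA; rewrite (lower_exit_law_series l0 c0 L0 driver a0 x (ltW y0) (ltW yL) j mA).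
have H k : iter k.*2 (leg_op L a0) (last_leg a L A) j (x, y) = vertical_weight L a0 s k y * walk_law a0 A k x /\
    iter k.*2.+1 (leg_op L a0) (last_leg a L A) j (x, y) = 0.
  move: js; rewrite !inE => /orP[] /eqP[-> ->].
    by have [[_ -> _ _] [_ -> _ _]] := iter_leg_op L a0 mA k (x, y).
  by have [[_ _ _ ->] [_ _ _ ->]] := iter_leg_op L a0 mA k (x, y).
have vert_ge0 k : 0 <= vertical_weight L a0 s k y.
  case: k => [|k] /=; last by apply: shift_mean_ge0 => z; exact: exit_weight_ge0.
  by case: ifP => // _; rewrite /killed; case: ifP => // _; exact: expR_ge0.
have nn n : (0 <= (iter n (leg_op L a0) (last_leg a L A) j (x, y))%:E)%E.
  rewrite lee_fin -(odd_double_half n); have [H0 H1] := H n./2.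
  by case: (odd n); rewrite ?add0n ?add1n ?H1// H0 mulr_ge0// walk_law_ge0.
rewrite nneseries_recl// -(nneseries_addn 1)//.
have [-> _] := H 0%N; congr (_ + _)%E.
rewrite nneseries_pair; last by move=> n; exact: nn.
apply: eq_eseriesr => k _; rewrite !addn1 -doubleS; have [_ ->] := H k; have [-> _] := H k.+1.
by rewrite add0e EFinM (walk_law_density a0 _ _ mA).
Qed.

Let shift_q_ge0 s k : 0 <= shift_mean a0 s (q k) y.
Proof. by apply: shift_mean_ge0 => z; exact: exit_weight_ge0. Qed.

Let shift_q_sum s n : \sum_(k < n) shift_mean a0 s (q k) y <= 1.
Proof.
have bq k : bmeas 1 (q k) by exact: bmeas_exit_weight.
rewrite -(@shift_mean_sum _ _ a0 s 1 q n y bq).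
apply: le_trans (shift_mean_le a0 s y (bmeas_sum n bq) (bmeas_cst _ (1 : R)) (fun z => exit_weight_sum_le a0 L n z)) _.
by rewrite /shift_mean prob_cst.
Qed.

Let theta z w := (z - x) * lambda * w / (c * Num.sqrt (1 - w ^+ 2)).
Let den w := (1 + w) ^+ 2 * expR (lambda * L / c * w) - (1 - w) ^+ 2 * expR (- (lambda * L / c * w)).
Let h := lambda * (L - y) / c.
Let K := lambda / (c * pi).

Let thetaE z w : theta z w = (z - x) * (a * al w).
Proof. by rewrite /theta /al /rt invfM; ring. Qed.

Let denE w : den w = exit_den a L w.
Proof. by rewrite /den /exit_den (_ : lambda * L / c = a * L)//; ring. Qed.

Let hE w : h * w = a * (L - y) * w.
Proof. by rewrite /h; ring. Qed.

Let K_neq0 : K != 0.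
Proof. by rewrite mulf_neq0 ?invr_neq0 ?mulf_neq0 ?gt_eqF// pi_gt0. Qed.

Let KV : K^-1 = pi / a.
Proof. by rewrite /K !invfM !invrK; ring. Qed.

Lemma horizontal_formula s j : (j, s) \in [:: (0 : 'Z_4, 1 : R); (2, -1)] ->
  density_formula (law j) (fun=> 0%E) K
    (fun z w => (Num.sqrt (1 - w ^+ 2) * cos (theta z w) + s * (w * sin (theta z w))) / (1 - w ^+ 2)
       * (((1 + w) * expR (h * w) - (1 - w) * expR (- (h * w))) / den w)).
Proof.
move=> js; have s1 : s ^+ 2 = 1.
  by move: js; rewrite !inE => /orP[] /eqP[_ ->]; rewrite ?expr1n ?sqrrN ?expr1n.
apply: (@mixture_density_formula R a a0 _ _ K 1 x _ (fun k => q k y) (first_dens a0 s)) => //.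
- by move=> k; exact: exit_weight_ge0.
- by move=> n; exact: exit_weight_sum_le.
- by move=> k; exact: bmeas_first_dens.
- by move=> k z; exact: first_dens_ge0.
- by move=> A mA; rewrite add0e (horizontal_law js mA).
move=> z zx; rewrite KV.
have pS w : 0 < w < 1 -> \sum_(k < n) q k y * (1 - w ^+ 2) ^+ k @[n --> \oo] --> exit_gf a L w y.
  by move=> w01; exact: exit_series_cvg.
have zx0 : z - x != 0 by rewrite subr_eq0.
have := first_mixture_improper a0 (fun k => exit_weight_ge0 a0 L k y) (fun n => exit_weight_sum_le a0 L n y) pS s1 zx0.
apply: improper_integral01_eq => w w01.
by rewrite /exit_gf /killed yy /exit_num denE thetaE !hE.
Qed.

Let shift_pS s w : 0 < w < 1 ->
  \sum_(k < n) shift_mean a0 s (q k) y * (1 - w ^+ 2) ^+ k @[n --> \oo] --> shift_mean a0 s (exit_gf a L w) y.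
Proof. by move=> w01; exact: exit_shift_series_cvg. Qed.

Lemma upward_formula : density_formula (law 1) (fun=> 0%E) (2 * lambda / (c * pi))
  (fun z w => cos (theta z w) * sinh (h * w) / den w / Num.sqrt (1 - w ^+ 2)).
Proof.
have K2 : 2 * lambda / (c * pi) = 2 * K by rewrite /K mulrA.
rewrite K2.
have js : (1 : 'Z_4, 1 : R) \in [:: (1 : 'Z_4, 1 : R); (3, -1)] by rewrite inE eqxx.
apply: (@mixture_density_formula R a a0 _ _ (2 * K) 1 x _ (fun k => shift_mean a0 1 (q k) y) (walk_dens a0)) => //.
- by move=> k; exact: bmeas_walk_dens.
- by move=> k z; exact: walk_dens_ge0.
- by rewrite mulf_neq0.
- by move=> A mA; rewrite (vertical_law js mA) /= one_neqN1 mul0r.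
move=> z zx.
have := improper_integral01Z 2^-1 (walk_mixture_improper a0 (shift_q_ge0 1) (shift_q_sum 1) (shift_pS (s := 1)) (z - x)).
rewrite mulrA -KV -invfM; apply: improper_integral01_eq => w w01.
rewrite (shift_exit_gf_up a0 L0 w01 yy) denE thetaE -hE -/(rt w).
have /andP[w0 w1] := w01.
have r0 : 0 < rt w by exact/rt_gt0/itv01_itv11.
have D0 : 0 < exit_den a L w by exact: exit_den_gt0.
by field; rewrite !gt_eqF.
Qed.

(** The exponent 3 / 2 is that of (1 - w^2) rt w: the factor 1 - w^2 comes
    from shift_exit_gf_down, and 1 / rt w is the weight of the frequency
    integral. *)
Lemma downward_formula : density_formula (law 3)
  (fun A => ((expR (- (lambda * y / c)))%:E * \d_x A)%E) K
  (fun z w => cos (theta z w)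
     * (((1 + w) ^+ 2 * expR (h * w) - (1 - w) ^+ 2 * expR (- (h * w))) / den w
          - expR (- (lambda * y / c))) / (1 - w ^+ 2) `^ (3 / 2)).
Proof.
have js : (3 : 'Z_4, -1 : R) \in [:: (1 : 'Z_4, 1 : R); (3, -1)] by rewrite !inE eqxx orbT.
apply: (@mixture_density_formula R a a0 _ _ K 1 x _ (fun k => shift_mean a0 (-1) (q k) y) (walk_dens a0)) => //.
- by move=> k; exact: bmeas_walk_dens.
- by move=> k z; exact: walk_dens_ge0.
- move=> A mA; rewrite (vertical_law js mA) /= eqxx /killed yy diracE indicE EFinM.
  by rewrite (_ : lambda * y / c = a * y)//; ring.
move=> z zx; rewrite KV.
have := walk_mixture_improper a0 (shift_q_ge0 (-1)) (shift_q_sum (-1)) (shift_pS (s := -1)) (z - x).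
apply: improper_integral01_eq => w w01.
have /andP[w0 w1] := w01.
have sq0 : 0 < 1 - w ^+ 2 by exact/rt_sub_gt0/itv01_itv11.
have r0 : 0 < rt w by rewrite sqrtr_gt0.
have -> : (1 - w ^+ 2) `^ (3 / 2) = (1 - w ^+ 2) * rt w.
  rewrite (_ : 3 / 2 = 1 + 2^-1); last by field.
  by rewrite powRD ?powRr1 ?powR12_sqrt ?ltW// gt_eqF// implybT.
have := shift_exit_gf_down a0 L0 w01 yy.
rewrite denE thetaE !hE (_ : lambda * y / c = a * y); last by ring.
move=> <-; field.
by rewrite !gt_eqF.
Qed.

End formulas.

Theorem mainTheorem10 (R : realType) (d : measure_display)
    (Omega : measurableType d) (P : probability Omega R)
    (lambda c L : R) (J0 : Omega -> 'Z_4)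
    (T : nat -> {RV P >-> R}) (turn : nat -> {RV P >-> bool})
    (lambda_gt0 : 0 < lambda) (c_gt0 : 0 < c) (L_gt0 : 0 < L)
    (driver : motion_driver lambda J0 T turn)
    (x y : R) (y_gt0 : 0 < y) (y_ltL : y < L) :
  let law := lower_exit_law P c L x y (direction J0 T turn) in
  let theta z w := (z - x) * lambda * w / (c * Num.sqrt (1 - w ^+ 2)) in
  let den w := (1 + w) ^+ 2 * expR (lambda * L / c * w)
             - (1 - w) ^+ 2 * expR (- (lambda * L / c * w)) in
  let h := lambda * (L - y) / c in
  [/\ density_formula (law 1) (fun=> 0%E) (2 * lambda / (c * pi))
        (fun z w => cos (theta z w) * sinh (h * w) / den w
                    / Num.sqrt (1 - w ^+ 2)),
      density_formula (law 3)
        (fun A => ((expR (- (lambda * y / c)))%:E * \d_x A)%E)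
        (lambda / (c * pi))
        (fun z w => cos (theta z w)
           * (((1 + w) ^+ 2 * expR (h * w) - (1 - w) ^+ 2 * expR (- (h * w)))
                / den w - expR (- (lambda * y / c)))
           / (1 - w ^+ 2) `^ (3 / 2)),
      density_formula (law 0) (fun=> 0%E) (lambda / (c * pi))
        (fun z w => (Num.sqrt (1 - w ^+ 2) * cos (theta z w)
                       + w * sin (theta z w)) / (1 - w ^+ 2)
           * (((1 + w) * expR (h * w) - (1 - w) * expR (- (h * w))) / den w))
    & density_formula (law 2) (fun=> 0%E) (lambda / (c * pi))
        (fun z w => (Num.sqrt (1 - w ^+ 2) * cos (theta z w)
                       - w * sin (theta z w)) / (1 - w ^+ 2)
           * (((1 + w) * expR (h * w) - (1 - w) * expR (- (h * w))) / den w))].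
Proof.
have a_gt0 : 0 < lambda / c by rewrite divr_gt0.
move=> law theta den h; split.
- exact: upward_formula a_gt0.
- exact: downward_formula a_gt0.
- have j0 : (0 : 'Z_4, 1 : R) \in [:: (0 : 'Z_4, 1 : R); (2, -1)] by rewrite inE eqxx.
  have := horizontal_formula lambda_gt0 c_gt0 L_gt0 driver x y_gt0 y_ltL a_gt0 j0.
  by congr density_formula; apply/funext => z; apply/funext => w; rewrite mul1r.
- have j2 : (2 : 'Z_4, -1 : R) \in [:: (0 : 'Z_4, 1 : R); (2, -1)] by rewrite !inE eqxx orbT.
  have := horizontal_formula lambda_gt0 c_gt0 L_gt0 driver x y_gt0 y_ltL a_gt0 j2.
  by congr density_formula; apply/funext => z; apply/funext => w; rewrite mulN1r.
Qed.
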